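(* Let $g>1$ be an integer. For a finite field $k=\mathbb{F}_q$ of odd characteristic, let $\operatorname{hyp}^{\bullet}(g)$ be the number of $k$-isomorphism classes of pointed hyperelliptic curves of genus $g$ over $k$. Then $$\operatorname{hyp}^{\bullet}(g)=2q^{2g-1}+O(q^{g-1}).$$
   Context: A hyperelliptic curve of genus $g>1$ over $k$ is a smooth, projective, geometrically irreducible curve $C$ of genus $g$ over $k$ admitting a degree-$2$ morphism to $\mathbb{P}^1$ defined over $k$; its Weierstrass points are the ramification points of this morphism (equivalently the fixed points of the hyperelliptic involution). A pointed hyperelliptic curve over $k$ is a pair $(C,P)$ where $C$ is a hyperelliptic curve over $k$ and $P\in C(k)$ is a $k$-rational Weierstrass point of $C$. Two pointed curves $(C,P)$ and $(C',P')$ are $k$-isomorphic if there is a $k$-isomorphism $C\to C'$ sending $P$ to $P'$. In the $O$-notation, $g$ is fixed, $q$ ranges over all odd prime powers, and the implied constant depends only on $g$. *)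

(* Defs.v *)
From mathcomp Require Import all_boot all_order all_algebra.

Set Implicit Arguments.
Unset Strict Implicit.
Unset Printing Implicit Defensive.

Import Order.TTheory GRing.Theory Num.Theory.
Local Open Scope ring_scope.

(* A smooth projective curve over a finite (hence perfect) field k is          *)
(* represented as the abstract complete nonsingular curve of its function      *)
(* field F (Hartshorne I.6): its closed points are all the normalized discrete *)
(* valuations of F that are trivial on k, the local ring at a point being the  *)
(* valuation ring.  Dominant morphisms C -> C' are the k-embeddings of         *)
(* function fields F' -> F; in particular a nonconstant morphism x : C -> P^1  *)
(* is an element x of F transcendental over k, of degree [F : k(x)].           *)

Section FunctionField.
Variables (k : finFieldType) (F : fieldType) (iota : {rmorphism k -> F}).

Definition in_ratfield (x z : F) : Prop :=
  exists p q : {poly k},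
    (map_poly iota q).[x] != 0 /\
    z = (map_poly iota p).[x] / (map_poly iota q).[x].

Definition morphism_degree (x : F) (d : nat) : Prop :=
  ~ algebraicOver iota x /\
  exists b : 'I_d -> F, forall z : F,
    exists! c : {ffun 'I_d -> F},
      (forall i, in_ratfield x (c i)) /\ z = \sum_(i < d) c i * b i.

(* Every finite extension of k is k' = k[t]/(p) with p irreducible, and the    *)
(* base change to k' has total ring of fractions F (x)_k k' = F[t]/(p).  As p  *)
(* is separable, Spec F[t]/(p) is irreducible iff p is irreducible over F.     *)
Definition geometrically_irreducible : Prop :=
  forall p : {poly k}, irreducible_poly p -> irreducible_poly (map_poly iota p).

(* [ord_cst] also fixes the convention ord 0 = 0. *)
Record place := Place {
  ord :> F -> int;
  ord_cst : forall c : k, ord (iota c) = 0;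
  ordM : forall x y : F, x != 0 -> y != 0 -> ord (x * y) = ord x + ord y;
  ordD : forall x y : F, x != 0 -> y != 0 -> x + y != 0 ->
    Num.min (ord x) (ord y) <= ord (x + y);
  ord_uniformizer : exists t : F, ord t = 1
}.

Definition in_local_ring (P : place) (z : F) : Prop := 0 <= ord P z.

Definition in_maximal_ideal (P : place) (z : F) : Prop := z = 0 \/ 0 < ord P z.

Definition rational_point (P : place) : Prop :=
  forall z : F, in_local_ring P z ->
    exists c : k, in_maximal_ideal P (z - iota c).

Definition ramification_index (x : F) (P : place) (e : nat) : Prop :=
  [/\ (0 < e)%N,
      forall z : F, in_ratfield x z -> z != 0 -> exists m : int, ord P z = e%:Z * m
    & exists z : F, in_ratfield x z /\ ord P z = e%:Z].

(* All residue extensions are separable since k is finite. *)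
Definition ramified (x : F) (P : place) : Prop :=
  exists2 e : nat, ramification_index x P e & (1 < e)%N.

Record derivation := Derivation {
  der :> F -> F;
  der_cst : forall c : k, der (iota c) = 0;
  derD : forall a b : F, der (a + b) = der a + der b;
  derM : forall a b : F, der (a * b) = a * der b + b * der a
}.

(* The F-space of Kaehler differentials of F/k is finite dimensional, hence is *)
(* the dual of Der_k(F): a differential is a function of a derivation, and     *)
(* a1 df1 + .. + an dfn is D |-> a1 D(f1) + .. + an D(fn).  The stalk at P of  *)
(* the sheaf of differentials consists of the sums with ai, fi in the local    *)
(* ring of P.                                                                  *)
Definition regular_differential_at (P : place) (w : derivation -> F) : Prop :=
  exists n (a f : 'I_n -> F),
    (forall i, in_local_ring P (a i) /\ in_local_ring P (f i)) /\
    forall D : derivation, w D = \sum_(i < n) a i * D (f i).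

Definition rational_differential (w : derivation -> F) : Prop :=
  exists n (a f : 'I_n -> F),
    forall D : derivation, w D = \sum_(i < n) a i * D (f i).

Definition regular_differential (w : derivation -> F) : Prop :=
  rational_differential w /\ forall P : place, regular_differential_at P w.

(* g = dim_k H^0(C, Omega^1) *)
Definition has_genus (g : nat) : Prop :=
  exists b : 'I_g -> derivation -> F,
    (forall i, regular_differential (b i)) /\
    forall w, regular_differential w ->
      exists! c : {ffun 'I_g -> k},
        forall D : derivation, w D = \sum_(i < g) iota (c i) * b i D.

End FunctionField.

Record curve (k : finFieldType) := Curve {
  function_field : fieldType;
  constants : {rmorphism k -> function_field};
  curve_dim1 : exists x d, morphism_degree constants x d;
  curve_geom_irr : geometrically_irreducible constants
}.

Definition closed_point (k : finFieldType) (C : curve k) := place (constants C).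

Definition genus (k : finFieldType) (C : curve k) (g : nat) : Prop :=
  has_genus (constants C) g.

Record hyperelliptic_curve (k : finFieldType) (g : nat) := HyperellipticCurve {
  hyp_curve :> curve k;
  hyp_genus : genus hyp_curve g;
  hyp_degree2 : exists x, morphism_degree (constants hyp_curve) x 2
}.

(* For g > 1 the degree 2 morphism to P^1 is unique up to an automorphism of   *)
(* P^1, which does not affect its ramification points.                         *)
Definition weierstrass_point (k : finFieldType) (g : nat)
    (C : hyperelliptic_curve k g) (P : closed_point C) : Prop :=
  exists2 x, morphism_degree (constants C) x 2 & ramified x P.

Record pointed_hyperelliptic_curve (k : finFieldType) (g : nat) :=
  PointedHyperellipticCurve {
    ptd_curve :> hyperelliptic_curve k g;
    ptd_point : closed_point ptd_curve;
    ptd_rational : rational_point ptd_point;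
    ptd_weierstrass : weierstrass_point ptd_point
  }.

(* A k-isomorphism C -> C' is given by its comorphism phi on function fields;  *)
(* the image of P is the point with valuation ord P \o phi.                    *)
Definition pointed_isomorphic (k : finFieldType) (g : nat)
    (C C' : pointed_hyperelliptic_curve k g) : Prop :=
  exists phi : {rmorphism function_field C' -> function_field C},
    [/\ bijective phi,
        forall c : k, phi (constants C' c) = constants C c
      & forall z, ord (ptd_point C) (phi z) = ord (ptd_point C') z].

(* [iso] is meant to be an equivalence relation; r is a system of              *)
(* representatives of its classes.                                             *)
Definition number_of_classes (T : Type) (iso : T -> T -> Prop) (N : nat) : Prop :=
  exists r : 'I_N -> T,
    (forall i j, iso (r i) (r j) -> i = j) /\ (forall x, exists i, iso x (r i)).

Definition hyp_pointed_count (k : finFieldType) (g N : nat) : Prop :=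
  number_of_classes (@pointed_isomorphic k g) N.

(* Main.v *)
From HB Require Import structures.
Require Import Defs.
From mathcomp Require Import all_boot all_order all_algebra all_fingroup all_field.
From mathcomp Require Import ring zify.
From Stdlib Require Import Classical IndefiniteDescription.

(* Fix k with q elements and a pointed curve (C, P). Moving P to infinity,     *)
(* completing the square and removing square factors presents the function     *)
(* field as k(x, y) with y^2 = f(x), where f is monic and separable, P is the  *)
(* only pole of x, and deg f is odd because P is ramified; computing the       *)
(* regular differentials z dx/y then gives deg f = 2 g + 1.  Conversely every  *)
(* such f occurs.  The functions regular away from P are k[x] + k[x] y, and x  *)
(* and y have poles of order 2 and 2 g + 1 at P, so an isomorphism between two *)
(* models is (x, y) |-> (e^2 x + b, e^(2 g + 1) y).  Hence the classes are the *)
(* orbits of the group of pairs (e, b), of order q (q - 1), on the set of      *)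
(* q^(2 g + 1) - q^(2 g) monic separable polynomials.  In Burnside's formula   *)
(* (1, 0) and (-1, 0) fix everything and give 2 q^(2 g - 1), while any other   *)
(* element fixes at most q^g polynomials and only O(q) elements fix any.       *)

(** The geometric half identifies isomorphism classes of pointed curves with affine orbits of monic
    separable polynomials of degree 2g + 1. [every_represented] and [represented_exists] pass from
    curves to polynomials and back, [pointed_isomorphicP] turns isomorphism into [affine_equiv], and
    [pointed_count] concludes that the number of classes is the number N of orbits.

    Two facts carry this half. As deg f is odd, a^2 and f b^2 never have the same degree, so the
    degree of the norm a^2 - f b^2 determines the order of a + b y at infinity ([ord_inf]); this
    gives existence, uniqueness, rationality and ramification of the point at infinity. And the
    functions regular at all other places are exactly k[x] + k[x] y
    ([finite_places_coordinate_ring]), so pole orders at infinity determine both the regular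
    differentials ([model_genus]) and the possible changes of coordinates ([models_affine_equiv]).

    The counting half is Burnside's formula for a group of order q (q - 1). By [card_separable_set]
    the polynomials number q^(2g-1) q (q - 1), so the two elements acting trivially contribute
    exactly 2 q^(2g-1) to N. A nontrivial element fixes at most q^g polynomials ([card_fixed_set]),
    and by [fixed_separable_root] at most 4 (2g + 1) q elements fix a separable one. Their total is
    at most 4 (2g + 1) q^(g+1); dividing by q (q - 1), which is at least q^2 / 2, bounds the error
    by 8 (2g + 1) q^(g-1) ([orbit_count_bound]). *)

Set Implicit Arguments.
Unset Strict Implicit.
Unset Printing Implicit Defensive.

Import Order.TTheory GRing.Theory Num.Theory.
Local Open Scope ring_scope.

(** * Places *)

Section Places.
Variables (k : finFieldType) (F : fieldType) (iota : {rmorphism k -> F}).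
Implicit Types (P : place iota) (z w : F).

Lemma ord0 P : ord P 0 = 0.
Proof. by rewrite -(rmorph0 iota) ord_cst. Qed.

Lemma ord1 P : ord P 1 = 0.
Proof. by rewrite -(rmorph1 iota) ord_cst. Qed.

Lemma ordN P z : ord P (- z) = ord P z.
Proof.
have [->|z0] := eqVneq z 0; first by rewrite oppr0.
have m1 : (-1 : F) != 0 by rewrite oppr_eq0 oner_eq0.
by rewrite -mulN1r ordM // -(rmorph1 iota) -rmorphN ord_cst add0r.
Qed.

Lemma ordV P z : ord P z^-1 = - ord P z.
Proof.
have [->|z0] := eqVneq z 0; first by rewrite invr0 ord0 oppr0.
apply/eqP; rewrite -addr_eq0 -ordM ?invr_eq0 // mulVf //; apply/eqP; exact: ord1.
Qed.

Lemma ord_div P z w : z != 0 -> w != 0 -> ord P (z / w) = ord P z - ord P w.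
Proof. by move=> z0 w0; rewrite ordM ?invr_eq0 // ordV. Qed.

Lemma ordX P z n : ord P (z ^+ n) = ord P z *+ n.
Proof.
have [->|z0] := eqVneq z 0.
  by rewrite expr0n ord0 mul0rn; case: n => [|n] /=; rewrite ?ord1 ?ord0.
by elim: n => [|n IH]; rewrite ?expr0 ?ord1 // exprS ordM ?expf_neq0 // IH mulrS.
Qed.

Lemma ordD_lt P z w : z != 0 -> w != 0 -> ord P z < ord P w ->
  z + w != 0 /\ ord P (z + w) = ord P z.
Proof.
move=> z0 w0 lt; have zw0 : z + w != 0.
  by apply: contraTneq lt => /eqP; rewrite addr_eq0 => /eqP ->; rewrite ordN ltxx.
split=> //; apply/eqP; rewrite eq_le; apply/andP; split; last first.
  by have := ordD P z0 w0 zw0; rewrite min_l // ltW.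
have := @ordD _ _ _ P (z + w) (- w); rewrite oppr_eq0 addrK ordN => /(_ zw0 w0 z0).
by rewrite ge_min => /orP[//|]; rewrite leNgt lt.
Qed.

Lemma local_ringD P z w :
  in_local_ring P z -> in_local_ring P w -> in_local_ring P (z + w).
Proof.
rewrite /in_local_ring => Oz Ow.
have [->|z0] := eqVneq z 0; first by rewrite add0r.
have [->|w0] := eqVneq w 0; first by rewrite addr0.
have [->|zw0] := eqVneq (z + w) 0; first by rewrite ord0.
by apply: le_trans (ordD P z0 w0 zw0); rewrite le_min Oz Ow.
Qed.

Lemma local_ringM P z w :
  in_local_ring P z -> in_local_ring P w -> in_local_ring P (z * w).
Proof.
rewrite /in_local_ring => Oz Ow.
have [->|z0] := eqVneq z 0; first by rewrite mul0r ord0.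
have [->|w0] := eqVneq w 0; first by rewrite mulr0 ord0.
by rewrite ordM // addr_ge0.
Qed.

Lemma local_ringN P z : in_local_ring P z -> in_local_ring P (- z).
Proof. by rewrite /in_local_ring ordN. Qed.

Lemma local_ring_cst P c : in_local_ring P (iota c).
Proof. by rewrite /in_local_ring ord_cst. Qed.

Lemma local_ringX P z n : in_local_ring P z -> in_local_ring P (z ^+ n).
Proof. by rewrite /in_local_ring ordX => z0; rewrite mulrn_wge0. Qed.

Lemma local_ring_sum P (I : Type) (r : seq I) (h : I -> F) :
  (forall i, in_local_ring P (h i)) -> in_local_ring P (\sum_(i <- r) h i).
Proof.
move=> Oh; elim/big_ind: _ => //; last by move=> *; apply: local_ringD.
by rewrite /in_local_ring ord0.
Qed.

Lemma maximal_idealD P z w :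
  in_maximal_ideal P z -> in_maximal_ideal P w -> in_maximal_ideal P (z + w).
Proof.
rewrite /in_maximal_ideal => Oz Ow.
have [->|z0] := eqVneq z 0; first by rewrite add0r.
have [->|w0] := eqVneq w 0; first by rewrite addr0.
have [->|zw0] := eqVneq (z + w) 0; [by left|right].
apply: lt_le_trans (ordD P z0 w0 zw0); rewrite lt_min.
case: Oz => [/eqP|->]; first by rewrite (negPf z0).
by case: Ow => [/eqP|//]; rewrite (negPf w0).
Qed.

Lemma maximal_idealM P z w :
  in_local_ring P z -> in_maximal_ideal P w -> in_maximal_ideal P (z * w).
Proof.
rewrite /in_maximal_ideal /in_local_ring => Oz [->|Ow]; first by left; rewrite mulr0.
have [->|z0] := eqVneq z 0; first by left; rewrite mul0r.
have [->|w0] := eqVneq w 0; [by left; rewrite mulr0|right].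
by rewrite ordM // ltr_wpDl.
Qed.

Lemma maximal_ideal_cst P c : in_maximal_ideal P (iota c) -> c = 0.
Proof.
case; last by rewrite ord_cst.
by move/eqP; rewrite fmorph_eq0 => /eqP.
Qed.

Lemma maximal_idealP P z : z != 0 -> in_maximal_ideal P z <-> 0 < ord P z.
Proof. by move=> z0; split=> [[/eqP|//]|]; [rewrite (negPf z0)|right]. Qed.

(* The localization of a subring A at a prime ideal M which becomes principal  *)
(* there, generated by t, is the valuation ring of a place.                    *)
Section LocalizationPlace.
Variables (A M : F -> Prop) (t : F).
Hypotheses (Acst : forall c, A (iota c))
  (AD : forall z w, A z -> A w -> A (z + w))
  (AM : forall z w, A z -> A w -> A (z * w))
  (MA : forall z, M z -> A z)
  (Mprime : forall z w, A z -> A w -> (M (z * w) <-> M z \/ M w))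
  (M1 : ~ M 1) (Mt : M t) (t0 : t != 0)
  (Mgen : forall z, M z -> exists e w, [/\ A e, ~ M e, A w & e * z = t * w])
  (Mdiv : forall z, A z -> z != 0 ->
     exists n u w, [/\ A u, ~ M u, A w & z * w = t ^+ n * u])
  (Afrac : forall z, exists a b, [/\ A a, A b, b != 0 & z = a / b]).

Let U z := A z /\ ~ M z.

Let A0 : A 0. Proof. by rewrite -(rmorph0 iota); apply: Acst. Qed.
Let A1 : A 1. Proof. by rewrite -(rmorph1 iota); apply: Acst. Qed.
Let M0 : M 0. Proof. by rewrite -(mulr0 t); apply/(Mprime (MA Mt) A0); left. Qed.
Let U1 : U 1. Proof. by split. Qed.
Let U0 z : U z -> z != 0. Proof. by case=> _ nM; apply/eqP=> z0; apply: nM;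
  rewrite z0. Qed.
Let UM z w : U z -> U w -> U (z * w).
Proof.
by move=> [Az nz] [Aw nw]; split; [apply: AM|case/(Mprime Az Aw)].
Qed.
Let AX z n : A z -> A (z ^+ n).
Proof. by move=> Az; elim: n => [|n IH]; rewrite ?expr0 // exprS; apply: AM. Qed.

Let val z (n : int) := exists a b, [/\ U a, U b & z = t ^ n * (a / b)].

Let valM z w m n : val z m -> val w n -> val (z * w) (m + n).
Proof.
move=> [a [b [Ua Ub ->]]] [a' [b' [Ua' Ub' ->]]].
exists (a * a'), (b * b'); split; try exact: UM.
by rewrite expfzDr // invfM; ring.
Qed.

Let valV z n : val z n -> val z^-1 (- n).
Proof.
move=> [a [b [Ua Ub ->]]]; exists b, a; split=> //.
by rewrite !invfM invrK invr_expz; ring.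
Qed.

Let valA_ge0 z n : A z -> val z n -> 0 <= n.
Proof.
move=> Az [a [b [Ua Ub Ez]]]; case: n Ez => // n; rewrite NegzE => Ez.
case: (Ua) => _ []; have -> : a = t ^+ n.+1 * (z * b).
  rewrite Ez -exprnN; have := U0 Ub; move: (U0 Ub) => b0 _.
  by field; rewrite b0 expf_neq0.
have Ar : A (t ^+ n * (z * b)).
  by case: Ub => Ab _; apply: AM; [apply: AX; apply: MA|apply: AM].
by rewrite exprS -mulrA; apply/(Mprime (MA Mt) Ar); left.
Qed.

Let val_uniq z m n : val z m -> val z n -> m = n.
Proof.
have le z' m' n' : val z' m' -> val z' n' -> n' <= m'.
  move=> vm vn; rewrite -subr_ge0.
  have [a [b [Ua Ub E]]] := valM vm (valV vn).
  have z0 : z' != 0.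
    case: vn => a' [b' [Ua' Ub' ->]].
    by rewrite mulf_neq0 ?expfz_neq0 ?mulf_neq0 ?invr_eq0 // U0.
  apply: (@valA_ge0 1) => //; exists a, b; split=> //; by rewrite -E mulfV.
by move=> vm vn; apply/eqP; rewrite eq_le; apply/andP; split; apply: le; eassumption.
Qed.

(** As long as the cofactor lies in [M], [Mgen] extracts one more [t], up to elements outside [M].
    The process stops because [Mdiv] makes [z] divide [t ^+ n * u]: after n + 1 extractions a
    product of elements outside [M] would be a multiple of [t]. *)
Let valA z : A z -> z != 0 -> exists n : nat, val z n.
Proof.
move=> Az z0; have [n [u [w [Au nu Aw E]]]] := Mdiv Az z0.
have w0 : w != 0.
  apply: contra_not_neq nu => w0; move/eqP: E.
  rewrite w0 mulr0 eq_sym mulf_eq0 expf_eq0 (negPf t0) andbF /= => /eqP ->.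
  exact: M0.
suff H (j : nat) : (exists e b, [/\ U e, A b & e * z = t ^+ j * b]) \/
   exists i : nat, val z i.
  case: (H n.+1) => [[e [b [Ue Ab E']]]|//].
  case: (UM Ue (conj Au nu)) => _ [].
  have -> : e * u = t * (b * w).
    apply: (mulfI (expf_neq0 n t0)).
    by rewrite mulrCA -E [e * _]mulrA E' exprS; ring.
  by apply/(Mprime (MA Mt) (AM Ab Aw)); left.
elim: j => [|j [[e [b [Ue Ab E']]]|v]].
- by left; exists 1, z; split=> //; rewrite expr0.
- case: (classic (M b)) => [Mb|nMb]; last first.
    right; exists j, b, e; split=> //.
    by rewrite -exprnP mulrA -E' mulrAC mulfV ?mul1r // U0.
  have [e1 [w1 [Ae1 ne1 Aw1 E1]]] := Mgen Mb.
  left; exists (e1 * e), w1; split=> //; first exact: UM.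
  by rewrite exprSr -mulrA E' mulrCA E1 mulrA.
- by right.
Qed.

Let val_ex z : z != 0 -> exists n, val z n.
Proof.
move=> z0; have [a [b [Aa Ab b0 E]]] := Afrac z.
have a0 : a != 0 by apply: contraNneq z0 => a0; rewrite E a0 mul0r.
have [m vm] := valA Aa a0; have [n vn] := valA Ab b0.
by exists (m%:Z - n%:Z); rewrite E; apply: valM => //; apply: valV.
Qed.

Let valD z w m n : val z m -> val w n -> z + w != 0 -> m <= n ->
  exists2 l, val (z + w) l & m <= l.
Proof.
move=> [a [b [Ua Ub ->]]] [a' [b' [Ua' Ub' ->]]] nz le_mn.
have [j Ej] : exists j : nat, n = m + j%:Z.
  by exists `|n - m|%N; lia.
pose c := a * b' + t ^+ j * (a' * b).
have E : t ^ m * (a / b) + t ^ n * (a' / b') = t ^ m * (c / (b * b')).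
  rewrite Ej expfzDr // -exprnP /c; have := U0 Ub; have := U0 Ub'.
  by move=> b'0 b0; field; rewrite b0 b'0.
have Ac : A c.
  case: Ua Ub Ua' Ub' => ? _ [? _] [? _] [? _].
  by apply: AD; [apply: AM|apply: AM; [apply: AX; apply: MA|apply: AM]].
have c0 : c != 0 by apply: contraNneq nz => c0; rewrite E c0 mul0r mulr0.
have [l vl] := valA Ac c0; exists (m + l%:Z); last by rewrite lerDl.
rewrite E; apply: valM; first by exists 1, 1; split=> //; rewrite divr1 mulr1.
rewrite -[l%:Z]addr0; apply: valM => //; exists 1, (b * b'); split=> //.
  exact: UM.
by rewrite expr0z mul1r div1r.
Qed.

(** The order of [z] is the exponent n in z = t^n (a / b) with [a], [b] outside [M]. The last
    clause, that regular functions are fractions with unit denominator, later controls derivations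
    on the local ring. *)
Lemma localization_place : exists P : place iota,
  [/\ forall z, A z -> in_local_ring P z,
      forall z, A z -> (in_maximal_ideal P z <-> M z)
    & forall z, in_local_ring P z ->
        exists a b, [/\ A a, A b, b != 0, ord P b = 0 & z = a / b]].
Proof.
have ex z : exists n, (z != 0 -> val z n) /\ (z = 0 -> n = 0).
  have [->|z0] := eqVneq z 0; first by exists 0.
  by have [n vn] := val_ex z0; exists n; split=> // /eqP; rewrite (negPf z0).
have [o Ho] := functional_choice _ ex.
have oE z n : val z n -> o z = n.
  move=> v; have z0 : z != 0.
    case: v => a [b [Ua Ub ->]].
    by rewrite mulf_neq0 ?expfz_neq0 ?mulf_neq0 ?invr_eq0 // U0.
  by apply: (@val_uniq z) => //; apply: (Ho z).1.
have oP z : z != 0 -> val z (o z) by case: (Ho z).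
have Uo u : U u -> o u = 0.
  move=> Uu; apply: oE; exists u, 1; split=> //.
  by rewrite expr0z mul1r divr1.
have oM x y : x != 0 -> y != 0 -> o (x * y) = o x + o y.
  by move=> x0 y0; apply: oE; apply: valM; apply: oP.
have oC c : o (iota c) = 0.
  have [->|c0] := eqVneq c 0; first by rewrite rmorph0; case: (Ho 0) => _ ->.
  apply: Uo; split=> // Mc; apply: M1.
  rewrite -(rmorph1 iota) -(mulVf c0) rmorphM.
  by apply/(Mprime (Acst _) (Acst _)); right.
have oD x y : x != 0 -> y != 0 -> x + y != 0 -> Num.min (o x) (o y) <= o (x + y).
  move=> x0 y0 xy0; case: (lerP (o x) (o y)) => le.
    by have [l /oE ->] := valD (oP _ x0) (oP _ y0) xy0 le.
  have yx0 : y + x != 0 by rewrite addrC.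
  have [l vl lel] := valD (oP _ y0) (oP _ x0) yx0 (ltW le).
  by rewrite addrC (oE _ _ vl).
have ot : o t = 1.
  by apply: oE; exists 1, 1; split=> //; rewrite divr1 mulr1 expr1z.
exists (Place oC oM oD (ex_intro _ t ot)).
rewrite /in_local_ring /in_maximal_ideal /=; split.
- move=> z Az; have [->|z0] := eqVneq z 0; first by case: (Ho 0) => _ ->.
  exact: valA_ge0 (oP _ z0).
- move=> z Az; have [->|z0] := eqVneq z 0; first by split=> // _; left.
  split=> [[E|z_gt0]|Mz].
  + by rewrite E eqxx in z0.
  + apply: NNPP => nM; by rewrite (Uo z) // ltxx in z_gt0.
  + right; rewrite lt_neqAle (valA_ge0 Az (oP _ z0)) andbT.
    apply/eqP => oz; have [a [b [[Aa na] [Ab nb]]]] := oP _ z0.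
    rewrite -oz expr0z mul1r => E; apply: na.
    have -> : a = z * b by rewrite E divfK // U0.
    by apply/Mprime => //; left.
- move=> z oz; have [->|z0] := eqVneq z 0.
    by exists 0, 1; split; rewrite ?oner_eq0 ?mul0r ?Uo.
  have [a [b [[Aa na] Ub E]]] := oP _ z0.
  exists (t ^+ `|o z|%N * a), b; split.
  + by apply: AM => //; apply: AX; apply: MA.
  + by case: Ub.
  + exact: U0.
  + exact: Uo.
  + by rewrite exprnP gez0_abs // -mulrA.
Qed.
End LocalizationPlace.
End Places.

(** * Curves y^2 = f(x) with f of odd degree: the place at infinity *)

Definition psize (k : finFieldType) (p : {poly k}) : nat := size p.

(* [lia] does not identify the sizes of a polynomial taken through different   *)
(* paths of the algebraic hierarchy; this gives them the same syntactic form.  *)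
Ltac plia :=
  repeat match goal with
  | |- context [@size ?T (@polyseq ?R ?p)] =>
      change (@size T (@polyseq R p)) with (psize p)
  | H : context [@size ?T (@polyseq ?R ?p)] |- _ =>
      change (@size T (@polyseq R p)) with (psize p) in H
  end; lia.

Section PolySize.
Variable k : finFieldType.
Implicit Types p q : {poly k}.

Lemma size_polyM p q : p != 0 -> q != 0 -> size (p * q) = (size p + size q).-1.
Proof. exact: size_mul. Qed.

Lemma size_poly_sqr p : size (p ^+ 2) = (size p + size p).-1.
Proof.
have [->|p0] := eqVneq p 0; first by rewrite expr0n size_poly0.
by rewrite expr2 size_polyM.
Qed.
End PolySize.

Section EvalAt.
Variables (k : finFieldType) (F : fieldType) (iota : {rmorphism k -> F}).
Implicit Types (x : F) (p q : {poly k}).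

Definition eval_at (x : F) (p : {poly k}) : F := (map_poly iota p).[x].

HB.instance Definition _ x :=
  GRing.RMorphism.copy (eval_at x) (horner_eval x \o map_poly iota).

Lemma eval_atE x p : eval_at x p = (map_poly iota p).[x]. Proof. by []. Qed.

Lemma eval_atC x c : eval_at x c%:P = iota c.
Proof. by rewrite eval_atE map_polyC hornerC. Qed.

Lemma eval_atX x : eval_at x 'X = x.
Proof. by rewrite eval_atE map_polyX hornerX. Qed.

Lemma eval_atZ x c p : eval_at x (c *: p) = iota c * eval_at x p.
Proof. by rewrite -mul_polyC rmorphM /= eval_atC. Qed.

Lemma eval_at_comp x p q : eval_at x (p \Po q) = eval_at (eval_at x q) p.
Proof. by rewrite !eval_atE map_comp_poly horner_comp. Qed.

Lemma eval_at_coef x p : eval_at x p = \sum_(i < size p) iota p`_i * x ^+ i.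
Proof.
rewrite eval_atE (@horner_coef_wide _ (size p)) ?size_poly //.
by apply: eq_bigr => i _; rewrite coef_map.
Qed.

Lemma eval_at_eq0 x p : ~ algebraicOver iota x -> (eval_at x p == 0) = (p == 0).
Proof.
move=> tr; apply/idP/eqP => [px0|->]; last by rewrite rmorph0.
by apply/eqP; apply: contraPT px0 => p0 px0; apply: tr; exists p.
Qed.

Lemma local_ring_eval (P : place iota) x p :
  in_local_ring P x -> in_local_ring P (eval_at x p).
Proof.
move=> Ox; rewrite eval_at_coef; apply: local_ring_sum => i.
by apply: local_ringM; [exact: local_ring_cst|exact: local_ringX].
Qed.

(** At a pole of [x] the leading term has strictly the smallest order; the induction follows
    Horner's scheme. *)
Lemma ord_eval (P : place iota) x p : ord P x < 0 -> p != 0 ->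
  ord P (eval_at x p) = ord P x * (size p).-1%:Z.
Proof.
move=> ox; have x0 : x != 0 by apply: contraTneq ox => ->; rewrite ord0.
suff H n : forall q : {poly k}, size q = n.+1 -> eval_at x q != 0 /\
    ord P (eval_at x q) = ord P x * n%:Z.
  by rewrite -size_poly_gt0; case E: (size p) => [//|n] _; case: (H n p E).
elim: n => [|n IH] q sq.
  have /size_poly1P[c c0 ->] : size q == 1%N by rewrite sq.
  by rewrite eval_atC ord_cst mulr0 fmorph_eq0.
have [q1 [c Eq]] : exists q1, exists c, q = q1 * 'X + c%:P.
  exists (\poly_(i < size q) q`_i.+1), q`_0; apply/polyP => i.
  rewrite coefD coefMX coefC; case: i => [|i] /=; first by rewrite add0r.
  rewrite addr0 coef_poly; case: ltnP => // le.
  by rewrite nth_default // (leq_trans le).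
have sq1 : size q1 = n.+1.
  move: sq; rewrite Eq size_MXaddC; by case: ifP => // _ [].
have [e0 oe] := IH _ sq1.
have xe0 : eval_at x q1 * x != 0 by rewrite mulf_neq0.
have oxe : ord P (eval_at x q1 * x) = ord P x * n.+1%:Z.
  by rewrite ordM // oe -addn1 PoszD mulrDr mulr1.
rewrite Eq rmorphD rmorphM /= eval_atX eval_atC.
have [->|c0] := eqVneq c 0; first by rewrite rmorph0 addr0.
rewrite -oxe; apply: ordD_lt; rewrite ?fmorph_eq0 // ord_cst oxe.
by rewrite nmulr_rlt0.
Qed.
End EvalAt.

Section OddModel.
Variables (k : finFieldType) (F : fieldType) (iota : {rmorphism k -> F}).

(** An affine model y^2 = f(x) of the function field. The size is the degree plus one, so
    [model_odd] says that deg f is odd. [model_gen] says that F = k(x) + k(x) y, with a common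
    denominator. *)
Record odd_model (x y : F) (f : {poly k}) : Prop := OddModel {
  model_tr : ~ algebraicOver iota x;
  model_eq : y ^+ 2 = eval_at iota x f;
  model_sep : separable_poly f;
  model_odd : ~~ odd (size f);
  model_gen : forall z : F, exists a b d, d != 0 /\
    z = (eval_at iota x a + eval_at iota x b * y) / eval_at iota x d
}.

Variables (x y : F) (f : {poly k}).
Hypothesis model : odd_model x y f.

Local Notation ev := (eval_at iota x).
Implicit Types (a b d p q : {poly k}) (z : F).

Definition eval2 a b : F := eval_at iota x a + eval_at iota x b * y.
(** The norm of a + b y from k(x, y) to k(x). *)
Definition norm_poly a b : {poly k} := a ^+ 2 - f * b ^+ 2.

Lemma model_neq0 : f != 0.
Proof. exact: separable_poly_neq0 (model_sep model). Qed.

Lemma ev_eq0 p : (ev p == 0) = (p == 0).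
Proof. exact: eval_at_eq0 (model_tr model). Qed.

Lemma ev_inj : injective ev.
Proof.
by move=> p q /eqP; rewrite -subr_eq0 -rmorphB ev_eq0 subr_eq0 => /eqP.
Qed.

Lemma model_y0 : y != 0.
Proof. by rewrite -sqrf_eq0 (model_eq model) ev_eq0 model_neq0. Qed.

Lemma model_x0 : x != 0.
Proof. by rewrite -(eval_atX iota x) ev_eq0 polyX_eq0. Qed.

Lemma eval2D a b a' b' : eval2 a b + eval2 a' b' = eval2 (a + a') (b + b').
Proof. by rewrite /eval2 !rmorphD /=; ring. Qed.

Lemma eval2M a b a' b' : eval2 a b * eval2 a' b' = eval2 (a * a' + f * (b * b')) (a *
  b' + b * a').
Proof.
by rewrite /eval2 !(rmorphD, rmorphM) /= -(model_eq model); ring.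
Qed.

Lemma eval20 a : eval2 a 0 = ev a.
Proof. by rewrite /eval2 rmorph0 mul0r addr0. Qed.

Lemma eval2_conj a b : eval2 a b * eval2 a (- b) = ev (norm_poly a b).
Proof.
rewrite eval2M -eval20; congr eval2; rewrite /norm_poly; ring.
Qed.

(** One degree is even and the other is odd. Hence leading terms never cancel in a norm, which gives
    the independence of 1 and y over k(x) as well as all orders at infinity. *)
Lemma size_sqr_neq (a b : {poly k}) : a != 0 -> b != 0 ->
  size (a ^+ 2) != size (f * b ^+ 2).
Proof.
move=> a0 b0; have := model_odd model.
rewrite size_polyM ?expf_neq0 ?model_neq0 // !size_poly_sqr.
by move: a0 b0; rewrite -!size_poly_gt0 => a0 b0; apply: contraNneq; lia.
Qed.

Lemma size_norm_poly a b : size (norm_poly a b) = maxn (size (a ^+ 2)) (size (f * b ^+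
  2)).
Proof.
have [->|a0] := eqVneq a 0.
  by rewrite /norm_poly expr0n /= sub0r size_polyN size_poly0 max0n.
have [->|b0] := eqVneq b 0.
  by rewrite /norm_poly expr0n /= mulr0 subr0 size_poly0 maxn0.
have := size_sqr_neq a0 b0; rewrite /norm_poly; case: ltngtP => // lt _.
  by rewrite addrC size_polyDl ?size_polyN.
by rewrite size_polyDl ?size_polyN.
Qed.

Lemma norm_poly_eq0 a b : (norm_poly a b == 0) = (a == 0) && (b == 0).
Proof.
rewrite -size_poly_eq0 size_norm_poly -leqn0 geq_max !leqn0 !size_poly_eq0.
by rewrite sqrf_eq0 mulf_eq0 (negPf model_neq0) sqrf_eq0.
Qed.

Lemma eval2_eq0 a b : (eval2 a b == 0) = (a == 0) && (b == 0).
Proof.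
apply/idP/idP => [/eqP E|/andP[/eqP-> /eqP->]].
  by rewrite -norm_poly_eq0 -ev_eq0 -eval2_conj E mul0r.
by rewrite eval20 rmorph0.
Qed.

Lemma eval2_inj a b a' b' : eval2 a b = eval2 a' b' -> a = a' /\ b = b'.
Proof.
move=> E; have /eqP : eval2 a b + eval2 (- a') (- b') = 0.
  by rewrite E eval2D !subrr eval20 rmorph0.
by rewrite eval2D eval2_eq0 !subr_eq0 => /andP[/eqP-> /eqP->].
Qed.

Lemma model_fraction z : exists a b d, d != 0 /\ z = eval2 a b / ev d.
Proof. exact: model_gen model z. Qed.

Lemma norm_polyM a b a' b' :
  norm_poly (a * a' + f * (b * b')) (a * b' + b * a') = norm_poly a b * norm_poly a' b'.
Proof. by rewrite /norm_poly; ring. Qed.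

(** The order of (a + b y) / d at infinity. There x has order -2, and a + b y has the same order as
    its conjugate a - b y, so this order is minus the degree of the norm. *)
Definition inf_order a b d : int :=
  2 * (size d).-1%:Z - (size (norm_poly a b)).-1%:Z.

Section InfinitePlace.
Variable P : place iota.
Hypothesis oPx : ord P x < 0.

Lemma ord2_eval p : p != 0 ->
  ord P (ev p) *+ 2 = ord P x * (size (p ^+ 2)).-1%:Z.
Proof.
by move=> p0; rewrite -ordX -rmorphXn /= ord_eval // expf_neq0.
Qed.

Lemma ord2_eval_y p : p != 0 ->
  ord P (ev p * y) *+ 2 = ord P x * (size (f * p ^+ 2)).-1%:Z.
Proof.
move=> p0; rewrite -ordX exprMn (model_eq model) -rmorphXn -rmorphM /=.
by rewrite [_ * f]mulrC ord_eval // mulf_neq0 ?expf_neq0 ?model_neq0.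
Qed.

(** The terms a and b y have different orders by parity, so the smaller one wins. Orders are doubled
    because y is accessible only through y^2 = f(x). *)
Lemma ord2_ev2 a b : eval2 a b != 0 ->
  ord P (eval2 a b) *+ 2 = ord P x * (size (norm_poly a b)).-1%:Z.
Proof.
have [->|a0] := eqVneq a 0.
  rewrite /eval2 rmorph0 add0r mulf_eq0 (negPf model_y0) orbF ev_eq0 => b0.
  by rewrite ord2_eval_y // size_norm_poly expr0n size_poly0 max0n.
have [->|b0] := eqVneq b 0.
  by rewrite eval20 ev_eq0 ord2_eval // size_norm_poly expr0n mulr0 size_poly0 maxn0.
rewrite /eval2 => nz; have ea0 : ev a != 0 by rewrite ev_eq0.
have eb0 : ev b * y != 0 by rewrite mulf_neq0 ?ev_eq0 ?model_y0.
have oa := ord2_eval a0; have ob := ord2_eval_y b0.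
have a20 : a ^+ 2 != 0 by rewrite expf_neq0.
have b20 : f * b ^+ 2 != 0 by rewrite mulf_neq0 ?expf_neq0 ?model_neq0.
have ne := size_sqr_neq a0 b0.
rewrite size_norm_poly; case: ltngtP ne => // lt _.
  rewrite addrC -ob; congr (_ *+ 2); apply: (ordD_lt _ _ _).2 => //.
  rewrite -(ltr_pMn2r (isT : 0 < 2)%N) oa ob ltr_nM2l //.
  by move: lt; rewrite -!size_poly_gt0 in a20 b20 *; lia.
rewrite -oa; congr (_ *+ 2); apply: (ordD_lt _ _ _).2 => //.
rewrite -(ltr_pMn2r (isT : 0 < 2)%N) oa ob ltr_nM2l //.
by move: lt; rewrite -!size_poly_gt0 in a20 b20 *; lia.
Qed.

(** From 2 ord(y) = ord(x) deg f with deg f odd, ord(x) = 2h is even. The doubled order of a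
    uniformizer is a multiple of ord(x), so 2 = 2hw; as h is negative, h = -1. *)
Lemma ord_inf_x : ord P x = - 2.
Proof.
have [t ot] := ord_uniformizer P; have [a [b [d [d0 E]]]] := model_fraction t.
have t0 : t != 0 by apply: contra_eq_neq ot => ->; rewrite ord0.
have ed0 : ev d != 0 by rewrite ev_eq0.
have n0 : eval2 a b != 0 by apply: contra_neq t0; rewrite E => ->; rewrite mul0r.
have Eo : ord P x * ((size (norm_poly a b)).-1%:Z - (size (d ^+ 2)).-1%:Z) = 2.
  rewrite mulrBr -ord2_ev2 // -ord2_eval // -mulrnBl -ord_div // -E ot.
  by [].
have Ey := ord2_eval_y (oner_neq0 _).
move: Ey; rewrite expr1n mulr1 => Ey.
have : exists h : int, ord P x = 2 * h.
  have := model_odd model; have := model_neq0; rewrite -size_poly_gt0 => s0 s1.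
  exists (ord P (ev 1 * y) - ord P x * ((size f).-1./2)%:Z).
  have Es : (size f).-1%:Z = 2 * ((size f).-1./2)%:Z + 1 by lia.
  move: Ey; rewrite {1}Es -mulr_natr; move: (ord P _) (ord P _) (Posz _./2).
  by move=> *; nia.
case=> h Eh; move: oPx Eo; rewrite Eh; set w := _ - _ => h0 Ew.
have : h * w = 1 by lia.
clearbody w; clear -h0 => hw; have w0 : w < 0 by nia.
have h1 : h >= -1 by nia.
by lia.
Qed.

Lemma ord_inf a b d : d != 0 -> eval2 a b != 0 ->
  ord P (eval2 a b / ev d) = inf_order a b d.
Proof.
move=> d0 n0; rewrite ord_div ?ev_eq0 // ord_eval // /inf_order.
by have := ord2_ev2 n0; rewrite ord_inf_x; lia.
Qed.
End InfinitePlace.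

Lemma inf_place_unique (P Q : place iota) :
  ord P x < 0 -> ord Q x < 0 -> forall z, ord P z = ord Q z.
Proof.
move=> Px Qx z; have [->|z0] := eqVneq z 0; first by rewrite !ord0.
have [a [b [d [d0 E]]]] := model_fraction z.
have n0 : eval2 a b != 0 by apply: contra_neq z0; rewrite E => ->; rewrite mul0r.
by rewrite E !ord_inf.
Qed.
End OddModel.

Section OddModelInf.
Variables (k : finFieldType) (F : fieldType) (iota : {rmorphism k -> F}).
Variables (x y : F) (f : {poly k}).
Hypothesis model : odd_model iota x y f.
Implicit Types (a b d p q : {poly k}) (z : F).

Local Notation ev := (eval_at iota x).
Local Notation ev2 := (eval2 iota x y).
Local Notation norm2 := (norm_poly f).
Local Notation infdeg := (inf_order f).
Local Notation ev_eq0 := (ev_eq0 model).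
Local Notation eval2_eq0 := (eval2_eq0 model).

Lemma eval2Z a b d : ev2 a b * ev d = ev2 (a * d) (b * d).
Proof. by rewrite /eval2 !rmorphM; ring. Qed.

Lemma size_norm_poly_gt0 a b : ev2 a b != 0 -> (0 < size (norm2 a b))%N.
Proof. by rewrite size_poly_gt0 (norm_poly_eq0 model) -eval2_eq0. Qed.

Lemma size_norm_polyZ a b d : d != 0 -> ev2 a b != 0 ->
  (size (norm2 (a * d) (b * d))).-1 = ((size (norm2 a b)).-1 + 2 * (size d).-1)%N.
Proof.
move=> d0 n0; have -> : norm2 (a * d) (b * d) = norm2 a b * d ^+ 2.
  by rewrite /norm_poly; ring.
have s0 := size_norm_poly_gt0 n0.
rewrite size_polyM ?expf_neq0 // -?size_poly_gt0 //.
by move: d0; rewrite size_poly_sqr -size_poly_gt0; lia.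
Qed.

Lemma inf_order_cross a b d a' b' d' : d != 0 -> d' != 0 -> ev2 a b != 0 ->
  ev2 a b / ev d = ev2 a' b' / ev d' -> infdeg a b d = infdeg a' b' d'.
Proof.
move=> d0 d'0 n0 E.
have ed0 : ev d != 0 by rewrite ev_eq0.
have ed'0 : ev d' != 0 by rewrite ev_eq0.
have n'0 : ev2 a' b' != 0.
  apply: contra_neq n0 => E0; move/eqP: E.
  by rewrite E0 mul0r mulf_eq0 invr_eq0 (negPf ed0) orbF => /eqP.
have [] : a * d' = a' * d /\ b * d' = b' * d.
  apply: (eval2_inj model); rewrite -!eval2Z.
  by rewrite -[ev2 a b](divfK ed0) E; field.
move=> Ea Eb; have := size_norm_polyZ d'0 n0; rewrite Ea Eb size_norm_polyZ //.
by rewrite /inf_order; lia.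
Qed.

Lemma size_norm_polyD a b a' b' :
  (size (norm2 (a + a') (b + b')) <= maxn (size (norm2 a b)) (size (norm2 a' b')))%N.
Proof.
have sfq (p : {poly k}) : p != 0 ->
  size (f * p ^+ 2) = (size f + (size p + size p).-1).-1.
  by move=> p0; rewrite size_polyM ?size_poly_sqr ?expf_neq0 // (model_neq0 model).
have mono (p q r : {poly k}) : (size p <= maxn (size q) (size r))%N ->
    (size (f * p ^+ 2)%R <= maxn (size (f * q ^+ 2)%R) (size (f * r ^+ 2)%R))%N.
  have [->|p0] := eqVneq p 0; first by rewrite expr0n mulr0 size_poly0.
  have [->|q0] := eqVneq q 0; have [->|r0] := eqVneq r 0;
    rewrite ?expr0n ?mulr0 ?size_poly0 ?sfq //; rewrite -?size_poly_gt0 in p0 *; lia.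
have sD (p q : {poly k}) := size_polyD p q.
rewrite !(size_norm_poly model) !size_poly_sqr.
have := mono _ _ _ (sD b b'); have := sD a a'; lia.
Qed.

(** The order is defined by [inf_order] on any presentation as a fraction: [inf_order_cross] makes
    it independent of the presentation, multiplicativity of the norm makes it additive, and
    [size_norm_polyD] gives the ultrametric inequality. *)
Lemma inf_place_exists : exists P : place iota, ord P x < 0.
Proof.
have f0 := model_neq0 model.
have ex z : exists n, (z = 0 -> n = 0) /\ forall a b d, d != 0 -> ev2 a b != 0 ->
    z = ev2 a b / ev d -> n = infdeg a b d.
  have [-> |z0] := eqVneq z 0.
    exists 0; split=> // a b d d0 n0 /esym/eqP.
    by rewrite mulf_eq0 invr_eq0 ev_eq0 (negPf d0) (negPf n0).
  have [a [b [d [d0 E]]]] := model_fraction model z.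
  have n0 : ev2 a b != 0 by apply: contra_neq z0; rewrite E => ->; rewrite mul0r.
  exists (infdeg a b d); split=> [/eqP|a' b' d' d'0 n'0 E']; first by rewrite (negPf z0).
  by apply: inf_order_cross => //; rewrite -E.
have [o Ho] := functional_choice _ ex.
have o0 : o 0 = 0 by apply: (Ho 0).1.
have oE a b d : d != 0 -> ev2 a b != 0 -> o (ev2 a b / ev d) = infdeg a b d.
  by move=> d0 n0; apply: (Ho _).2.
have rep z : z != 0 -> exists a b d, [/\ d != 0, ev2 a b != 0 & z = ev2 a b / ev d].
  move=> z0; have [a [b [d [d0 E]]]] := model_fraction model z; exists a, b, d;
    split=> //.
  by apply: contra_neq z0; rewrite E => ->; rewrite mul0r.
have oC c : o (iota c) = 0.
  have [->|c0] := eqVneq c 0; first by rewrite rmorph0.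
  have Ec : ev2 c%:P 0 / ev 1 = iota c by rewrite eval20 eval_atC rmorph1 divr1.
  rewrite -Ec oE ?oner_neq0 ?eval2_eq0 ?polyC_eq0 ?(negPf c0) //.
  rewrite /inf_order (size_norm_poly model) expr0n mulr0 size_poly0 maxn0 size_poly1.
  by rewrite -polyC_exp size_polyC expf_neq0.
have oM z w : z != 0 -> w != 0 -> o (z * w) = o z + o w.
  move=> z0 w0; have [a [b [d [d0 n0 Ez]]]] := rep _ z0.
  have [a' [b' [d' [d'0 n'0 Ew]]]] := rep _ w0.
  have ed0 : ev d != 0 by rewrite ev_eq0.
  have ed'0 : ev d' != 0 by rewrite ev_eq0.
  have nn : ev2 a b * ev2 a' b' != 0 by rewrite mulf_neq0.
  have -> : z * w = (ev2 a b * ev2 a' b') / ev (d * d').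
    by rewrite Ez Ew rmorphM /=; field; rewrite ed0 ed'0.
  have s1 := size_norm_poly_gt0 n0; have s2 := size_norm_poly_gt0 n'0.
  rewrite (eval2M model) in nn *; rewrite oE ?mulf_neq0 // Ez Ew !oE // /inf_order.
  rewrite norm_polyM !size_polyM // -?size_poly_gt0 //.
  by move: s1 s2 (d0) (d'0); rewrite -!size_poly_gt0; lia.
have oD z w : z != 0 -> w != 0 -> z + w != 0 -> Num.min (o z) (o w) <= o (z + w).
  move=> z0 w0; have [a [b [d [d0 n0 Ez]]]] := rep _ z0.
  have [a' [b' [d' [d'0 n'0 Ew]]]] := rep _ w0.
  have ed0 : ev d != 0 by rewrite ev_eq0.
  have ed'0 : ev d' != 0 by rewrite ev_eq0.
  have E : z + w = (ev2 (a * d') (b * d') + ev2 (a' * d) (b' * d)) / ev (d * d').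
    by rewrite -!eval2Z Ez Ew rmorphM /=; field; rewrite ed0 ed'0.
  have dd0 : d * d' != 0 by rewrite mulf_neq0.
  move=> zw0; have nn : ev2 (a * d') (b * d') + ev2 (a' * d) (b' * d) != 0.
    by apply: contra_neq zw0; rewrite E => ->; rewrite mul0r.
  rewrite E eval2D in nn *; rewrite (oE _ _ _ dd0 nn) Ez Ew !oE //.
  have := size_norm_polyD (a * d') (b * d') (a' * d) (b' * d).
  have := size_norm_polyZ d'0 n0; have := size_norm_polyZ d0 n'0.
  have := size_norm_poly_gt0 nn; rewrite /inf_order size_polyM //.
  by move: (d0) (d'0); rewrite -!size_poly_gt0; lia.
have s0 : (0 < size f)%N by rewrite size_poly_gt0.
(* With deg f = 2g + 1, the function x^g y / f = x^g / y has order -2g + (2g + 1) = 1. *)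
have ut : exists t, o t = 1.
  pose g := (size f).-2./2; exists (ev2 0 'X^g / ev f).
  rewrite oE ?eval2_eq0 ?negb_and ?expf_neq0 ?polyX_eq0 ?orbT //.
  rewrite /inf_order (size_norm_poly model) expr0n size_poly0 max0n -exprM.
  rewrite size_polyM ?expf_neq0 ?polyX_eq0 // size_polyXn /g.
  by have := model_odd model; lia.
exists (Place oC oM oD ut) => /=.
have -> : x = ev2 'X 0 / ev 1 by rewrite eval20 eval_atX rmorph1 divr1.
rewrite oE ?oner_neq0 ?eval2_eq0 ?polyX_eq0 //.
rewrite /inf_order (size_norm_poly model) expr0n mulr0 size_poly0 maxn0 size_polyXn.
by rewrite size_poly1.
Qed.

Section AtInfinity.
Variable P : place iota.
Hypothesis oPx : ord P x < 0.

(** If (a + b y) / d is regular, then deg a is at most deg d and deg(f b^2) at most 2 deg d. The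
    latter inequality is strict by parity, so the term b y / d vanishes at P, and the residue is the
    quotient of the coefficients of x^(deg d) in a and d. *)
Lemma inf_rational : rational_point P.
Proof.
move=> z Oz; have [->|z0] := eqVneq z 0.
  by exists 0; left; rewrite rmorph0 subr0.
have [a [b [d [d0 E]]]] := model_fraction model z.
have n0 : ev2 a b != 0 by apply: contra_neq z0; rewrite E => ->; rewrite mul0r.
have ed0 : ev d != 0 by rewrite ev_eq0.
pose c := a`_(size d).-1 / lead_coef d; exists c.
have Ez : z - iota c = ev2 (a - c *: d) b / ev d.
  by rewrite E /eval2 rmorphB /= eval_atZ; field.
rewrite Ez; have [-> |nn] := eqVneq (ev2 (a - c *: d) b) 0; first by left; rewrite mul0r.
right; rewrite (ord_inf model) //.
move: Oz; rewrite E /in_local_ring (ord_inf model) // /inf_order !(size_norm_poly model).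
have Od : ~~ odd (size (f * b ^+ 2)).
  have [->|b0] := eqVneq b 0; first by rewrite expr0n mulr0 size_poly0.
  have := model_odd model; rewrite size_polyM ?(model_neq0 model) ?expf_neq0 //
    size_poly_sqr.
  by move: b0; rewrite -size_poly_gt0; lia.
have sd : (0 < size d)%N by rewrite size_poly_gt0.
rewrite !size_poly_sqr => le.
have sa : (size a <= size d)%N by lia.
have := size_norm_poly_gt0 nn; rewrite (size_norm_poly model) size_poly_sqr => sn.
suff : (size (a - c *: d)%R <= (size d).-1)%N by lia.
apply/leq_sizeP => j; rewrite leq_eqVlt => /orP[/eqP <-|lt].
  by rewrite coefB coefZ -lead_coefE divfK ?subrr // lead_coef_eq0.
have jd : (size d <= j)%N by lia.
by rewrite coefB coefZ !nth_default ?mulr0 ?subrr // (leq_trans sa).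
Qed.

Lemma in_ratfieldP z : in_ratfield iota x z <-> exists p q, q != 0 /\ z = ev p / ev q.
Proof.
split=> [[p [q [q0 ->]]]|[p [q [q0 ->]]]].
  by exists p, q; split=> //; rewrite -ev_eq0.
by exists p, q; split=> //; rewrite -/(ev q) ev_eq0.
Qed.

Lemma inf_ramified : ramified x P.
Proof.
exists 2%N => //; split=> //.
- move=> z /in_ratfieldP[p [q [q0 ->]]] z0.
  have p0 : p != 0 by apply: contra_neq z0 => ->; rewrite rmorph0 mul0r.
  rewrite ord_div ?ev_eq0 // !ord_eval // (ord_inf_x model oPx).
  by exists ((size q).-1%:Z - (size p).-1%:Z); lia.
- exists x^-1; split; last by rewrite ordV (ord_inf_x model oPx).
  apply/in_ratfieldP; exists 1, 'X.
  by rewrite polyX_eq0 rmorph1 eval_atX div1r.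
Qed.
End AtInfinity.

Lemma model_degree2 : morphism_degree iota x 2.
Proof.
split; first exact: model_tr model.
exists (fun i => if i == 0 then 1 else y) => z.
have [a [b [d [d0 E]]]] := model_fraction model z.
have ed0 : ev d != 0 by rewrite ev_eq0.
have sum2 (c : 'I_2 -> F) :
    \sum_(i < 2) c i * (if i == 0 then 1 else y) = c 0 + c 1 * y.
  rewrite !big_ord_recl big_ord0 /= mulr1 addr0.
  by congr (_ + c _ * y); apply/val_inj.
exists [ffun i : 'I_2 => if i == 0 then ev a / ev d else ev b / ev d]; split.
  split; last by rewrite sum2 !ffunE /= E /eval2; field.
  by move=> i; apply/in_ratfieldP; rewrite ffunE; case: ifP => _;
    [exists a, d|exists b, d].
move=> c [Kc]; rewrite sum2 => Ez; apply/ffunP => i; rewrite ffunE.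
have /in_ratfieldP[p [q [q0 E0]]] := Kc 0.
have /in_ratfieldP[r [s [s0 E1]]] := Kc 1.
have eq0 : ev q != 0 by rewrite ev_eq0.
have es0 : ev s != 0 by rewrite ev_eq0.
have [] : a * (q * s) = p * (s * d) /\ b * (q * s) = r * (q * d).
  apply: (eval2_inj model); rewrite -eval2Z -[ev2 a b](divfK ed0) -E Ez E0 E1.
  by rewrite /eval2 !rmorphM /=; field; rewrite eq0 es0.
move/(congr1 ev); rewrite !rmorphM => Ea /(congr1 ev); rewrite !rmorphM => Eb.
move: Ea Eb => /= Ea Eb.
have [->|->] : i = 0 \/ i = 1.
- by case: i => [] [|[|//]] ?; [left|right]; apply/val_inj.
- rewrite /= E0; apply/eqP; rewrite eqr_div //; apply/eqP/(mulIf es0).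
  by rewrite -mulrA Ea; ring.
- rewrite /= E1; apply/eqP; rewrite eqr_div //; apply/eqP/(mulIf eq0).
  by rewrite -mulrA [_ * ev q]mulrC Eb; ring.
Qed.
End OddModelInf.

(** * Finite places *)

Section IrreducibleFactors.
Variable k : finFieldType.
Implicit Types p q : {poly k}.

Lemma irreducible_divisor p : (1 < size p)%N ->
  exists2 q, irreducible_poly q & q %| p.
Proof.
have [n] := ubnP (size p); elim: n p => // n IH p lt_n p1.
have [Ip|nIp] := classic (irreducible_poly p); first by exists p.
have [q [q1 qp nqp]] : exists q, [/\ size q != 1%N, q %| p & ~~ (q %= p)].
  apply: NNPP => nq; apply: nIp; split=> // q q1 qp; apply: contraT => nqp.
  by case: nq; exists q.
have p0 : p != 0 by rewrite -size_poly_gt0 ltnW.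
have q0 : q != 0 by apply: contraTneq qp => ->; rewrite dvd0p.
have lt_q : (size q < size p)%N by rewrite ltn_neqAle dvdp_leq // dvdp_size_eqp // nqp.
have [||r Ir rq] := IH q; first exact: leq_trans lt_q _.
  by rewrite ltn_neqAle eq_sym q1 size_poly_gt0.
by exists r => //; apply: dvdp_trans rq qp.
Qed.

Lemma irreducible_multiplicity p q : irreducible_poly p -> q != 0 ->
  exists n u, q = p ^+ n * u /\ ~~ (p %| u).
Proof.
move=> Ip; have [m] := ubnP (size q); elim: m q => // m IH q lt_m q0.
have [/dvdpP[r Er]|npq] := boolP (p %| q); last by exists 0%N, q; rewrite mul1r.
have r0 : r != 0 by apply: contra_neq q0 => r0; rewrite Er r0 mul0r.
have lt_r : (size r < size q)%N.
  have p1 : (1 < size p)%N := Ip.1.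
  have lt (a b : nat) : (0 < a)%N -> (1 < b)%N -> (a < (a + b).-1)%N by lia.
  by rewrite Er size_polyM // ?irredp_neq0 //; apply: lt; rewrite ?size_poly_gt0.
have [||n [u [Eu nu]]] := IH r => //; first exact: leq_trans lt_r _.
by exists n.+1, u; rewrite Er Eu exprS; split=> //; ring.
Qed.

Lemma irreducible_Euclid p q r :
  irreducible_poly p -> (p %| q * r) = (p %| q) || (p %| r).
Proof.
move=> Ip; have := irreducible_poly_coprime q Ip.
case: (boolP (p %| q)) => [pq _|_ /= cpq]; first by rewrite dvdp_mulr.
by rewrite Gauss_dvdpr.
Qed.
End IrreducibleFactors.

Section FinitePlaces.
Variables (k : finFieldType) (F : fieldType) (iota : {rmorphism k -> F}).
Variables (x y : F) (f : {poly k}).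
Hypothesis model : odd_model iota x y f.
Hypothesis k2 : 2%:R != 0 :> k.
Implicit Types (a b d p q : {poly k}) (z : F).

Local Notation ev := (eval_at iota x).
Local Notation ev2 := (eval2 iota x y).
Local Notation norm2 := (norm_poly f).
Local Notation ev_eq0 := (ev_eq0 model).
Local Notation eval2_eq0 := (eval2_eq0 model).

Definition coordinate_ring z := exists a b, z = ev2 a b.

(** The local ring at P is a localization of the coordinate ring k[x] + k[x] y. *)
Definition fractional (P : place iota) := forall z, in_local_ring P z ->
  exists a b a' b', [/\ ev2 a' b' != 0, ord P (ev2 a' b') = 0 & z = ev2 a b / ev2 a' b'].

Lemma local_ring_y (P : place iota) : in_local_ring P x -> in_local_ring P y.
Proof.
move=> Ox; have := local_ring_eval f Ox.
by rewrite -(model_eq model) /in_local_ring ordX pmulrn_lge0.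
Qed.

Lemma local_ring_ev2 (P : place iota) a b :
  in_local_ring P x -> in_local_ring P (ev2 a b).
Proof.
move=> Ox; apply: local_ringD; first exact: local_ring_eval.
by apply: local_ringM; [exact: local_ring_eval|exact: local_ring_y].
Qed.

Section OverIrreducible.
Variable pi : {poly k}.
Hypothesis Ipi : irreducible_poly pi.

(** [m a b] stands for membership of a + b y in a prime ideal of k[x] + k[x] y whose contraction to
    k[x] is generated by [pi]. *)
Record prime_over (m : {poly k} -> {poly k} -> Prop) : Prop := PrimeOver {
  prime_add : forall a b a' b', m a b -> m a' b' -> m (a + a') (b + b');
  prime_mul : forall a b a' b',
    m (a * a' + f * (b * b')) (a * b' + b * a') <-> m a b \/ m a' b';
  prime_cst : forall p, m p 0 <-> pi %| p
}.

(** If f is congruent to a square s^2 modulo [pi] (with s = 0 when [pi] divides f), the prime is the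
    kernel of y |-> s modulo [pi]. Otherwise [pi] is inert and generates a prime. *)
Lemma prime_over_exists : exists m, prime_over m.
Proof.
have pi0 := irredp_neq0 Ipi.
have [[s Hs]|ns] := classic (exists s : {poly k}, pi %| s ^+ 2 - f).
  exists (fun a b => pi %| a + b * s); split.
  - move=> a b a' b' h h'.
    have -> : a + a' + (b + b') * s = (a + b * s) + (a' + b' * s) by ring.
    by rewrite dvdp_add.
  - move=> a b a' b'.
    have -> : a * a' + f * (b * b') + (a * b' + b * a') * s =
              (a + b * s) * (a' + b' * s) - b * b' * (s ^+ 2 - f) by ring.
    rewrite dvdp_subl; last exact: dvdp_mull.
    rewrite irreducible_Euclid //.
    by split=> /orP.
  - by move=> p; rewrite mul0r addr0.
(* If b were invertible modulo [pi], with inverse v, then a^2 = f b^2 would make f the square of a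
   v. *)
have nN a b : pi %| norm2 a b -> (pi %| a) && (pi %| b).
  move=> dN; suff bb : pi %| b.
    rewrite bb andbT; move: dN; rewrite /norm_poly dvdp_subl; last first.
      by rewrite dvdp_mull // expr2 dvdp_mulr.
    by rewrite expr2 irreducible_Euclid // orbb.
  apply: contraT => nb; have := irreducible_poly_coprime b Ipi; rewrite nb.
  move/Bezout_eq1_coprimepP => [[u v] /= E]; case: ns; exists (a * v).
  have -> : (a * v) ^+ 2 - f = v ^+ 2 * norm2 a b + f * ((v * b) ^+ 2 - 1).
    by rewrite /norm_poly; ring.
  apply: dvdp_add; first exact: dvdp_mull.
  have -> : (v * b) ^+ 2 - 1 = - (1 + v * b) * (1 - v * b) by ring.
  by rewrite -[1 - v * b](_ : u * pi = _) ?dvdp_mull // -E addrK.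
exists (fun a b => (pi %| a) && (pi %| b)); split.
- by move=> a b a' b' /andP[? ?] /andP[? ?]; rewrite !dvdp_add.
- move=> a b a' b'; split=> [/andP[h h']|[|] /andP[h h']]; last first.
  + apply/andP; split; apply: dvdp_add;
      by rewrite ?(dvdp_mull _ h) ?(dvdp_mull _ h') // !dvdp_mull.
  + apply/andP; split; apply: dvdp_add;
      by rewrite ?(dvdp_mulr _ h) ?(dvdp_mulr _ h') // dvdp_mull // dvdp_mulr.
  have : pi %| norm2 a b * norm2 a' b'.
    rewrite -norm_polyM /norm_poly expr2; apply: dvdp_sub; first exact: dvdp_mull.
    by rewrite expr2 !dvdp_mull.
  by rewrite irreducible_Euclid // => /orP[] /nN; [left|right].
- by move=> p; rewrite dvdp0 andbT.
Qed.

Lemma prime_over_conj m : prime_over m -> prime_over (fun a b => m a (- b)).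
Proof.
case=> mD mM mC; split.
- by move=> a b a' b' h h'; rewrite opprD; apply: mD.
- move=> a b a' b'; rewrite -mM.
  have -> : - b * - b' = b * b' by ring.
  by have -> : - (a * b' + b * a') = a * - b' + - b * a' by ring.
- by move=> p; rewrite oppr0.
Qed.

Lemma separable_factor q : f = pi * q -> ~~ (pi %| q).
Proof.
move=> Ef; apply/negP => /dvdpP[r Er].
have := model_sep model; rewrite unlock Ef Er => /coprimepP /(_ pi).
have d1 : pi %| pi * (r * pi) by exact: dvdp_mulIl.
have d2 : pi %| (pi * (r * pi))^`().
  by rewrite derivM dvdp_add ?dvdp_mulIl // mulrA dvdp_mulIr.
by move/(_ d1 d2); rewrite -size_poly_eq1 eqn_leq leqNgt; case: Ipi => ->.
Qed.

Section PlaceOfPrime.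
Variable m : {poly k} -> {poly k} -> Prop.
Hypothesis Pm : prime_over m.

Let mD := prime_add Pm.
Let mM := prime_mul Pm.
Let mC := prime_cst Pm.

Let mMM a b a' b' (c d : {poly k}) : c = a * a' + f * (b * b') -> d = a * b' + b * a' ->
  m c d <-> m a b \/ m a' b'.
Proof. by move=> -> ->. Qed.

Let Mm z := exists a b, z = ev2 a b /\ m a b.

Let MmE a b : Mm (ev2 a b) <-> m a b.
Proof.
split=> [[a' [b' [/(eval2_inj model)[-> ->]] //]]|h]; by exists a, b.
Qed.

Let ev2C p : ev2 p 0 = ev p. Proof. exact: eval20. Qed.

Let dvd2 p : (pi %| p + p) = (pi %| p).
Proof.
have -> : p + p = 2%:R *: p by rewrite scaler_nat mulr2n.
by rewrite dvdpZr.
Qed.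

Let yE : y = ev2 0 1. Proof. by rewrite /eval2 rmorph0 rmorph1 mul1r add0r. Qed.

Let mMy a b : m a b -> m (f * b) a.
Proof.
move=> h; have /mM : m a b \/ m 0 1 by left.
by rewrite !mulr0 mulr1 add0r mulr1 addr0.
Qed.

Let m0_dvd b : m 0 b -> (pi %| f) || (pi %| b).
Proof. by move=> /mMy /mC; rewrite irreducible_Euclid. Qed.

Let m10 : ~ m 1 0.
Proof.
move/mC; rewrite dvdp1 => /eqP s1; by case: Ipi; rewrite s1.
Qed.

Let Mm1 : ~ Mm 1.
Proof. by move=> M1; apply: m10; apply/MmE; rewrite ev2C rmorph1. Qed.

(** When [pi] divides f the prime is ramified, and y is a local generator because y^2 = pi f1 with
    f1 prime to [pi]. Otherwise [pi] is one: if a + b y is in the prime but not divisible by [pi],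
    its conjugate lies outside the prime and multiplies it to the norm, a multiple of [pi]. *)
Lemma prime_generator : exists t (r : {poly k}) i, [/\ t != 0, Mm t, ~~ (pi %| r),
  ev (pi * r) = t ^+ i &
  forall z, Mm z -> exists e w,
    [/\ coordinate_ring e, ~ Mm e, coordinate_ring w & e * z = t * w]].
Proof.
have pi0 := irredp_neq0 Ipi.
have [pif|npif] := boolP (pi %| f).
  have [f1 Ef1] := dvdpP _ _ pif; rewrite mulrC in Ef1.
  have nf1 := separable_factor Ef1.
  have m01 : m 0 1.
    have mf : m f 0 by apply/mC.
    have [H _] : m f 0 <-> m 0 1 \/ m 0 1 by apply: mMM; ring.
    by case: (H mf).
  exists y, f1, 2%N; split=> //.
  - exact: model_y0 model.
  - by rewrite yE; apply/MmE.
  - by rewrite -Ef1 (model_eq model).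
  move=> z [a [b [Ez mab]]]; rewrite {}Ez.
  have ma : pi %| a.
    have [_ H] : m 0 (- b) <-> m 0 1 \/ m (- b) 0 by apply: mMM; ring.
    apply/mC; have := mD mab (H (or_introl m01)).
    by rewrite addr0 subrr.
  have [a1 Ea1] := dvdpP _ _ ma.
  exists (ev2 f1 0), (ev2 (f1 * b) a1); split.
  - by exists f1, 0.
  - by move/MmE/mC; apply/negP.
  - by exists (f1 * b), a1.
  transitivity (ev2 0 1 * ev2 (f1 * b) a1); last by rewrite -yE.
  by rewrite !(eval2M model); congr ev2; rewrite ?Ea1 ?Ef1; ring.
exists (ev pi), 1, 1%N; split.
- by rewrite ev_eq0.
- by rewrite -ev2C; apply/MmE/mC.
- by apply/negP => /mC.
- by rewrite mulr1.
move=> z [a [b [Ez mab]]]; rewrite {}Ez.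
have [/andP[/dvdpP[a1 Ea] /dvdpP[b1 Eb]]|nab] := boolP ((pi %| a) && (pi %| b)).
  exists 1, (ev2 a1 b1); split; last 1 first.
  - by rewrite mul1r mulrC eval2Z Ea Eb.
  - by exists 1, 0; rewrite ev2C rmorph1.
  - exact: Mm1.
  - by exists a1, b1.
have mN : m (norm2 a b) 0.
  have [_ H] : m (norm2 a b) 0 <-> m a b \/ m a (- b).
    by apply: mMM; rewrite /norm_poly; ring.
  by apply: H; left.
have [q Eq] : exists q, norm2 a b = q * pi by apply/dvdpP/mC.
exists (ev2 a (- b)), (ev q); split.
- by exists a, (- b).
- move/MmE => mabN; case/negP: nab; apply/andP.
  have pa : pi %| a.
    by rewrite -dvd2; apply/mC; have := mD mab mabN; rewrite subrr.
  split=> //; have : m 0 b.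
    have : m (- a) 0 by apply/mC; rewrite dvdpNr.
    by move/(mD mab); rewrite subrr addr0.
  by move/m0_dvd; rewrite (negPf npif).
- by exists q, 0; rewrite ev2C.
by rewrite mulrC (eval2_conj model) Eq rmorphM mulrC.
Qed.

Lemma place_of_prime : exists P : place iota,
  [/\ in_local_ring P x, fractional P &
    forall a b, in_maximal_ideal P (ev2 a b) <-> m a b].
Proof.
have [t [r [i [t0 Mt nr Er Mgen]]]] := prime_generator.
have MA z : Mm z -> coordinate_ring z by case=> a [b [-> _]]; exists a, b.
have AM z w : coordinate_ring z -> coordinate_ring w -> coordinate_ring (z * w).
  move=> [a [b ->]] [a' [b' ->]]; rewrite (eval2M model); by do 2 eexists.
have [|||||||||||P [PA PM Pfrac]] := @localization_place k F iota coordinate_ring Mm t.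
- by move=> c; exists c%:P, 0; rewrite ev2C eval_atC.
- by move=> z w [a [b ->]] [a' [b' ->]]; rewrite eval2D; do 2 eexists.
- exact: AM.
- exact: MA.
- by move=> z w [a [b ->]] [a' [b' ->]]; rewrite (eval2M model) !MmE mM.
- exact: Mm1.
- exact: Mt.
- exact: t0.
- exact: Mgen.
(* Write the norm of z as pi^n u with u prime to [pi]. Multiplying z by its conjugate and by r^n
   gives (pi r)^n u = t^(i n) u. *)
- move=> z [a [b ->]] n0; have N0 : norm2 a b != 0
    by rewrite (norm_poly_eq0 model) -eval2_eq0.
  have [n [u [EN nu]]] := irreducible_multiplicity Ipi N0.
  exists (i * n)%N, (ev u), (ev2 (a * r ^+ n) (- b * r ^+ n)); split.
  + by exists u, 0; rewrite ev2C.
  + by rewrite -ev2C => /MmE/mC; apply/negP.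
  + by do 2 eexists.
  + by rewrite -eval2Z mulrA (eval2_conj model) exprM -Er EN !(rmorphM,
      rmorphXn) /= exprMn; ring.
- move=> z; have [a [b [d [d0 ->]]]] := model_fraction model z.
  exists (ev2 a b), (ev d); split=> //; last by rewrite ev_eq0.
    by exists a, b.
  by exists d, 0; rewrite ev2C.
- exists P; split.
  + by apply: PA; exists 'X, 0; rewrite ev2C eval_atX.
  + move=> z /Pfrac[_ [_ [[a [b ->]] [a' [b' ->]] h0 o0 ->]]].
    by exists a, b, a', b'.
  + by move=> a b; rewrite PM ?MmE //; exists a, b.
Qed.
End PlaceOfPrime.
End OverIrreducible.

(** The coordinate ring is the intersection of its local rings. Write z = (a + b y) / d and remove
    an irreducible factor [pi] of d: since z is regular at the places over [pi], a + b y = z d lies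
    in a prime over [pi] and in its conjugate. Adding conjugates shows that [pi] divides 2a, and
    then that b y lies in the prime; separability of f then yields that [pi] divides b. *)
Lemma finite_places_coordinate_ring z :
  (forall P : place iota, in_local_ring P x -> fractional P -> in_local_ring P z) ->
  coordinate_ring z.
Proof.
move=> Hz; have [a [b [d [d0 Ez]]]] := model_fraction model z.
have [n] := ubnP (size d); elim: n => // n IH in a b d d0 Ez *; move=> lt_n.
have [sd|sd] := leqP (size d) 1.
  have : size d == 1%N by rewrite eqn_leq sd size_poly_gt0.
  case/size_poly1P => c c0 Ed; exists (c^-1 *: a), (c^-1 *: b).
  have ic0 : iota c != 0 by rewrite fmorph_eq0.
  by rewrite Ez Ed eval_atC /eval2 !eval_atZ fmorphV; field.
have [pi Ipi pid] := irreducible_divisor sd; have [d1 Ed] := dvdpP _ _ pid.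
have d10 : d1 != 0 by apply: contra_neq d0 => d10; rewrite Ed d10 mul0r.
have pi0 := irredp_neq0 Ipi.
have ed0 : ev d != 0 by rewrite ev_eq0.
have [m Pm] := prime_over_exists Ipi.
have Hm m' : prime_over pi m' -> exists P : place iota, [/\ in_local_ring P x,
    fractional P,
    forall a b, in_maximal_ideal P (ev2 a b) <-> m' a b & m' a b].
  move=> Pm'; have [P [Ox Fr HP]] := place_of_prime Ipi Pm'; exists P; split=> //.
  apply/HP; rewrite -[ev2 a b](divfK ed0) -Ez; apply: maximal_idealM.
    exact: Hz.
  rewrite -(eval20 iota x y); apply/HP/(prime_cst Pm').
  by rewrite Ed dvdp_mull.
have [P [Ox FrP HP mab]] := Hm _ Pm.
have [_ [_ _ _ /= mabN]] := Hm _ (prime_over_conj Pm).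
have mD := prime_add Pm; have mC := prime_cst Pm.
have pa : pi %| a.
  suff : pi %| 2%:R *: a by rewrite dvdpZr.
  by rewrite scaler_nat mulr2n; apply/mC; have := mD _ _ _ _ mab mabN; rewrite subrr.
have [a1 Ea] := dvdpP _ _ pa.
have m0b : m 0 b.
  have : m (- a) 0 by apply/mC; rewrite dvdpNr.
  by move/(mD _ _ _ _ mab); rewrite subrr addr0.
have pb : pi %| b.
  apply: contraT => npb; have mfb : m (f * b) 0.
    have [_] := prime_mul Pm 0 b 0 1.
    by rewrite !(mul0r, mulr0, mulr1, add0r, addr0); apply; left.
  have : pi %| f by move/mC: mfb; rewrite irreducible_Euclid // (negPf npb) orbF.
  move=> pif; have [q Eq] := dvdpP _ _ pif; rewrite mulrC in Eq.
  have npq := separable_factor Ipi Eq.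
  have nz p : p != 0 -> ev p != 0 by rewrite ev_eq0.
  have b0 : b != 0 by apply: contraNneq npb => ->; rewrite dvdp0.
  have q0 : q != 0 by apply: contraNneq npq => ->; rewrite dvdp0.
  have unit p : ~~ (pi %| p) -> ord P (ev p) = 0.
    move=> np; have p0 : p != 0 by apply: contraNneq np => ->; rewrite dvdp0.
    have := local_ring_eval p Ox; rewrite /in_local_ring le_eqVlt => /orP[/eqP //|lt].
    by case/negP: np; apply/mC/HP; rewrite eval20; right.
  have opi : 0 < ord P (ev pi).
    have : m pi 0 by apply/mC.
    by move/HP; rewrite eval20; case=> // /eqP; rewrite ev_eq0 (negPf pi0).
  (* [b] is a unit at [P], so [y / pi] is regular at [P], whereas [f = y ^+ 2] *)
  (* is not divisible by [pi ^+ 2].                                            *)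
  have : in_local_ring P (y / ev pi).
    have -> : y / ev pi = (z * ev d1 - ev a1) * (ev b)^-1.
      by rewrite Ez Ea Ed /eval2 !rmorphM /=; field; rewrite !nz.
    apply: local_ringM; last by rewrite /in_local_ring ordV unit.
    apply: local_ringD; last by apply/local_ringN/local_ring_eval.
    by apply: local_ringM; [apply: Hz|exact: local_ring_eval].
  move/(@local_ringX _ _ _ P _ 2); rewrite expr_div_n (model_eq model) Eq rmorphM /=.
  have -> : ev pi * ev q / ev pi ^+ 2 = ev q / ev pi by field; rewrite nz.
  by rewrite /in_local_ring ord_div ?nz // unit // sub0r oppr_ge0 leNgt opi.
have [b1 Eb] := dvdpP _ _ pb.
apply: (IH a1 b1 d1) => //; last first.
  have lt (i j : nat) : (1 < j)%N -> ((i + j).-1 < n.+1)%N -> (i < n)%N by lia.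
  by move: lt_n; rewrite Ed size_polyM //; apply: lt; case: Ipi.
have epi0 : ev pi != 0 by rewrite ev_eq0.
have ed10 : ev d1 != 0 by rewrite ev_eq0.
by rewrite Ez Ea Eb Ed -eval2Z rmorphM /=; field; rewrite ?epi0 ?ed10.
Qed.
End FinitePlaces.

(** * Differentials and the genus *)

Section Derivations.
Variables (k : finFieldType) (F : fieldType) (iota : {rmorphism k -> F}).
Implicit Types D : derivation iota.

Lemma der0 D : D 0 = 0.
Proof. by have := der_cst D 0; rewrite rmorph0. Qed.

Lemma derB_cst D z c : D (z - iota c) = D z.
Proof. by rewrite -rmorphN derD der_cst addr0. Qed.

Lemma der_div D a b : b != 0 -> D (a / b) = (D a - a / b * D b) / b.
Proof.
move=> b0; have := derM D (a / b) b; rewrite divfK // => ->.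
by field.
Qed.

Lemma der_eval D x p : D (eval_at iota x p) = eval_at iota x p^`() * D x.
Proof.
elim/poly_ind: p => [|p c IH]; first by rewrite linear0 rmorph0 mul0r der0.
rewrite derivMXaddC !(rmorphD, rmorphM) /= !eval_atX eval_atC derD der_cst derM IH.
ring.
Qed.
End Derivations.

Section ModelDerivation.
Variables (k : finFieldType) (F : fieldType) (iota : {rmorphism k -> F}).
Variables (x y : F) (f : {poly k}).
Hypothesis model : odd_model iota x y f.
Hypothesis k2 : 2%:R != 0 :> k.
Implicit Types (a b d p q : {poly k}) (z : F) (D : derivation iota).

Local Notation ev := (eval_at iota x).
Local Notation ev2 := (eval2 iota x y).
Local Notation norm2 := (norm_poly f).
Local Notation ev_eq0 := (ev_eq0 model).
Local Notation eval2_eq0 := (eval2_eq0 model).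

(** Differentiating y^2 = f(x) gives y dy = h dx with h = f' / 2. *)
Definition half_deriv : {poly k} := 2%:R^-1 *: f^`().
Local Notation h := half_deriv.

Lemma half_derivE : f^`() = h + h.
Proof. by rewrite /h -scalerDl -mulr2n -[_ *+ 2]mulr_natr mulVf // scale1r. Qed.

(** The value at a + b y of the derivation y d/dx, dual to the differential dx / y. It sends x to y
    and y to f' / 2, so it preserves k[x] + k[x] y. *)
Definition der2 a b : F := ev2 (b^`() * f + b * h) a^`().

Lemma der2M a b a' b' :
  der2 (a * a' + f * (b * b')) (a * b' + b * a') =
  ev2 a b * der2 a' b' + ev2 a' b' * der2 a b.
Proof.
rewrite /der2 !(eval2M model) eval2D; congr ev2;
  rewrite !(derivD, derivM) ?half_derivE; ring.
Qed.

Lemma der2_eval a b d : der2 (a * d) (b * d) = ev2 a b * der2 d 0 + ev d * der2 a b.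
Proof.
rewrite -(eval20 iota x y d) -der2M; congr der2; ring.
Qed.

(** The quotient rule extends [der2] to all fractions; its value does not depend on the presentation
    because [der2] satisfies the Leibniz rule. *)
Lemma model_derivation : exists D1 : derivation iota, forall a b, D1 (ev2 a b) = der2 a b.
Proof.
have ex z : exists w, forall a b d, d != 0 -> z = ev2 a b / ev d ->
    w = (der2 a b - z * der2 d 0) / ev d.
  have [a [b [d [d0 E]]]] := model_fraction model z.
  exists ((der2 a b - z * der2 d 0) / ev d) => a' b' d' d'0 E'.
  have ed0 : ev d != 0 by rewrite ev_eq0.
  have ed'0 : ev d' != 0 by rewrite ev_eq0.
  have [Ea Eb] : a * d' = a' * d /\ b * d' = b' * d.
    apply: (eval2_inj model); rewrite -!eval2Z.
    by rewrite -[ev2 a b](divfK ed0) -E E'; field.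
  have := der2_eval a b d'; rewrite Ea Eb der2_eval.
  rewrite -[ev2 a b](divfK ed0) -E -[ev2 a' b'](divfK ed'0) -E' => H.
  apply/eqP; rewrite eqr_div // -subr_eq0; apply/eqP.
  transitivity ((z * ev d * der2 d' 0 + ev d' * der2 a b) -
                (z * ev d' * der2 d 0 + ev d * der2 a' b')); first by ring.
  by rewrite H subrr.
have [o Ho] := functional_choice _ ex.
have oE a b d : d != 0 -> o (ev2 a b / ev d) = (der2 a b - (ev2 a b / ev d) * der2 d 0)
  / ev d.
  by move=> d0; apply: Ho.
have der20 c : der2 c%:P 0 = 0.
  by rewrite /der2 derivC linear0 !mul0r addr0 eval20 rmorph0.
have o2 a b : o (ev2 a b) = der2 a b.
  have := oE a b 1 (oner_neq0 _); rewrite rmorph1 !divr1 => ->.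
  by rewrite der20 mulr0 subr0.
have oC c : o (iota c) = 0.
  by rewrite -(eval_atC iota x) -(eval20 iota x y) o2 der20.
have oM2 z w : o (z * w) = z * o w + w * o z.
  have [a [b [d [d0 Ez]]]] := model_fraction model z.
  have [a' [b' [d' [d'0 Ew]]]] := model_fraction model w.
  have ed0 : ev d != 0 by rewrite ev_eq0.
  have ed'0 : ev d' != 0 by rewrite ev_eq0.
  have -> : z * w = (ev2 a b * ev2 a' b') / ev (d * d').
    by rewrite Ez Ew rmorphM /=; field; rewrite ed0 ed'0.
  rewrite (eval2M model) oE ?mulf_neq0 // der2M -(eval2M model) Ez Ew !oE //.
  have -> : der2 (d * d') 0 = ev d * der2 d' 0 + ev d' * der2 d 0.
    by rewrite -!(eval20 iota x y) -der2M; congr der2; ring.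
  by rewrite rmorphM /=; field; rewrite ed0 ed'0.
have oD2 z w : o (z + w) = o z + o w.
  have [a [b [d [d0 Ez]]]] := model_fraction model z.
  have [a' [b' [d' [d'0 Ew]]]] := model_fraction model w.
  have ed0 : ev d != 0 by rewrite ev_eq0.
  have ed'0 : ev d' != 0 by rewrite ev_eq0.
  have -> : z + w = (ev2 (a * d' + a' * d) (b * d' + b' * d)) / ev (d * d').
    by rewrite -eval2D -!eval2Z Ez Ew rmorphM /=; field; rewrite ed0 ed'0.
  rewrite oE ?mulf_neq0 //.
  have -> : der2 (a * d' + a' * d) (b * d' + b' * d) = der2 (a * d') (b * d') + der2
    (a' * d) (b' * d).
    by rewrite /der2 eval2D !derivD; congr ev2; ring.
  rewrite -eval2D -!eval2Z !der2_eval Ez Ew !oE //.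
  have -> : der2 (d * d') 0 = ev d * der2 d' 0 + ev d' * der2 d 0.
    by rewrite -!(eval20 iota x y) -der2M; congr der2; ring.
  by rewrite rmorphM /=; field; rewrite ed0 ed'0.
by exists (Defs.Derivation oC oD2 oM2).
Qed.

Lemma model_y D : y * D y = ev h * D x.
Proof.
have F2 : 2%:R != 0 :> F by rewrite -(rmorph_nat iota) fmorph_eq0.
have := derM D y y; rewrite -expr2 (model_eq model) der_eval half_derivE rmorphD /=.
by move=> E; apply: (mulfI F2); rewrite !mulr_natl !mulr2n -E; ring.
Qed.

Section Genus.
Variable D1 : derivation iota.
Hypothesis D1E : forall a b, D1 (ev2 a b) = der2 a b.

Lemma D1x : D1 x = y.
Proof.
have {1}-> : x = ev2 'X 0 by rewrite eval20 eval_atX.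
by rewrite D1E /der2 derivX linear0 !mul0r addr0 /eval2 rmorph0 rmorph1 mul1r add0r.
Qed.

(** The derivations of F over k form a line spanned by [D1], since a derivation is determined by its
    value at x. *)
Lemma derE D z : D z = D1 z * (D x / y).
Proof.
have y0 := model_y0 model.
have Dy : D y = ev h * D x / y by rewrite -model_y; field.
have D2E a b : D (ev2 a b) = der2 a b * (D x / y).
  rewrite /eval2 derD derM !der_eval Dy /der2 /eval2 !(rmorphD, rmorphM) /=.
  by rewrite -(model_eq model); field.
have [a [b [d [d0 ->]]]] := model_fraction model z.
have ed0 : ev d != 0 by rewrite ev_eq0.
rewrite !der_div // -(eval20 iota x y d) !D2E !D1E; ring.
Qed.

End Genus.
End ModelDerivation.

Section OrderBound.
Variables (k : finFieldType) (F : fieldType) (iota : {rmorphism k -> F}).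
Variable P : place iota.
Implicit Types (z w : F) (m n : int).

(* The order of [0] is infinite here, unlike the conventional value [ord P 0 = 0]. *)
Definition ord_ge n z := z = 0 \/ n <= ord P z.

Lemma ord_geW m n z : m <= n -> ord_ge n z -> ord_ge m z.
Proof. by move=> mn [->|nz]; [left|right; apply: le_trans nz]. Qed.

Lemma ord_ge_ord z : ord_ge (ord P z) z. Proof. by right. Qed.

Lemma ord_geD n z w : ord_ge n z -> ord_ge n w -> ord_ge n (z + w).
Proof.
move=> Hz Hw.
have [->|z0] := eqVneq z 0; first by rewrite add0r.
have [->|w0] := eqVneq w 0; first by rewrite addr0.
have [->|zw0] := eqVneq (z + w) 0; [by left|right].
apply: le_trans (ordD P z0 w0 zw0); rewrite le_min.
case: Hz => [/eqP|->]; first by rewrite (negPf z0).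
by case: Hw => [/eqP|//]; rewrite (negPf w0).
Qed.

Lemma ord_geN n z : ord_ge n z -> ord_ge n (- z).
Proof. by case=> [->|h]; [left; rewrite oppr0|right; rewrite ordN]. Qed.

Lemma ord_geM m n z w : ord_ge m z -> ord_ge n w -> ord_ge (m + n) (z * w).
Proof.
have [->|z0] := eqVneq z 0; first by left; rewrite mul0r.
have [->|w0] := eqVneq w 0; first by left; rewrite mulr0.
case=> [/eqP|Hz]; first by rewrite (negPf z0).
case=> [/eqP|Hw]; first by rewrite (negPf w0).
by right; rewrite ordM // lerD.
Qed.

Lemma ord_ge_sum n (I : Type) (r : seq I) (h : I -> F) :
  (forall i, ord_ge n (h i)) -> ord_ge n (\sum_(i <- r) h i).
Proof.
by move=> H; elim/big_ind: _ => //; [left|exact: ord_geD].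
Qed.

Lemma ord_geP n z : z != 0 -> ord_ge n z -> n <= ord P z.
Proof. by move=> z0 [/eqP|//]; rewrite (negPf z0). Qed.

End OrderBound.

Section Genus.
Variables (k : finFieldType) (F : fieldType) (iota : {rmorphism k -> F}).
Variables (x y : F) (f : {poly k}).
Hypothesis model : odd_model iota x y f.
Variable g : nat.
Hypothesis sf : size f = (2 * g + 2)%N.
Implicit Types (a b d p q : {poly k}) (z : F) (D : derivation iota).

Local Notation ev := (eval_at iota x).
Local Notation ev2 := (eval2 iota x y).
Local Notation norm2 := (norm_poly f).
Local Notation ev_eq0 := (ev_eq0 model).
Local Notation eval2_eq0 := (eval2_eq0 model).
Local Notation h := (half_deriv f).

Let x0 : x != 0 := model_x0 model.
Let y0 : y != 0 := model_y0 model.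

Lemma ord_inf_y (P : place iota) : ord P x < 0 -> ord P y = - (2 * g%:Z + 1).
Proof.
move=> Px; have := ord2_eval_y model Px (oner_neq0 _).
by rewrite rmorph1 mul1r expr1n mulr1 (ord_inf_x model Px) sf; lia.
Qed.

Lemma ord_inf_eval (P : place iota) p : ord P x < 0 -> p != 0 ->
  ord P (ev p) = - (2 * (size p).-1%:Z).
Proof. by move=> Px p0; rewrite ord_eval // (ord_inf_x model Px) mulNr. Qed.

Lemma ord_inf_ev2 (P : place iota) a b : ord P x < 0 -> ev2 a b != 0 ->
  ord P (ev2 a b) = - (maxn (2 * (size a).-1) (if b == 0%R then 0 else 2 * g + 1 + 2 *
    (size b).-1))%N%:Z.
Proof.
move=> Px n0; have := ord_inf model Px (oner_neq0 _) n0.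
rewrite rmorph1 divr1 => ->; rewrite /inf_order size_poly1 (size_norm_poly model)
  size_poly_sqr.
have [->|b0] := eqVneq b 0; first by rewrite expr0n (mulr0 f) size_poly0; plia.
rewrite size_polyM ?expf_neq0 ?(model_neq0 model) // size_poly_sqr sf.
by move: b0; rewrite -size_poly_gt0; plia.
Qed.

Hypothesis k2 : 2%:R != 0 :> k.

(* Where x is regular, u f + v f' = 1 gives dx/y = u y dx + 2 v dy; where x has *)
(* a pole, dx is a multiple of dt for the uniformizer t = x^g / y.              *)
Lemma regular_basis i : (i < g)%N ->
  regular_differential (fun D : derivation iota => x ^+ i * (D x / y)).
Proof.
move=> ig; have F2 : 2%:R != 0 :> F by rewrite -(rmorph_nat iota) fmorph_eq0.
split.
  exists 1%N, (fun _ => x ^+ i / y), (fun _ => x) => D.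
  by rewrite big_ord1 mulrA mulrAC.
move=> P; have [Px|Px] := leP 0 (ord P x).
  have [[u v] /= E] : exists u : {poly k} * {poly k}, u.1 * f + u.2 * f^`() = 1.
    by apply/Bezout_eq1_coprimepP; have := model_sep model; rewrite unlock.
  have Oy := local_ring_y model Px.
  exists 2%N, (fun j => if j == 0 then x ^+ i * ev u * y else x ^+ i * 2%:R * ev v),
    (fun j => if j == 0 then x else y); split.
    move=> j; case: ifP => _; split=> //.
    - by apply: local_ringM => //; apply: local_ringM;
        [exact: local_ringX|exact: local_ring_eval].
    - apply: local_ringM; last exact: local_ring_eval.
      by apply: local_ringM; [exact: local_ringX|rewrite -(rmorph_nat iota);
        exact: local_ring_cst].
  move=> D; rewrite !big_ord_recl big_ord0 /= addr0.
  have Dy : D y = ev h * D x / y by rewrite -(model_y model k2); field.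
  have E' : ev u * y ^+ 2 + ev v * ((1 + 1) * ev h) = 1.
    rewrite (model_eq model) mulrDl mul1r -rmorphD /= -half_derivE //.
    by rewrite -!rmorphM -rmorphD E rmorph1.
  rewrite Dy -[in LHS](mul1r (D x)) -{1}E'; field.
  exact: y0.
(* This is the numerator of dt / dx for t = x^g / y. Its top coefficient is that of f times 2g - (2g
   + 1) = -1, so it has the degree of f in every characteristic. *)
pose e : {poly k} := (2 * g)%:R *: f - 'X * f^`().
have coef_e j : e`_j = ((2 * g)%:R - j%:R) * f`_j.
  rewrite coefB coefZ coefXM; case: j => [|j] /=; first by rewrite !subr0.
  by rewrite coef_deriv mulrBl mulr_natl.
have se : size e = (2 * g + 2)%N.
  apply/eqP; rewrite eqn_leq; apply/andP; split.
    by apply/leq_sizeP => j le; rewrite coef_e [f`_j]nth_default ?mulr0 // sf.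
  rewrite addn2 ltnNge; apply/negP => /leq_sizeP /(_ (2 * g + 1)%N).
  rewrite addn1 leqnn => /(_ isT) /eqP; rewrite coef_e -natr1 opprD addNKr.
  have -> : f`_(2 * g).+1 = lead_coef f by rewrite lead_coefE sf addn2.
  by rewrite mulN1r oppr_eq0 lead_coef_eq0 (negPf (model_neq0 model)).
have e0 : e != 0 by rewrite -size_poly_eq0 se addn2.
have ee0 : ev e != 0 by rewrite ev_eq0.
pose t := x ^+ g / y.
have g0 : (0 < g)%N by apply: leq_ltn_trans ig.
have xn0 n : x ^+ n != 0 by rewrite expf_neq0.
have oPy := ord_inf_y Px; have oPx := ord_inf_x model Px.
exists 1%N, (fun _ => x ^+ i * (2%:R * y ^+ 2 * x / (x ^+ g * ev e))), (fun _ => t).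
split.
  move=> _; split; last by rewrite /in_local_ring ord_div // ordX oPy oPx; lia.
  rewrite /in_local_ring ordM // ?mulf_neq0 ?invr_eq0 ?mulf_neq0 ?expf_neq0 //.
  rewrite ord_div ?mulf_neq0 ?expf_neq0 // !ordM ?mulf_neq0 ?expf_neq0 // !ordX.
  rewrite oPy oPx (ord_inf_eval Px e0) se -(rmorph_nat iota) ord_cst.
  by lia.
move=> D; rewrite big_ord1.
have Dy : D y = ev h * D x / y by rewrite -(model_y model k2); field.
have Dxg : D (x ^+ g) = g%:R * x ^+ g / x * D x.
  have Exn n : x ^+ n = ev 'X^n by rewrite rmorphXn /= eval_atX.
  have {2}-> : x ^+ g = x ^+ g.-1 * x by rewrite -exprSr prednK.
  by rewrite {1}Exn der_eval derivXn rmorphMn /= -Exn -mulr_natl; field.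
have Ee : ev e = 2%:R * (g%:R * y ^+ 2 - x * ev h).
  rewrite rmorphB /= eval_atZ rmorph_nat natrM rmorphM /= eval_atX (model_eq model).
  by rewrite half_derivE // rmorphD /=; ring.
have Dt : D t = ev e * x ^+ g / (2%:R * y ^+ 3 * x) * D x.
  by rewrite der_div // Dxg Dy Ee /t; field; rewrite F2 x0 y0.
rewrite Dt; field; rewrite ?ee0 ?x0 ?F2 ?xn0 ?y0 //.
Qed.

Variable D1 : derivation iota.
Hypothesis D1E : forall a b, D1 (ev2 a b) = der2 iota x y f a b.

Lemma local_ring_D1 (P : place iota) z : in_local_ring P x -> fractional x y P ->
  in_local_ring P z -> in_local_ring P (D1 z).
Proof.
move=> Ox Fr Oz; have [a [b [a' [b' [n0 o0 Ez]]]]] := Fr _ Oz.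
rewrite Ez der_div // -Ez; apply: local_ringM; last by rewrite /in_local_ring ordV o0.
rewrite !D1E; apply: local_ringD; first exact: (local_ring_ev2 model).
by apply/local_ringN/local_ringM => //; apply: (local_ring_ev2 model).
Qed.

Lemma ord_ge_eval (P : place iota) p n : ord P x < 0 -> (size p <= n.+1)%N ->
  ord_ge P (- (2 * n%:Z)) (ev p).
Proof.
move=> Px sp; have [->|p0] := eqVneq p 0; first by left; rewrite rmorph0.
by right; rewrite ord_inf_eval //; plia.
Qed.

(** Differentiation with respect to x raises the order at infinity by at least 2, and multiplication
    by y lowers it by 2g + 1. *)
Lemma ord_ge_D1 (P : place iota) z : ord P x < 0 -> z != 0 ->
  ord_ge P (ord P z + 1 - 2 * g%:Z) (D1 z).
Proof.
move=> Px z0; have oPy := ord_inf_y Px.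
have shp : (size (h : {poly k}) <= 2 * g + 1)%N.
  rewrite /half_deriv (leq_trans (size_scale_leq _ _)) //.
  by rewrite -ltnS; apply: leq_trans (lt_size_deriv (model_neq0 model)) _; rewrite sf;
    plia.
have sd p : (size p^`() <= (size p).-1)%N.
  have [->|p0] := eqVneq p 0; first by rewrite linear0 size_poly0.
  by have := lt_size_deriv p0; plia.
have Hd a b : ev2 a b != 0 ->
    ord_ge P (ord P (ev2 a b) + 1 - 2 * g%:Z) (der2 iota x y f a b).
  move=> n0; rewrite ord_inf_ev2 // /der2 /eval2 !rmorphD !rmorphM /=.
  have evy (p : {poly k}) n : (size p <= n.+1)%N ->
    ord_ge P (- (2 * n%:Z) - (2 * g%:Z + 1)) (ev p * y).
    by move=> sp; apply: ord_geM; [exact: ord_ge_eval|right; rewrite oPy].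
  apply: ord_geD; first (have [->|b0] := eqVneq b 0).
  - by left; rewrite linear0 rmorph0 !mul0r addr0.
  - apply: ord_geD.
    + have [s1|s2] := leqP (size b) 1.
        left; rewrite [b^`()](_ : _ = 0) ?rmorph0 ?mul0r //.
        by apply/eqP; rewrite -size_poly_eq0; have := sd b; plia.
      apply: (@ord_geW _ _ _ _ _ (- (2 * (size b).-2%:Z) + - (2 * (2 * g + 1)%N%:Z)));
        first by plia.
      by apply: ord_geM; apply: ord_ge_eval => //; [have := sd b|]; plia.
    + apply: (@ord_geW _ _ _ _ _ (- (2 * (size b).-1%:Z) + - (2 * (2 * g)%N%:Z)));
        first by plia.
      by apply: ord_geM; apply: ord_ge_eval => //; plia.
  - have [s1|s2] := leqP (size a) 1.
      left; rewrite [a^`()](_ : _ = 0) ?rmorph0 ?mul0r //.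
      by apply/eqP; rewrite -size_poly_eq0; have := sd a; plia.
    apply: ord_geW (evy _ (size a).-2 _); last by have := sd a; plia.
    by case: ifP => _; plia.
have [a [b [d [d0 Ez]]]] := model_fraction model z.
have ed0 : ev d != 0 by rewrite ev_eq0.
have n0 : ev2 a b != 0 by apply: contra_neq z0; rewrite Ez => ->; rewrite mul0r.
have oz : ord P z = ord P (ev2 a b) - ord P (ev d) by rewrite Ez ord_div.
have nd : ev2 d 0 != 0 by rewrite eval20.
rewrite Ez der_div // -Ez -(eval20 iota x y d) !D1E.
have -> : ord P z + 1 - 2 * g%:Z = (ord P (ev2 a b) + 1 - 2 * g%:Z) + ord P (ev2 d 0)^-1.
  by rewrite ordV eval20 oz; plia.
apply: ord_geM; last exact: ord_ge_ord.
apply: ord_geD; first exact: Hd.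
apply/ord_geN; have -> : ord P (ev2 a b) + 1 - 2 * g%:Z = ord P z + (ord P (ev2 d 0) +
  1 - 2 * g%:Z).
  by rewrite eval20 oz; plia.
by apply: ord_geM; [exact: ord_ge_ord|exact: Hd].
Qed.

(** A regular differential is Z dx / y with Z = [w D1]. Regularity at the finite places makes Z = A
    + B y a polynomial expression, and regularity at infinity gives Z order at least 2 - 2g. As y
    has order -(2g + 1), this forces B = 0 and deg A < g. *)
Lemma model_genus (P : place iota) : ord P x < 0 -> has_genus iota g.
Proof.
move=> Px; exists (fun i D => x ^+ i * (D x / y)); split.
  by move=> i; apply: regular_basis.
move=> w [[n [a0 [f0 Ew]]] Hw].
have Dx1 : D1 x / y = 1 by rewrite (D1x D1E) divff.
pose Z := w D1.
have wE D : w D = Z * (D x / y).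
  rewrite /Z !Ew mulr_suml; apply: eq_bigr => j _.
  by rewrite (derE model k2 D1E D) mulrA.
have [A [B EZ]] : coordinate_ring iota x y Z.
  apply: (finite_places_coordinate_ring model k2) => Q Ox Fr.
  rewrite /Z; have [l [b [e [Ob ->]]]] := Hw Q; apply: local_ring_sum => i.
  have [Obi Oei] := Ob i.
  by apply: local_ringM => //; apply: local_ring_D1.
(* Subtracting its residue from a regular function leaves its differential unchanged and makes its
   order at least 1, so [ord_ge_D1] gives 1 + 1 - 2g. *)
have oZ : ord_ge P (2 - 2 * g%:Z) Z.
  rewrite /Z; have [l [b [e [Ob ->]]]] := Hw P; apply: ord_ge_sum => i.
  have [Obi Oei] := Ob i; rewrite -[2 - _]add0r; apply: ord_geM; first by right.
  have [c Hc] := inf_rational model Px Oei; rewrite -(derB_cst D1 _ c).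
  have [->|n0] := eqVneq (e i - iota c) 0; first by left; rewrite der0.
  apply: ord_geW (ord_ge_D1 Px n0); have := (maximal_idealP P n0).1 Hc; plia.
have [B0 sA] : B = 0 /\ (size A <= g)%N.
  have [Z0|Z0] := eqVneq Z 0.
    by move/eqP: Z0; rewrite EZ eval2_eq0 => /andP[/eqP-> /eqP->]; rewrite size_poly0.
  have := ord_geP Z0 oZ; rewrite EZ in Z0 *; rewrite ord_inf_ev2 //.
  have [B0|B0] := eqVneq B 0; last by plia.
  split=> //; plia.
have sumE (c : {ffun 'I_g -> k}) D :
    \sum_(i < g) iota (c i) * (x ^+ i * (D x / y)) =
    ev (\sum_(i < g) c i *: 'X^i) * (D x / y).
  rewrite rmorph_sum mulr_suml; apply: eq_bigr => i _.
  by rewrite /= eval_atZ rmorphXn /= eval_atX mulrA.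
exists [ffun i : 'I_g => A`_i]; split.
  move=> D; rewrite sumE wE EZ B0 eval20; congr (ev _ * _).
  apply/polyP => j; rewrite coef_sum.
  have [jg|jg] := ltnP j g; last first.
    rewrite nth_default ?(leq_trans sA) // big1 // => i _.
    by rewrite coefZ coefXn gtn_eqF ?mulr0 // (leq_trans (ltn_ord i)).
  rewrite (bigD1 (Ordinal jg)) //= big1 => [|i ij].
    by rewrite addr0 coefZ coefXn eqxx mulr1 ffunE.
  rewrite coefZ coefXn; case: eqP => [E|]; last by rewrite mulr0.
  by case/eqP: ij; apply/val_inj.
move=> c Hc; apply/ffunP => j; rewrite ffunE.
have := Hc D1; rewrite sumE wE Dx1 !mulr1 EZ B0 eval20 => /(ev_inj model) ->.
rewrite coef_sum (bigD1 j) //= big1 => [|i ij].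
  by rewrite addr0 coefZ coefXn eqxx mulr1.
rewrite coefZ coefXn; case: eqP => [E|]; last by rewrite mulr0.
by case/eqP: ij; apply/val_inj.
Qed.
End Genus.

(** * Geometric irreducibility *)

Section GeometricIrreducibility.
Variables (k : finFieldType) (F : fieldType) (iota : {rmorphism k -> F}).
Variable P : place iota.
Hypothesis ratP : rational_point P.

Lemma primitive_multiple (q : {poly F}) : q != 0 ->
  exists c i, [/\ c != 0, (c *: q)`_i = 1 & forall j, in_local_ring P (c *: q)`_j].
Proof.
move=> q0; pose I := [pred i : 'I_(size q) | q`_i != 0].
have sq : ((size q).-1 < size q)%N by rewrite prednK ?size_poly_gt0.
have Ii0 : I (Ordinal sq) by rewrite /= -lead_coefE lead_coef_eq0.
case: (@Order.TotalTheory.arg_minP _ _ _ (Ordinal sq) I (fun i => ord P q`_i) Ii0).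
move=> i /= qi0 min_i; exists (q`_i)^-1, i; split.
- by rewrite invr_eq0.
- by rewrite coefZ mulVf.
- move=> j; rewrite coefZ /in_local_ring; have [->|qj0] := eqVneq q`_j 0.
    by rewrite mulr0 ord0.
  rewrite ordM ?invr_eq0 // ordV addrC subr_ge0.
  have jq : (j < size q)%N.
    by rewrite ltnNge; apply: contra qj0 => le; rewrite nth_default.
  exact: (min_i (Ordinal jq)).
Qed.

Lemma maximal_ideal_sum (I : Type) (r : seq I) (h : I -> F) :
  (forall i, in_maximal_ideal P (h i)) -> in_maximal_ideal P (\sum_(i <- r) h i).
Proof.
move=> Mh; elim/big_ind: _ => //; first by left.
by move=> *; apply: maximal_idealD.
Qed.

(* Gauss's lemma at the place P, followed by reduction modulo P. *)
Lemma rational_point_geom_irr : geometrically_irreducible iota.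
Proof.
move=> p Ip; split=> [|q sq1 /dvdpP[r Epr]]; first by rewrite size_map_poly; case: Ip.
have p0 := irredp_neq0 Ip.
have mp0 : map_poly iota p != 0 by rewrite map_poly_eq0.
have q0 : q != 0 by apply: contraNneq mp0 => q0; rewrite Epr q0 mulr0.
have r0 : r != 0 by apply: contraNneq mp0 => r0; rewrite Epr r0 mul0r.
have ex z : exists c, in_local_ring P z -> in_maximal_ideal P (z - iota c).
  have [Oz|nO] := classic (in_local_ring P z); last by exists 0.
  by have [c] := ratP Oz; exists c.
have [res Hres] := functional_choice _ ex.
have res0 : res 0 = 0.
  have /Hres : in_local_ring P 0 by rewrite /in_local_ring ord0.
  by rewrite sub0r -rmorphN => /maximal_ideal_cst/eqP; rewrite oppr_eq0 => /eqP.
pose bar (s : {poly F}) : {poly k} := \poly_(i < size s) res s`_i.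
have coef_bar s j : (bar s)`_j = res s`_j.
  by rewrite coef_poly; case: ltnP => // le; rewrite nth_default.
have redn s : s != 0 -> exists c, [/\ c != 0, bar (c *: s) != 0,
    (size (bar (c *: s)) <= size s)%N &
    forall j, in_local_ring P (c *: s)`_j /\ in_maximal_ideal P ((c *: s)`_j - iota
      (bar (c *: s))`_j)].
  move=> s0; have [c [i [c0 ci Oc]]] := primitive_multiple s0.
  exists c; split=> //.
  - apply/eqP => /polyP /(_ i); rewrite coef_bar coef0 ci => r1.
    have /Hres : in_local_ring P 1 by rewrite /in_local_ring ord1.
    rewrite r1 rmorph0 subr0 -(rmorph1 iota) => /maximal_ideal_cst /eqP.
    by rewrite oner_eq0.
  - by rewrite (leq_trans (size_poly _ _)) // size_scale.
  - by move=> j; rewrite coef_bar; split=> //; apply: Hres.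
have [c [c0 bq0 sbq Hq]] := redn q q0.
have [d [d0 br0 sbr Hr]] := redn r r0.
set q' := c *: q in bq0 sbq Hq; set r' := d *: r in br0 sbr Hr.
pose e := c * d.
have Ee : q' * r' = e *: map_poly iota p.
  by rewrite /q' /r' -scalerAl -scalerAr scalerA Epr [r * q]mulrC.
have Hqr j : in_maximal_ideal P (e * iota p`_j - iota (bar q' * bar r')`_j).
  rewrite -coef_map -coefZ -Ee !coefM rmorph_sum -sumrB.
  apply: maximal_ideal_sum => i; rewrite rmorphM /=.
  set a := q'`_i; set b := r'`_(j - i); set a' := iota _; set b' := iota _.
  have -> : a * b - a' * b' = b * (a - a') + a' * (b - b') by ring.
  apply: maximal_idealD; apply: maximal_idealM.
  - by case: (Hr (j - i)%N).
  - by case: (Hq i).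
  - exact: local_ring_cst.
  - by case: (Hr (j - i)%N).
have bqr0 : bar q' * bar r' != 0 by rewrite mulf_neq0.
have e0 : e != 0 by rewrite mulf_neq0.
(* The product of the two reductions is nonzero, so some coefficient of [e *: map_poly iota p] has
   order 0; nonzero constants have order 0 too, hence [e] is a unit at P. *)
have oe : ord P e = 0.
  pose j := (size (bar q' * bar r')).-1.
  have cj0 : (bar q' * bar r')`_j != 0 by rewrite -lead_coefE lead_coef_eq0.
  have icj0 : iota (bar q' * bar r')`_j != 0 by rewrite fmorph_eq0.
  have := Hqr j; set w := _ - _ => Mw.
  have Ew : e * iota p`_j = iota (bar q' * bar r')`_j + w by rewrite addrC subrK.
  have [E0 Eo] : e * iota p`_j != 0 /\ ord P (e * iota p`_j) = 0.
    rewrite Ew; case: Mw => [->|ow]; first by rewrite addr0 ord_cst.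
    have w0 : w != 0 by apply: contraTneq ow => ->; rewrite ord0.
    by have := @ordD_lt _ _ _ P _ _ icj0 w0; rewrite ord_cst; apply.
  have pj0 : iota p`_j != 0 by apply: contraNneq E0 => ->; rewrite mulr0.
  by move: Eo; rewrite ordM // ord_cst addr0.
have Oe : in_local_ring P e by rewrite /in_local_ring oe.
have Epq : bar q' * bar r' = res e *: p.
  apply/polyP => j; apply/eqP; rewrite -subr_eq0 coefZ; apply/eqP.
  apply: (@maximal_ideal_cst _ _ _ P); rewrite rmorphB rmorphM /=.
  have -> : iota (bar q' * bar r')`_j - iota (res e) * iota p`_j =
     iota p`_j * (e - iota (res e)) - (e * iota p`_j - iota (bar q' * bar r')`_j) by ring.
  apply: maximal_idealD; first by apply: maximal_idealM;
    [exact: local_ring_cst|exact: Hres].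
  rewrite -mulN1r; apply: maximal_idealM => //.
  by rewrite /in_local_ring ordN ord1.
have re0 : res e != 0.
  by apply: contraNneq bqr0 => E; rewrite Epq E scale0r.
(* Reduction can only lower the degrees of the two factors, and the degree of the product is
   preserved, so neither drops. *)
have sE : size (bar q') = size q.
  have : size (bar q' * bar r') = size (r * q).
    by rewrite Epq -Epr size_map_poly size_scale.
  rewrite !size_mul // => E; apply/eqP; rewrite eqn_leq sbq /=.
  have bq1 : (0 < size (bar q'))%N by rewrite size_poly_gt0.
  have r1 : (0 < size r)%N by rewrite size_poly_gt0.
  have H (a b a' b' : nat) : (0 < a)%N -> (0 < b')%N -> (a <= a')%N -> (b <= b')%N ->
    (a + b).-1 = (b' + a').-1 -> (a' <= a)%N by lia.
  exact: H bq1 r1 sbq sbr E.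
have dq : bar q' %| p by rewrite -(dvdpZr _ _ re0) -Epq dvdp_mulr.
have : bar q' %= p by apply: Ip.2 => //; rewrite sE.
move/eqp_size; rewrite sE => E; rewrite -dvdp_size_eqp ?Epr ?dvdp_mull //.
by rewrite -Epr size_map_poly E.
Qed.
End GeometricIrreducibility.

(** * Isomorphisms of models *)

Section PlacePullback.
Variables (k : finFieldType) (F F' : fieldType).
Variables (iota : {rmorphism k -> F}) (iota' : {rmorphism k -> F'}).
Variable phi : {rmorphism F' -> F}.
Hypothesis phi_cst : forall c, phi (iota' c) = iota c.

Lemma rmorph_eval x p : phi (eval_at iota' x p) = eval_at iota (phi x) p.
Proof.
rewrite !eval_at_coef rmorph_sum; apply: eq_bigr => i _.
by rewrite rmorphM rmorphXn /= phi_cst.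
Qed.

Lemma pullback_place (P : place iota) : bijective phi ->
  exists Q : place iota', forall z, ord Q z = ord P (phi z).
Proof.
move=> [psi phiK psiK].
have oC c : ord P (phi (iota' c)) = 0 by rewrite phi_cst ord_cst.
have oM z w : z != 0 -> w != 0 -> ord P (phi (z * w)) = ord P (phi z) + ord P (phi w).
  by move=> z0 w0; rewrite rmorphM ordM // fmorph_eq0.
have oD z w : z != 0 -> w != 0 -> z + w != 0 ->
    Num.min (ord P (phi z)) (ord P (phi w)) <= ord P (phi (z + w)).
  by move=> z0 w0 zw0; rewrite rmorphD ordD -?rmorphD ?fmorph_eq0.
have ot : exists t, ord P (phi t) = 1.
  by have [t ot] := ord_uniformizer P; exists (psi t); rewrite psiK.
by exists (Place oC oM oD ot).
Qed.

Lemma transport_model x y f : bijective phi ->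
  odd_model iota' x y f -> odd_model iota (phi x) (phi y) f.
Proof.
move=> [psi phiK psiK] [tr E sep od gen]; split=> //.
- move=> [p p0 /eqP]; rewrite -/(eval_at iota (phi x) p) -rmorph_eval => /eqP.
  by rewrite fmorph_eq0 => rp; apply: tr; exists p.
- by rewrite -rmorphXn /= E rmorph_eval.
- move=> z; have [a [b [d [d0 Ez]]]] := gen (psi z); exists a, b, d; split=> //.
  by rewrite -[LHS]psiK Ez fmorph_div rmorphD rmorphM /= !rmorph_eval.
Qed.
End PlacePullback.

Section ModelIsomorphism.
Variables (k : finFieldType) (F F' : fieldType).
Variables (iota : {rmorphism k -> F}) (iota' : {rmorphism k -> F'}).
Variables (x y : F) (x' y' : F') (f : {poly k}).
Hypotheses (model : odd_model iota x y f) (model' : odd_model iota' x' y' f).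

Lemma model_morphism : exists phi : {rmorphism F' -> F}, forall a b d, d != 0 ->
  phi (eval2 iota' x' y' a b / eval_at iota' x' d) = eval2 iota x y a b / eval_at iota
    x d.
Proof.
pose E a b (d : {poly k}) := eval2 iota x y a b / eval_at iota x d.
pose E' a b (d : {poly k}) := eval2 iota' x' y' a b / eval_at iota' x' d.
have gen z : exists a b d, d != 0 /\ z = E' a b d := model_fraction model' z.
have ex z : exists w, forall a b d, d != 0 -> z = E' a b d -> w = E a b d.
  have [a [b [d [d0 Ez]]]] := gen z; exists (E a b d) => a1 b1 d1 d10 Ez1.
  have ed0 : eval_at iota' x' d != 0 by rewrite (ev_eq0 model').
  have ed10 : eval_at iota' x' d1 != 0 by rewrite (ev_eq0 model').
  have [Ea Eb] : a * d1 = a1 * d /\ b * d1 = b1 * d.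
    apply: (eval2_inj model'); rewrite -!eval2Z; apply/eqP.
    by rewrite -eqr_div //; apply/eqP; rewrite -[LHS]Ez.
  apply/eqP; rewrite eqr_div ?(ev_eq0 model) // !eval2Z; apply/eqP.
  by congr (eval2 _ _ _ _ _).
have [o Ho] := functional_choice _ ex.
have oE a b d : d != 0 -> o (E' a b d) = E a b d by move=> d0; apply: Ho.
have n0 d : d != 0 -> eval_at iota x d != 0 by rewrite (ev_eq0 model).
have n0' d : d != 0 -> eval_at iota' x' d != 0 by rewrite (ev_eq0 model').
have o1 : o 1 = 1.
  have -> : 1 = E' 1 0 1 by rewrite /E' eval20 !rmorph1 divr1.
  by rewrite oE ?oner_neq0 // /E eval20 !rmorph1 divr1.
have oM z w : o (z * w) = o z * o w.
  have [a [b [d [d0 ->]]]] := gen z; have [a1 [b1 [d1 [d10 ->]]]] := gen w.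
  have -> : E' a b d * E' a1 b1 d1 = E' (a * a1 + f * (b * b1)) (a * b1 + b * a1) (d *
    d1).
    by rewrite /E' -(eval2M model') rmorphM /=; field; rewrite !n0'.
  rewrite !oE ?mulf_neq0 // /E -(eval2M model) rmorphM /=.
  by field; rewrite !n0.
have oB z w : o (z - w) = o z - o w.
  have [a [b [d [d0 ->]]]] := gen z; have [a1 [b1 [d1 [d10 ->]]]] := gen w.
  have -> : E' a b d - E' a1 b1 d1 = E' (a * d1 + - a1 * d) (b * d1 + - b1 * d) (d * d1).
    rewrite /E' -eval2D -!eval2Z rmorphM /= /eval2 !rmorphN /=.
    by field; rewrite !n0'.
  rewrite !oE ?mulf_neq0 // /E -eval2D -!eval2Z rmorphM /= /eval2 !rmorphN /=.
  by field; rewrite !n0.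
pose oA := GRing.isZmodMorphism.Build F' F o oB.
pose oMM := GRing.isMonoidMorphism.Build F' F o (o1, oM).
pose phi : {rmorphism F' -> F} := HB.pack o oA oMM.
by exists phi.
Qed.
End ModelIsomorphism.

Lemma model_isomorphism (k : finFieldType) (F F' : fieldType)
    (iota : {rmorphism k -> F}) (iota' : {rmorphism k -> F'}) x y x' y' f :
  odd_model iota x y f -> odd_model iota' x' y' f ->
  exists phi : {rmorphism F' -> F}, [/\ bijective phi,
    forall c, phi (iota' c) = iota c & phi x' = x].
Proof.
move=> model model'.
have [phi phiE] := model_morphism model model'.
have [psi psiE] := model_morphism model' model.
have phi2 a : phi (eval_at iota' x' a) = eval_at iota x a.
  by have := phiE a 0 1 (oner_neq0 _); rewrite !eval20 !rmorph1 !divr1.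
exists phi; split.
- exists psi => z.
    by have [a [b [d [d0 ->]]]] := model_fraction model' z; rewrite phiE // psiE.
  by have [a [b [d [d0 ->]]]] := model_fraction model z; rewrite psiE // phiE.
- by move=> c; have := phi2 c%:P; rewrite !eval_atC.
- by have := phi2 'X; rewrite !eval_atX.
Qed.

Section AffineEquivalence.
Variables (k : finFieldType) (n : nat).
Implicit Types (f : {poly k}).

(** This is the effect on equations of the change of coordinates (x, y) |-> (e^2 x + b, e^n y),
    where n is the common degree. *)
Definition affine_equiv f f' := exists e b : k,
  e != 0 /\ f' \Po (e ^+ 2 *: 'X + b%:P) = e ^+ (2 * n) *: f.
End AffineEquivalence.

Section AffineChange.
Variables (k : finFieldType) (F : fieldType) (iota : {rmorphism k -> F}).
Hypothesis k2 : 2%:R != 0 :> k.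
Implicit Types (P : place iota) (f : {poly k}).

Lemma affine_change_model x y f f' (alpha b gamma : k) :
  alpha != 0 -> gamma != 0 -> f' \Po (alpha *: 'X + b%:P) = gamma ^+ 2 *: f ->
  odd_model iota x y f ->
  odd_model iota (iota alpha * x + iota b) (iota gamma * y) f'.
Proof.
move=> a0 c0 Ef [tr E sep od gen].
set X := _ + _; pose l : {poly k} := alpha *: 'X + b%:P.
have EX p : eval_at iota X p = eval_at iota x (p \Po l).
  by rewrite eval_at_comp rmorphD /= eval_atZ eval_atX eval_atC.
pose l' : {poly k} := alpha^-1 *: ('X - b%:P).
have ll' : l \Po l' = 'X.
  by rewrite comp_polyD comp_polyZ comp_polyX comp_polyC scalerA mulfV // scale1r subrK.
have l'l : l' \Po l = 'X.
  rewrite comp_polyZ comp_polyB comp_polyX comp_polyC /l addrK scalerA mulVf //.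
  by rewrite scale1r.
have Ex p : eval_at iota x p = eval_at iota X (p \Po l').
  by rewrite EX -comp_polyA l'l comp_polyXr.
have Ef' : f' = gamma ^+ 2 *: (f \Po l').
  by rewrite -comp_polyZ -Ef -comp_polyA ll' comp_polyXr.
have c20 : gamma ^+ 2 != 0 by rewrite expf_neq0.
have dl' : l'^`() = (alpha^-1)%:P.
  by rewrite derivZ derivB derivX derivC subr0 -mul_polyC mulr1.
split.
- move=> [p p0 /eqP]; rewrite -/(eval_at iota X p) EX => rp.
  apply: tr; exists (p \Po l); last by apply/eqP.
  apply: contraNneq p0 => pl0; rewrite -[p]comp_polyXr -ll' comp_polyA pl0.
  by rewrite comp_poly0.
- by rewrite exprMn E EX Ef eval_atZ rmorphXn.
- rewrite unlock Ef' derivZ deriv_comp dl' mulrC mul_polyC.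
  rewrite coprimepZl // !coprimepZr ?invr_eq0 //.
  by apply: coprimep_comp_poly; move: sep; rewrite unlock.
- rewrite Ef' size_scale // size_comp_poly2 //.
  by rewrite size_scale ?invr_eq0 // size_XsubC.
- move=> z; have [a [c [d [d0 ->]]]] := gen z.
  exists (a \Po l'), (gamma^-1 *: (c \Po l')), (d \Po l'); split.
    apply: contraNneq d0 => dl0; rewrite -[d]comp_polyXr -l'l comp_polyA dl0.
    by rewrite comp_poly0.
  rewrite eval_atZ -!Ex mulrCA mulrA mulrA -rmorphM mulfV //.
  by rewrite rmorph1 mul1r.
Qed.

(** P is the only pole of both x and X, so X and Y lie in k[x] + k[x] y. Their pole orders 2 and 2g
    + 1 at P force X = alpha x + b and Y = R + c y with c a nonzero constant. In Y^2 = f'(X) the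
    coefficient 2 R c of y vanishes, so R = 0, and the rest reads c^2 f = f'(alpha x + b). *)
Lemma models_affine_equiv (P : place iota) x y X Y f f' g : (0 < g)%N ->
  odd_model iota x y f -> odd_model iota X Y f' ->
  ord P x < 0 -> ord P X < 0 ->
  f \is monic -> f' \is monic ->
  size f = (2 * g + 2)%N -> size f' = (2 * g + 2)%N ->
  affine_equiv (2 * g + 1) f f'.
Proof.
move=> g0 m m' oPx oPX mf mf' sf sf'.
have fin (Q : place iota) : in_local_ring Q x -> in_local_ring Q X.
  rewrite /in_local_ring => Qx; rewrite leNgt; apply/negP => QX.
  by move: Qx; rewrite -(inf_place_unique m' oPX QX) leNgt oPx.
have [A [B EX]] : coordinate_ring iota x y X.
  by apply: (finite_places_coordinate_ring m k2) => Q Qx _; apply: fin.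
have [R [C EY]] : coordinate_ring iota x y Y.
  apply: (finite_places_coordinate_ring m k2) => Q Qx _.
  by apply: (local_ring_y m'); apply: fin.
have X0 := model_x0 m'; have Y0 := model_y0 m'.
have [B0 sA] : B = 0 /\ size A = 2%N.
  have := ord_inf_x m' oPX; rewrite EX (ord_inf_ev2 m sf) -?EX //.
  case: eqP => [-> h|_ h]; last by exfalso; plia.
  by split=> //; plia.
have [C0 sC] : C != 0 /\ size C = 1%N.
  have := ord_inf_y m' sf' oPX; rewrite EY (ord_inf_ev2 m sf) -?EY //.
  have [-> h|C0 h] := eqVneq C 0; first by exfalso; plia.
  by split=> //; move: C0; rewrite -size_poly_gt0; plia.
rewrite B0 eval20 in EX.
have EXp p : eval_at iota X p = eval_at iota x (p \Po A).
  by rewrite eval_at_comp -EX.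
have /eqP/size_poly1P[c c0 EC] := sC.
have [ER EF] : C ^+ 2 * f = f' \Po A /\ R = 0.
  have := model_eq m'; rewrite EXp expr2 {1 2}EY (eval2M m) -(eval20 iota x y).
  move/(eval2_inj m) => [E1 E2].
  have R0 : R = 0.
    have /eqP : 2%:R *: (R * C) = 0 by rewrite scaler_nat mulr2n -[in RHS]E2; ring.
    by rewrite scaler_eq0 (negPf k2) mulf_eq0 (negPf C0) orbF => /eqP.
  by rewrite -E1 R0; split=> //; ring.
pose alpha := A`_1; pose b := A`_0.
have EA : A = alpha *: 'X + b%:P.
  apply/polyP => -[|[|j]]; rewrite coefD coefZ coefX coefC ?mulr0 ?add0r ?mulr1 ?addr0
    //=.
  by rewrite nth_default // sA.
have a0 : alpha != 0.
  have : lead_coef A != 0 by rewrite lead_coef_eq0 -size_poly_eq0 sA.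
  by rewrite lead_coefE sA.
have Ec : c ^+ 2 = alpha ^+ (2 * g + 1).
  have := congr1 lead_coef ER; rewrite lead_coef_comp ?sA // lead_coefM.
  rewrite (monicP mf) (monicP mf') mulr1 mul1r EC -polyC_exp lead_coefC => ->.
  by rewrite sf' addn2 addn1 lead_coefE sA.
(* Leading coefficients give c^2 = alpha^(2g+1), so alpha is the square of c / alpha^g. *)
pose e := c / alpha ^+ g.
have ag0 : alpha ^+ g != 0 by rewrite expf_neq0.
have Ee : e ^+ 2 = alpha.
  rewrite /e expr_div_n Ec -exprM exprD expr1 mulnC mulrAC mulfV ?mul1r //.
  by rewrite expf_neq0.
exists e, b; split; first by rewrite mulf_neq0 ?invr_eq0.
rewrite Ee -EA -ER EC -polyC_exp mul_polyC; congr (_ *: _).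
by rewrite exprM Ee Ec.
Qed.
End AffineChange.

Section PointedIsomorphism.
Variables (k : finFieldType) (g : nat).
Hypothesis k2 : 2%:R != 0 :> k.
Hypothesis g0 : (0 < g)%N.

(* (C, P) is isomorphic to y^2 = f(x) pointed at infinity. *)
Definition represents (C : pointed_hyperelliptic_curve k g) (f : {poly k}) :=
  exists x y, odd_model (constants C) x y f /\ ord (ptd_point C) x < 0.

Definition good_poly (f : {poly k}) :=
  [/\ f \is monic, separable_poly f & size f = (2 * g + 2)%N].

Lemma pointed_isomorphicP C C' f f' :
  represents C f -> represents C' f' -> good_poly f -> good_poly f' ->
  pointed_isomorphic C C' <-> affine_equiv (2 * g + 1) f f'.
Proof.
move=> [x [y [m ox]]] [x' [y' [m' ox']]] [mf sepf sf] [mf' sepf' sf']; split.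
- move=> [phi [bij cst oE]].
  have m2 := transport_model cst bij m'.
  by apply: (models_affine_equiv k2 g0 m m2 ox _ mf mf' sf sf'); rewrite oE.
- move=> [e [b [e0 E]]].
  have m2 : odd_model (constants C) (constants C (e ^+ 2) * x + constants C b)
      (constants C (e ^+ (2 * g + 1)) * y) f'.
    by apply: affine_change_model m; rewrite ?expf_neq0 // E -exprM mulnC.
  have [phi [bij cst px]] := model_isomorphism m2 m'.
  exists phi; split=> // z.
  have [Q QE] := pullback_place cst (ptd_point C) bij.
  rewrite -QE; apply: (inf_place_unique m') => //.
  rewrite QE px.
  have x0 := model_x0 m.
  have ie0 : constants C (e ^+ 2) != 0 by rewrite fmorph_eq0 expf_neq0.
  have oe : ord (ptd_point C) (constants C (e ^+ 2) * x) = ord (ptd_point C) x.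
    by rewrite ordM // ord_cst add0r.
  have [->|b0] := eqVneq b 0; first by rewrite rmorph0 addr0 oe.
  have ib0 : constants C b != 0 by rewrite fmorph_eq0.
  have xe0 := mulf_neq0 ie0 x0.
  by rewrite (ordD_lt xe0 ib0 _).2 oe // ord_cst.
Qed.
End PointedIsomorphism.

(** * Existence of models *)

Section SquarefreePart.
Variable k : finFieldType.
Implicit Types p u : {poly k}.

(** Only exponents divisible by the characteristic l occur, and the coefficients have l-th roots
    because Frobenius is bijective on a finite field. *)
Lemma deriv_eq0_pth_power p : p^`() = 0 -> exists2 l, (1 < l)%N & exists u, p = u ^+ l.
Proof.
move=> dp; have [l pr_l chl] := finPcharP k; exists l; first exact: prime_gt1.
have l0 := prime_gt0 pr_l.
have [r rK] : exists r : k -> k, forall c, r c ^+ l = c.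
  have inj : injective (fun c : k => c ^+ l).
    exact: (fmorph_inj (pFrobenius_aut chl)).
  by exists (invF inj) => c; exact: (f_invF inj).
have chp : l \in [pchar {poly k}] by rewrite pchar_poly.
exists (\poly_(i < size p) r p`_(i * l)).
transitivity (\sum_(i < size p) (p`_(i * l))%:P * 'X^(i * l)).
  apply/polyP => j; rewrite coef_sum.
  have [/dvdnP[i Ej]|nlj] := boolP (l %| j)%N; last first.
    rewrite big1 => [|i _].
      case: j nlj => [|j] nlj; first by rewrite dvdn0 in nlj.
      have := congr1 (fun q : {poly k} => q`_j) dp; rewrite coef_deriv coef0 => /eqP.
      rewrite -mulr_natr mulf_eq0 => /orP[/eqP //|].
      by rewrite -(dvdn_pcharf chl) (negPf nlj).
    rewrite coefCM coefXn; case: eqP => [E|]; last by rewrite mulr0.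
    by rewrite E dvdn_mull in nlj.
  have [ip|ip] := ltnP i (size p).
    rewrite (bigD1 (Ordinal ip)) //= big1 => [|i' ne].
      by rewrite addr0 coefCM coefXn Ej eqxx mulr1.
    rewrite coefCM coefXn Ej eqn_pmul2r // eq_sym.
    case: eqP => [E|]; last by rewrite mulr0.
    by case/eqP: ne; apply/val_inj.
  rewrite nth_default ?big1 //; last by rewrite Ej (leq_trans ip) // leq_pmulr.
  move=> i' _; rewrite coefCM coefXn Ej eqn_pmul2r // gtn_eqF ?mulr0 //.
  by rewrite (leq_trans (ltn_ord i')).
rewrite poly_def -(pFrobenius_autE chp) rmorph_sum; apply: eq_bigr => i _ /=.
by rewrite pFrobenius_autE -mul_polyC exprMn -polyC_exp rK exprM.
Qed.

Lemma not_separable_square p : p != 0 -> ~~ separable_poly p ->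
  exists2 u : {poly k}, (1 < size u)%N & u ^+ 2 %| p.
Proof.
move=> p0 nsep; apply: NNPP => nu; case/negP: nsep; apply/separable_polyP; split.
- move=> u v uvp; apply/coprimepP => d du dv; rewrite -size_poly_eq1.
  have d0 : d != 0.
    apply: contraNneq p0 => d0; move: uvp; move: du; rewrite d0 dvd0p => /eqP ->.
    by rewrite mul0r dvd0p.
  apply: contraT => d1; case: nu; exists d.
    by rewrite ltn_neqAle eq_sym d1 size_poly_gt0.
  by apply: dvdp_trans uvp; rewrite expr2 dvdp_mul.
- move=> u up su; apply/eqP => /deriv_eq0_pth_power[l l1 [v Ev]]; case: nu; exists v.
    have v0 : v != 0 by apply: contraTneq su => v0; rewrite Ev v0 expr0n;
      case: l l1 {Ev} => // *; rewrite size_poly0.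
    rewrite ltn_neqAle size_poly_gt0 v0 andbT eq_sym; apply: contraTneq su => sv.
    by rewrite -leqNgt Ev; have := size_poly_exp_leq v l; rewrite sv.
  by apply: dvdp_trans up; rewrite Ev dvdp_exp2l.
Qed.

Lemma squarefree_part p : p != 0 ->
  exists s h, [/\ p = s ^+ 2 * h, s != 0 & separable_poly h].
Proof.
have [n] := ubnP (size p); elim: n p => // n IH p lt_n p0.
have [sep|nsep] := boolP (separable_poly p).
  by exists 1, p; rewrite expr1n mul1r oner_neq0.
have [u su up] := not_separable_square p0 nsep.
have [q Eq] := dvdpP _ _ up.
have q0 : q != 0 by apply: contra_neq p0 => q0; rewrite Eq q0 mul0r.
have u0 : u != 0 by rewrite -size_poly_gt0 ltnW.
have lt_q : (size q < n)%N.
  move: lt_n; rewrite Eq size_polyM ?expf_neq0 // size_poly_sqr.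
  have H (a b : nat) : (1 < b)%N -> ((a + (b + b).-1).-1 < n.+1)%N -> (a < n)%N by lia.
  exact: H.
have [s [h [Es s0 seph]]] := IH q lt_q q0.
exists (s * u), h; split=> //; last by rewrite mulf_neq0.
by rewrite Eq Es; ring.
Qed.
End SquarefreePart.

(** * The genus is well defined *)

Section GenusUnique.
Variables (k : finFieldType) (F : fieldType) (iota : {rmorphism k -> F}).

(** The predicate [Q] is a parameter so that the rational case ([Q] always true) and the regular
    case ([Q] the local ring at a place) are treated at once. *)
Lemma differential_comb (Q : F -> Prop) m (c : 'I_m -> k) (b : 'I_m ->
  derivation iota -> F) :
  (forall e, Q (iota e)) -> (forall z w, Q z -> Q w -> Q (z * w)) ->
  (forall i, exists n (a f : 'I_n -> F), (forall j, Q (a j) /\ Q (f j)) /\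
     forall D, b i D = \sum_(j < n) a j * D (f j)) ->
  exists n (a f : 'I_n -> F), (forall j, Q (a j) /\ Q (f j)) /\
     forall D, \sum_(i < m) iota (c i) * b i D = \sum_(j < n) a j * D (f j).
Proof.
move=> Qc QM; elim: m => [|m IH] in c b *; move=> Hb.
  exists 0%N, (fun _ => 0), (fun _ => 0); split; first by case.
  by move=> D; rewrite !big_ord0.
have [n [a [f [Qaf E]]]] := IH (fun i => c (widen_ord (leqnSn m) i))
  (fun i => b (widen_ord (leqnSn m) i)) (fun i => Hb _).
have [n' [a' [f' [Qaf' E']]]] := Hb ord_max.
exists (n + n')%N,
  (fun j => match split j with inl i => a i | inr i => iota (c ord_max) * a' i end),
  (fun j => match split j with inl i => f i | inr i => f' i end); split.
  move=> j; case: (split j) => i //; have [Qa Qf] := Qaf' i.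
  by split=> //; apply: QM.
move=> D; rewrite big_ord_recr /= E E' big_split_ord /= mulr_sumr.
congr (_ + _); apply: eq_bigr => i _; last first.
  by rewrite -[rshift _ _]/(unsplit (inr i)) unsplitK mulrA.
by rewrite -[lshift _ _]/(unsplit (inl i)) unsplitK.
Qed.

Lemma regular_differential_comb m (c : 'I_m -> k) (b : 'I_m -> derivation iota -> F) :
  (forall i, regular_differential (b i)) ->
  regular_differential (fun D => \sum_(i < m) iota (c i) * b i D).
Proof.
move=> Rb; split.
  have [|||n [a [f [_ E]]]] := @differential_comb (fun _ => True) m c b => //.
    by move=> i; have [n [a [f E]]] := (Rb i).1; exists n, a, f.
  by exists n, a, f.
move=> P; apply: differential_comb; first exact: local_ring_cst.
  by move=> z w; apply: local_ringM.
by move=> i; apply: (Rb i).2.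
Qed.

(** Dimensions are compared by cardinality: rewriting coordinates from one basis to the other is an
    injection of k^m into k^n, and k is finite. *)
Lemma has_genus_le m n : has_genus iota m -> has_genus iota n -> (m <= n)%N.
Proof.
move=> [b [Rb Ub]] [b' [Rb' Ub']].
have reg (c : {ffun 'I_m -> k}) : exists c' : {ffun 'I_n -> k}, forall D,
    \sum_(i < m) iota (c i) * b i D = \sum_(i < n) iota (c' i) * b' i D.
  by have [c' [Ec' _]] := Ub' _ (regular_differential_comb c Rb); exists c'.
have [T HT] := fin_all_exists reg.
have injT : injective T.
  move=> c d E; have [e [_ He]] := Ub _ (regular_differential_comb c Rb).
  by have <- := He c (fun _ => erefl); apply: He => D; rewrite !HT E.
have := leq_card T injT; rewrite !card_ffun !card_ord leq_exp2l //.
exact: finNzRing_gt1.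
Qed.

Lemma has_genus_unique m n : has_genus iota m -> has_genus iota n -> m = n.
Proof.
by move=> Hm Hn; apply/eqP; rewrite eqn_leq !has_genus_le.
Qed.
End GenusUnique.

Section Ratfield.
Variables (k : finFieldType) (F : fieldType) (iota : {rmorphism k -> F}).
Variable x : F.
Implicit Types z w : F.
Local Notation ev := (eval_at iota x).
Local Notation K := (in_ratfield iota x).

Lemma ratfield_eval p : K (ev p).
Proof. by exists p, 1; rewrite rmorph1 hornerC oner_neq0 divr1. Qed.

Lemma ratfield_cst c : K (iota c).
Proof. by rewrite -(eval_atC iota x); apply: ratfield_eval. Qed.

Lemma ratfieldD z w : K z -> K w -> K (z + w).
Proof.
move=> [p [q [q0 ->]]] [r [s [s0 ->]]]; exists (p * s + r * q), (q * s).
rewrite -!/(eval_at _ _ _) in q0 s0 *; rewrite !(rmorphD, rmorphM) /=.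
by split; [rewrite mulf_neq0|field; rewrite q0 s0].
Qed.

Lemma ratfieldM z w : K z -> K w -> K (z * w).
Proof.
move=> [p [q [q0 ->]]] [r [s [s0 ->]]]; exists (p * r), (q * s).
rewrite -!/(eval_at _ _ _) in q0 s0 *; rewrite !(rmorphD, rmorphM) /=.
by split; [rewrite mulf_neq0|field; rewrite q0 s0].
Qed.

Lemma ratfieldN z : K z -> K (- z).
Proof.
by move=> Kz; rewrite -mulN1r -(rmorph1 iota) -rmorphN; apply: ratfieldM => //;
  apply: ratfield_cst.
Qed.

Lemma ratfieldB z w : K z -> K w -> K (z - w).
Proof. by move=> Kz Kw; apply: ratfieldD => //; apply: ratfieldN. Qed.

Lemma ratfieldV z : K z -> K z^-1.
Proof.
move=> [p [q [q0 ->]]]; have [p0|p0] := eqVneq (ev p) 0.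
  by rewrite -!/(eval_at _ _ _) p0 mul0r invr0 -(rmorph0 iota); apply: ratfield_cst.
by exists q, p; rewrite invf_div.
Qed.

Lemma ratfield_x : K x.
Proof. by rewrite -[x in K x](eval_atX iota x); apply: ratfield_eval. Qed.
End Ratfield.

Section RatfieldChange.
Variables (k : finFieldType) (F : fieldType) (iota : {rmorphism k -> F}).

Lemma ratfield_sub x x1 z :
  in_ratfield iota x1 x -> in_ratfield iota x z -> in_ratfield iota x1 z.
Proof.
move=> Kx [p [q [_ ->]]]; rewrite -!/(eval_at _ _ _).
have Kp r : in_ratfield iota x1 (eval_at iota x r).
  elim/poly_ind: r => [|r c IH]; first by rewrite rmorph0 -(rmorph0 iota);
    apply: ratfield_cst.
  rewrite rmorphD rmorphM /= eval_atX eval_atC; apply: ratfieldD;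
    last exact: ratfield_cst.
  exact: ratfieldM.
by apply: ratfieldM => //; apply: ratfieldV.
Qed.

(** If x is regular at P with residue c, then 1 / (x - c) has a pole at P and generates the same
    field k(x), so degree and ramification carry over. *)
Lemma move_to_infinity (P : place iota) x : rational_point P ->
  morphism_degree iota x 2 -> ramified x P ->
  exists x1, [/\ morphism_degree iota x1 2, ramified x1 P & ord P x1 < 0].
Proof.
move=> ratP [tr [b Hb]] [e [e0 ram_div ram_ex] e1].
have [ox|ox] := ltP (ord P x) 0.
  by exists x; split=> //; [split=> //; exists b|exists e].
have [c Mc] := ratP x ox; exists (x - iota c)^-1.
have xc0 : x - iota c != 0.
  rewrite subr_eq0; apply: contra_notN tr => /eqP ->; exact: algebraic_id.
have KE z : in_ratfield iota (x - iota c)^-1 z <-> in_ratfield iota x z.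
  split; apply: ratfield_sub.
    by apply/ratfieldV/ratfieldB; [exact: ratfield_x|exact: ratfield_cst].
  rewrite -[x in in_ratfield _ _ x](subrK (iota c)); apply: ratfieldD;
    last exact: ratfield_cst.
  by have := ratfieldV (ratfield_x iota (x - iota c)^-1); rewrite invrK.
split.
- split.
    move/algebraic_inv; rewrite invrK => al; apply: tr.
    by rewrite -[x](subrK (iota c)); apply: algebraic_add => //; apply: algebraic_id.
  exists b => z; have [d [[Kd Ez] Ud]] := Hb z; exists d; split.
    by split=> // i; apply/KE.
  by move=> d' [Kd' Ez']; apply: Ud; split=> // i; apply/KE.
- exists e => //; split=> //.
    by move=> z /KE; apply: ram_div.
  by have [z [/KE Kz oz]] := ram_ex; exists z.
- by rewrite ordV oppr_lt0; apply/maximal_idealP.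
Qed.
End RatfieldChange.

Section CompletingTheSquare.
Variables (k : finFieldType) (F : fieldType) (iota : {rmorphism k -> F}).
Hypothesis k2 : 2%:R != 0 :> k.
Variable x : F.
Hypothesis deg2 : morphism_degree iota x 2.
Local Notation ev := (eval_at iota x).
Local Notation K := (in_ratfield iota x).

Let F2 : 2%:R != 0 :> F. Proof. by rewrite -(rmorph_nat iota) fmorph_eq0. Qed.

Let K0 : K 0. Proof. by rewrite -(rmorph0 iota); apply: ratfield_cst. Qed.
Let K1 : K 1. Proof. by rewrite -(rmorph1 iota); apply: ratfield_cst. Qed.

(** In a basis of F over k(x), some basis vector has a nonzero coefficient in the expansion of 1;
    that vector is exchanged for 1, and the other is [w]. *)
Lemma quadratic_generator : exists w, ~ K w /\
  forall z, exists a b, [/\ K a, K b & z = a + b * w].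
Proof.
have [_ [b Hb]] := deg2.
suff [u [v [gen uniq]]] : exists u v,
    (forall z, exists c d, [/\ K c, K d, z = c * u + d * v & exists c1 d1,
       [/\ K c1, K d1, 1 = c1 * u + d1 * v & c1 != 0]]) /\
    (forall c d c' d', K c -> K d -> K c' -> K d' ->
       c * u + d * v = c' * u + d' * v -> c = c' /\ d = d').
  exists v; have [_ [_ [_ _ _ [c1 [d1 [Kc1 Kd1 E1 c10]]]]]] := gen 0; split.
    move=> Kv; have E : (v * c1) * u + (v * d1) * v = 0 * u + 1 * v.
      by rewrite mul0r mul1r add0r -!mulrA -mulrDr -E1 mulr1.
    have [/eqP] := uniq _ _ _ _ (ratfieldM Kv Kc1) (ratfieldM Kv Kd1) K0 K1 E.
    rewrite mulf_eq0 (negPf c10) orbF => /eqP -> /eqP.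
    by rewrite mul0r eq_sym oner_eq0.
  move=> z; have [c [d [Kc Kd -> _]]] := gen z.
  exists (c / c1), (d - c * d1 / c1); split.
  - by apply: ratfieldM => //; apply: ratfieldV.
  - by apply: ratfieldB => //; apply: ratfieldM; [apply: ratfieldM|apply: ratfieldV].
  - have -> : u = (1 - d1 * v) / c1 by rewrite E1 addrK; field.
    by field.
have gen z : exists c d, [/\ K c, K d & z = c * b 0 + d * b 1].
  have [c [[Kc Ez] _]] := Hb z; exists (c 0), (c 1); split=> //.
  rewrite Ez !big_ord_recl big_ord0 addr0; congr (_ + c _ * b _); exact/val_inj.
have uniq c d c' d' : K c -> K d -> K c' -> K d' ->
    c * b 0 + d * b 1 = c' * b 0 + d' * b 1 -> c = c' /\ d = d'.
  move=> Kc Kd Kc' Kd' E; have [e [_ Ue]] := Hb (c * b 0 + d * b 1).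
  have H s t : K s -> K t -> c * b 0 + d * b 1 = s * b 0 + t * b 1 ->
      e = [ffun i : 'I_2 => if i == 0 then s else t].
    move=> Ks Kt Est; apply: Ue; split; first by move=> i; rewrite ffunE; case: ifP.
    rewrite Est !big_ord_recl big_ord0 addr0 !ffunE /=; congr (_ + _ * b _).
    exact/val_inj.
  have E' : [ffun i : 'I_2 => if i == 0 then c else d] = [ffun i =>
    if i == 0 then c' else d'].
    by rewrite -(H c d) // -(H c' d').
  have := congr1 (fun h : {ffun 'I_2 -> F} => h 1) E'.
  by have := congr1 (fun h : {ffun 'I_2 -> F} => h 0) E'; rewrite !ffunE.
have [c1 [d1 [Kc1 Kd1 E1]]] := gen 1.
have [c10|c10] := eqVneq c1 0; last first.
  exists (b 0), (b 1); split=> // z; have [c [d [Kc Kd Ez]]] := gen z.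
  by exists c, d; split=> //; exists c1, d1.
have d10 : d1 != 0.
  apply: contra_eq_neq E1 => ->; rewrite c10 !mul0r addr0; exact: oner_neq0.
exists (b 1), (b 0); split.
  move=> z; have [c [d [Kc Kd Ez]]] := gen z.
  by exists d, c; split=> //; rewrite 1?addrC //; exists d1, c1; split=> //;
    rewrite addrC.
move=> c d c' d' Kc Kd Kc' Kd'; rewrite [LHS]addrC [RHS]addrC => E.
by have [-> ->] := uniq _ _ _ _ Kd Kc Kd' Kc' E.
Qed.

(** Completing the square gives y0 with y0^2 = p / q in k(x). Then (q y0)^2 = p q = r^2 h with h
    separable, and y = q y0 / r has square h. *)
Lemma square_generator : exists y h, [/\ ~ K y, y ^+ 2 = ev h, separable_poly h &
  forall z, exists a b, [/\ K a, K b & z = a + b * y]].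
Proof.
have [tr _] := deg2; have [w [nKw gen]] := quadratic_generator.
have ev0 p : (ev p == 0) = (p == 0) by exact: eval_at_eq0.
have [s [t [Ks Kt Ew]]] := gen (w ^+ 2).
have Kh : K 2%:R^-1 by apply: ratfieldV; rewrite -(rmorph_nat iota); apply: ratfield_cst.
pose y0 := w - t / 2%:R.
have Ky0 : K (y0 ^+ 2).
  have -> : y0 ^+ 2 = s + (t / 2%:R) * (t / 2%:R).
    by rewrite /y0 sqrrB Ew; field.
  by apply: ratfieldD => //; apply: ratfieldM; apply: ratfieldM.
have nKy0 : ~ K y0.
  move=> Ky; apply: nKw; rewrite -[w](subrK (t / 2%:R)).
  by apply: ratfieldD => //; apply: ratfieldM.
have [p [q [q0 E0]]] := Ky0; rewrite -!/(eval_at _ _ _) in q0 E0.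
have p0 : p != 0.
  apply: contra_notN nKy0 => /eqP p0; move/eqP: E0.
  by rewrite p0 rmorph0 mul0r sqrf_eq0 => /eqP ->.
have q0' : q != 0 by rewrite -ev0.
have [r [h [Eh r0 sep]]] := squarefree_part (mulf_neq0 p0 q0').
have er0 : ev r != 0 by rewrite ev0.
pose y := y0 * ev q / ev r.
have Ky1 : y0 = y * (ev r / ev q) by rewrite /y; field; rewrite er0 q0.
have Krq : K (ev r / ev q).
  by apply: ratfieldM; [|apply: ratfieldV]; apply: ratfield_eval.
exists y, h; split=> //.
- by move=> Ky; apply: nKy0; rewrite Ky1; apply: ratfieldM.
- rewrite /y expr_div_n exprMn E0; apply: (mulIf (expf_neq0 2 er0)).
  rewrite divfK ?expf_neq0 //; have := congr1 ev Eh; rewrite !rmorphM /= => E.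
  by transitivity (ev p * ev q); [field|rewrite E; ring].
- move=> z; have [a [b [Ka Kb ->]]] := gen z.
  exists (a + b * (t / 2%:R)), (b * (ev r / ev q)); split.
  + by apply: ratfieldD => //; apply: ratfieldM => //; apply: ratfieldM.
  + exact: ratfieldM.
  + by rewrite -mulrA [_ * y]mulrC -Ky1 /y0; ring.
Qed.

(* If deg h were even then v = y / x^(deg h / 2) would be a unit at P, and one  *)
(* of c + v and c - v is a unit at P for each c in k(x) regular at P; their      *)
(* product being in k(x), all orders at P would be divisible by e.              *)
Lemma odd_degree (P : place iota) y h : ord P x < 0 -> ramified x P ->
  ~ K y -> y ^+ 2 = ev h -> separable_poly h ->
  (forall z, exists a b, [/\ K a, K b & z = a + b * y]) -> ~~ odd (size h).
Proof.
move=> ox [e [_ ram _] e1] nKy Ey sep gen; apply/negP => od.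
have [tr _] := deg2.
have ev0 p : (ev p == 0) = (p == 0) by exact: eval_at_eq0.
have h0 := separable_poly_neq0 sep.
have x0 : x != 0 by apply: contraTneq ox => ->; rewrite ord0.
pose m := (size h).-1./2.
pose v := y / x ^+ m.
have xm0 : x ^+ m != 0 by rewrite expf_neq0.
have Kxm : K (x ^+ m) by rewrite -[x in x ^+ _](eval_atX iota x) -rmorphXn;
  apply: ratfield_eval.
have nKv : ~ K v by move=> Kv; apply: nKy; rewrite -[y](divfK xm0); apply: ratfieldM.
have Ev : v ^+ 2 = ev h / (x ^+ m) ^+ 2 by rewrite expr_div_n Ey.
have ov : ord P v = 0.
  have : ord P (v ^+ 2) = 0.
    rewrite Ev ord_div ?expf_neq0 ?ev0 // ord_eval // !ordX /m.
    have -> : (size h).-1 = ((size h).-1./2 * 2)%N by move: od; lia.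
    by rewrite muln2 doubleK -mulrnA muln2 -[X in _ - X]mulr_natr natz subrr.
  by rewrite ordX; lia.
have Kv2 : K (v ^+ 2).
  rewrite Ev expr2; apply: ratfieldM; first exact: ratfield_eval.
  by apply/ratfieldV/ratfieldM.
have v0 : v != 0 by apply: contra_notN nKv => /eqP ->.
have [t ot] := ord_uniformizer P.
have t0 : t != 0 by apply: contra_eq_neq ot => ->; rewrite ord0.
have [a [b [Ka Kb Et]]] := gen t.
pose b' := b * x ^+ m.
have Kb' : K b' by apply: ratfieldM.
have {}Et : t = a + b' * v by rewrite Et /b' /v; field.
have e_ndvd1 (n : nat) (i : int) : (1 < n)%N -> 1 = n%:Z * i -> False.
  move=> n1 E; have i0 : 0 < i by nia.
  by nia.
suff [m3 om3] : exists m3, ord P t = e%:Z * m3.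
  by apply: (e_ndvd1 e m3) => //; rewrite -om3.
have [b0|b0] := eqVneq b' 0.
  by apply: ram => //; rewrite Et b0 mul0r addr0.
pose c := a / b'; have Kc : K c by apply: ratfieldM => //; apply: ratfieldV.
have nz z : K z -> z + v != 0 /\ z - v != 0.
  move=> Kz; split; apply: contra_notN nKv.
    by rewrite addr_eq0 => /eqP Ez; rewrite -[v]opprK -Ez; apply: ratfieldN.
  by rewrite subr_eq0 => /eqP <-.
have [z0 z1] := nz c Kc.
have [m1 om1] := ram _ Kb' b0.
suff [m3 om3] : exists m3, ord P (c + v) = e%:Z * m3.
  exists (m1 + m3); have -> : t = b' * (c + v) by rewrite Et /c; field.
  by rewrite ordM // om1 om3 mulrDr.
have [oc|oc] := ltP (ord P c) 0.
  have c0 : c != 0 by apply: contraTneq oc => ->; rewrite ord0.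
  have [m3 om3] := ram _ Kc c0; exists m3; rewrite -om3.
  by apply: (ordD_lt c0 v0 _).2; rewrite ov.
have Oz : in_local_ring P (c + v) by apply: local_ringD => //; rewrite /in_local_ring ov.
have [oz|oz] := leP (ord P (c + v)) 0.
  by exists 0; rewrite mulr0; apply/eqP; rewrite eq_le oz.
have o1 : ord P (c - v) = 0.
  have v20 : - (2%:R * v) != 0 by rewrite oppr_eq0 mulf_neq0.
  have o2 : ord P (- (2%:R * v)) = 0.
    by rewrite ordN ordM // ov addr0 -(rmorph_nat iota) ord_cst.
  have -> : c - v = - (2%:R * v) + (c + v) by ring.
  by rewrite (ordD_lt v20 z0 _).2 o2.
have Kn : K ((c + v) * (c - v)).
  have -> : (c + v) * (c - v) = c * c - v ^+ 2 by ring.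
  by apply: ratfieldB => //; apply: ratfieldM.
have [m2 om2] := ram _ Kn (mulf_neq0 z0 z1).
by exists m2; rewrite -om2 ordM // o1 addr0.
Qed.
End CompletingTheSquare.

Lemma fraction_quotient (R : idomainType) (z : {fraction R}) :
  exists p q : R, q != 0 /\ z = FracField.tofrac p / FracField.tofrac q.
Proof.
elim/quotW: z => r; exists \n_r, \d_r; have d0 := denom_ratioP r; split=> //.
have E : (\pi_({fraction R}) r)%qT * FracField.tofrac \d_r = FracField.tofrac \n_r.
  rewrite !piE; apply/eqmodP; rewrite /= /FracField.mulf FracField.equivfE.
  by rewrite !numden_Ratio ?mulf_neq0 ?oner_neq0 // !mulr1 mulrC.
by rewrite -E mulfK // tofrac_eq0.
Qed.

Lemma eval_at_rmorph (k : finFieldType) (F : fieldType)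
  (xi : {rmorphism {poly k} -> F}) p : eval_at (xi \o polyC) (xi 'X) p = xi p.
Proof.
elim/poly_ind: p => [|p c IH]; first by rewrite !rmorph0.
by rewrite !(rmorphD, rmorphM) /= IH eval_atX eval_atC.
Qed.

Section Existence.
Variable k : finFieldType.
Hypothesis k2 : 2%:R != 0 :> k.

(** Adjoin a square root of f to the fraction field of k[x]. The quadratic has no root there, since
    a^2 = f b^2 contradicts the parity of degrees. *)
Lemma odd_model_exists (f : {poly k}) : separable_poly f -> ~~ odd (size f) ->
  exists (F : fieldType) (iota : {rmorphism k -> F}) x y, odd_model iota x y f.
Proof.
move=> sep od; have f0 := separable_poly_neq0 sep.
pose K := {fraction {poly k}}.
pose q : {poly K} := 'X^2 - (FracField.tofrac f)%:P.
have sq : size q = 3%N by rewrite size_XnsubC.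
have Iq : irreducible_poly q.
  apply: cubic_irreducible; first by rewrite sq.
  move=> z; apply/negP; rewrite /root !hornerE subr_eq0 => /eqP Ez.
  have [a [b [b0 Eab]]] := fraction_quotient z.
  have /eqP : FracField.tofrac (a ^+ 2) = FracField.tofrac (f * b ^+ 2).
    by rewrite [RHS]rmorphM /= -Ez Eab !rmorphXn /= expr_div_n divfK // expf_neq0 //
      tofrac_eq0.
  rewrite tofrac_eq => /eqP /(congr1 (fun p : {poly k} => size p)).
  have a0 : a != 0.
    apply/eqP => a0; move/eqP: Ez; rewrite Eab a0 rmorph0 mul0r expr0n eq_sym.
    by rewrite tofrac_eq0 (negPf f0).
  rewrite size_polyM ?expf_neq0 // !size_poly_sqr.
  by move: a0 b0 od; rewrite -!size_poly_gt0; plia.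
have [L dimL [y qy genL]] := irredp_FAdjoin Iq.
have [psi Ey gen] : exists2 psi : {rmorphism K -> L}, y ^+ 2 = psi (FracField.tofrac f) &
    forall z, exists p, z = (map_poly psi p).[y].
  exists (in_alg L).
    move: qy; rewrite /root rmorphB /= map_polyXn map_polyC /= !hornerE subr_eq0.
    by move/eqP.
  by move=> z; apply/Fadjoin1_polyP; rewrite genL memvf.
pose xi : {rmorphism {poly k} -> L} := psi \o @FracField.tofrac _.
pose iota : {rmorphism k -> L} := xi \o polyC.
have xiE p : eval_at iota (xi 'X) p = xi p by exact: eval_at_rmorph.
have xi0 p : (xi p == 0) = (p == 0) by rewrite /xi /= fmorph_eq0 tofrac_eq0.
exists L, iota, (xi 'X), y; split=> //.
- move=> [p p0]; rewrite /root -/(eval_at iota (xi 'X) p) xiE xi0.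
  by rewrite (negPf p0).
- by rewrite xiE.
- move=> z; have [p ->] := gen z.
  suff [u [v ->]] : exists u v, (map_poly psi p).[y] = psi u + psi v * y.
    have [a [b [b0 ->]]] := fraction_quotient u.
    have [c [d [d0 ->]]] := fraction_quotient v.
    exists (a * d), (c * b), (b * d); split; first by rewrite mulf_neq0.
    rewrite !xiE !rmorphM !fmorphV -!/(xi _).
    have xb0 : xi b != 0 by rewrite xi0.
    have xd0 : xi d != 0 by rewrite xi0.
    by rewrite /xi /= in xb0 xd0 *; field; rewrite xb0 xd0.
  elim/poly_ind: p => [|p c [u [v E]]].
    by exists 0, 0; rewrite !rmorph0 horner0 mul0r addr0.
  exists (c + v * FracField.tofrac f), u.
  rewrite rmorphD rmorphM /= map_polyX map_polyC /= !hornerE E.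
  by rewrite rmorphD rmorphM /= -Ey; ring.
Qed.

Variable g : nat.

Lemma represented_exists (f : {poly k}) : good_poly g f ->
  exists C : pointed_hyperelliptic_curve k g, represents C f.
Proof.
move=> [mf sepf sf]; have od : ~~ odd (size f) by rewrite sf; lia.
have [F [iota [x [y m]]]] := odd_model_exists sepf od.
have [P oP] := inf_place_exists m.
have [D1 D1E] := model_derivation m k2.
have deg2 := model_degree2 m.
have ratP := inf_rational m oP.
pose C := Curve (ex_intro _ x (ex_intro _ 2%N deg2)) (rational_point_geom_irr ratP).
have genC : genus C g by exact: (model_genus m sf k2 D1E oP).
pose H := HyperellipticCurve genC (ex_intro _ x deg2).
have wP : @weierstrass_point k g H P by exists x => //; exact: (inf_ramified m oP).
by exists (@PointedHyperellipticCurve k g H P ratP wP), x, y.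
Qed.

(** After P is moved to infinity and the square completed, ramification makes the degree odd, a
    rescaling makes the polynomial monic, and uniqueness of the genus identifies its degree as 2g +
    1. *)
Lemma every_represented (C : pointed_hyperelliptic_curve k g) :
  exists2 f, good_poly g f & represents C f.
Proof.
have [x0 deg0 ram0] := ptd_weierstrass C.
have [x [deg2 ram ox]] := move_to_infinity (@ptd_rational k g C) deg0 ram0.
have [y [h [nKy Ey seph gen]]] := square_generator k2 deg2.
have odh := odd_degree k2 deg2 ox ram nKy Ey seph gen.
have ev0 p : (eval_at (constants C) x p == 0) = (p == 0) by apply/eval_at_eq0; case: deg2.
have m0 : odd_model (constants C) x y h.
  split=> //; first by case: deg2.
  move=> z; have [_ [_ [[p [q [q0 ->]]] [r [s [s0 ->]]] ->]]] := gen z.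
  rewrite -!/(eval_at _ _ _) in q0 s0 *.
  exists (p * s), (r * q), (q * s); split; first by rewrite -ev0 rmorphM mulf_neq0.
  by rewrite !rmorphM /=; field; rewrite q0 s0.
have h0 := separable_poly_neq0 seph.
pose n := (size h).-2./2.
have sh : size h = (2 * n + 2)%N by move: h0 odh; rewrite -size_poly_gt0 /n; plia.
pose l := lead_coef h; have l0 : l != 0 by rewrite lead_coef_eq0.
(* The change (x, y) |-> (l x, l^n y) turns h, of degree 2n + 1 and leading coefficient l, into a
   monic polynomial: l^(2n) l l^-(2n+1) = 1. *)
pose f := (l ^+ n) ^+ 2 *: (h \Po (l^-1 *: 'X)).
have sl : size (l^-1 *: 'X : {poly k}) = 2%N
  by rewrite size_scale ?invr_eq0 // size_polyX.
have Ef : f \Po (l *: 'X + 0%:P) = (l ^+ n) ^+ 2 *: h.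
  rewrite comp_polyZ -comp_polyA comp_polyZ comp_polyX addr0 scalerA mulVf //.
  by rewrite scale1r comp_polyXr.
have m1 := affine_change_model l0 (expf_neq0 n l0) Ef m0.
have sf : size f = (2 * n + 2)%N by rewrite size_scale ?expf_neq0 // size_comp_poly2.
have mf : f \is monic.
  rewrite monicE lead_coefZ lead_coef_comp ?sl // sh lead_coefZ lead_coefX mulr1 -/l.
  by rewrite addn2 /= mulrA -exprM -exprSr [(n * 2)%N]mulnC exprVn mulfV ?expf_neq0.
rewrite rmorph0 addr0 in m1.
have ox1 : ord (ptd_point C) (constants C l * x) < 0.
  by rewrite ordM ?fmorph_eq0 ?(model_x0 m0) // ord_cst add0r.
have [D1 D1E] := model_derivation m1 k2.
have ng : n = g.
  exact: has_genus_unique (model_genus m1 sf k2 D1E ox1) (hyp_genus C).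
exists f; last by exists (constants C l * x), (constants C (l ^+ n) * y).
by split=> //; [exact: model_sep m1|rewrite sf ng].
Qed.
End Existence.

(** * Counting separable polynomials *)

Section MonicPolynomials.
Variable k : finFieldType.
Implicit Types f s h u : {poly k}.

(** After division by the gcd of s and s', the square of the remaining factor of s divides h', so
    this factor is constant. *)
Lemma monic_square_dvd s s' h' : separable_poly h' -> s != 0 ->
  s ^+ 2 %| s' ^+ 2 * h' -> s %| s'.
Proof.
move=> sep s0; pose d := gcdp s s' => dv.
have d0 : d != 0 by rewrite gcdp_eq0 negb_and s0.
have [s1 Es] := dvdpP _ _ (dvdp_gcdl s s').
have [s1' Es'] := dvdpP _ _ (dvdp_gcdr s s').
rewrite -/d in Es Es'.
have s10 : s1 != 0 by apply: contra_neq s0 => E; rewrite Es E mul0r.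
have cop : coprimep s1 s1'.
  have := coprimep_div_gcd (p := s) (q := s'); rewrite s0 /= => /(_ isT).
  by rewrite -/d {1}Es {1}Es' !mulpK.
have : s1 ^+ 2 %| h'.
  rewrite -(@Gauss_dvdpr _ _ (s1' ^+ 2)); last by rewrite coprimep_expl // coprimep_expr.
  rewrite -(dvdp_mul2r _ _ (expf_neq0 2 d0)) -exprMn -Es mulrAC -exprMn -Es'.
  exact: dv.
have [/eqP|s11] := eqVneq (size s1) 1%N.
  by move/size_poly1P => [c c0 E] _; rewrite Es E mul_polyC dvdpZl // dvdp_gcdr.
by rewrite (separable_nosquare sep).
Qed.

Lemma squarefree_part_unique s h s' h' : s \is monic -> s' \is monic ->
  separable_poly h -> separable_poly h' ->
  s ^+ 2 * h = s' ^+ 2 * h' -> s = s' /\ h = h'.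
Proof.
move=> ms ms' sep sep' E; have s0 := monic_neq0 ms; have s'0 := monic_neq0 ms'.
have Es : s = s'.
  apply/eqP; rewrite -eqp_monic // /eqp (monic_square_dvd sep') //=.
    by rewrite (monic_square_dvd sep) // E dvdp_mulr.
  by rewrite -E dvdp_mulr.
by split=> //; apply: (mulfI (expf_neq0 2 s0)); rewrite E Es.
Qed.

Lemma monic_squarefree_part f : f \is monic -> exists sh : {poly k} * {poly k},
  [&& f == sh.1 ^+ 2 * sh.2, sh.1 \is monic, sh.2 \is monic & separable_poly sh.2].
Proof.
move=> mf; have [s [h [E s0 sep]]] := squarefree_part (monic_neq0 mf).
pose c := lead_coef s; have c0 : c != 0 by rewrite lead_coef_eq0.
have ms : c^-1 *: s \is monic by rewrite monicE lead_coefZ mulVf.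
have E' : f = (c^-1 *: s) ^+ 2 * (c ^+ 2 *: h).
  by rewrite exprZn -scalerAl -scalerAr scalerA -exprMn mulVf // expr1n scale1r.
exists (c^-1 *: s, c ^+ 2 *: h); rewrite /= -E' eqxx ms /=; apply/andP; split.
  by rewrite -(monicMl _ (rpredX 2 ms)) -E'.
by rewrite unlock derivZ coprimepZl ?coprimepZr ?expf_neq0 //; move: sep; rewrite unlock.
Qed.

Lemma size_sqrM s h : s != 0 -> h != 0 ->
  size (s ^+ 2 * h) = ((size s + size s).-1 + size h).-1.
Proof. by move=> s0 h0; rewrite size_polyM ?expf_neq0 // size_poly_sqr. Qed.

(** Monic polynomials of degree n are encoded by their n lower coefficients, which form a finite
    type on which a group can act. *)
Definition monic_of n (c : {ffun 'I_n ->
  k}) : {poly k} := 'X^n + \sum_(i < n) c i *: 'X^i.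
Definition lower_coefs n f : {ffun 'I_n -> k} := [ffun i : 'I_n => f`_i].

Lemma coef_lower n (c : {ffun 'I_n ->
  k}) (i : 'I_n) : (\sum_(j < n) c j *: 'X^j)`_i = c i.
Proof.
rewrite coef_sum (bigD1 i) //= big1 => [|j ij].
  by rewrite addr0 coefZ coefXn eqxx mulr1.
rewrite coefZ coefXn; case: eqP => [E|]; last by rewrite mulr0.
by case/eqP: ij; apply/val_inj.
Qed.

Lemma size_lower n (c : {ffun 'I_n -> k}) : (size (\sum_(j < n) c j *: 'X^j)%R <= n)%N.
Proof.
apply: (leq_trans (size_sum _ _ _)); apply/bigmax_leqP => i _.
by rewrite (leq_trans (size_scale_leq _ _)) // size_polyXn.
Qed.

Lemma size_monic_of n (c : {ffun 'I_n -> k}) : size (monic_of c) = n.+1.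
Proof. by rewrite size_polyDl size_polyXn // ltnS size_lower. Qed.

Lemma monic_of_monic n (c : {ffun 'I_n -> k}) : monic_of c \is monic.
Proof.
by rewrite monicE lead_coefDl ?lead_coefXn // size_polyXn ltnS size_lower.
Qed.

Lemma monic_ofK n : cancel (@monic_of n) (lower_coefs n).
Proof.
move=> c; apply/ffunP => i; rewrite ffunE coefD coefXn coef_lower.
by rewrite ltn_eqF // add0r.
Qed.

Lemma lower_coefsK n f : f \is monic -> size f = n.+1 -> monic_of (lower_coefs n f) = f.
Proof.
move=> mf sf; apply/polyP => j; have [jn|jn] := ltnP j n.
  rewrite coefD coefXn ltn_eqF // add0r -[j]/(nat_of_ord (Ordinal jn)) coef_lower.
  by rewrite ffunE.
have [<-|ne] := eqVneq n j.
  have := monicP (monic_of_monic (lower_coefs n f));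
    rewrite lead_coefE size_monic_of /= => ->.
  by have := monicP mf; rewrite lead_coefE sf.
by rewrite !nth_default ?sf ?size_monic_of // ltn_neqAle ne.
Qed.

Definition separable_set n := [set c : {ffun 'I_n -> k} | separable_poly (monic_of c)].

(* With [s] and [h] the squarefree decomposition [f = s ^+ 2 * h] of a monic     *)
(* polynomial of degree [n], the map [(f, c) |-> (s * 'X + c) ^+ 2 * h] is a      *)
(* bijection onto the monic polynomials of degree [n + 2] which are not squarefree. *)
Lemma card_nonseparable n : #|~: separable_set n.+2| = (#|k| ^ n.+1)%N.
Proof.
pose dec (c : {ffun 'I_n -> k}) := xchoose (monic_squarefree_part (monic_of_monic c)).
have decP c : [/\ monic_of c = (dec c).1 ^+ 2 * (dec c).2, (dec c).1 \is monic,
    (dec c).2 \is monic & separable_poly (dec c).2].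
  by have /and4P[/eqP] := xchooseP (monic_squarefree_part (monic_of_monic c)).
pose phi (z : {ffun 'I_n -> k} * k) : {ffun 'I_n.+2 -> k} :=
  lower_coefs n.+2 (((dec z.1).1 * 'X + z.2%:P) ^+ 2 * (dec z.1).2).
have mX s b : s \is monic -> s * 'X + b%:P \is monic /\ size (s * 'X + b%:P) = (size
  s).+1.
  move=> ms; have s0 : s != 0 by apply: monic_neq0.
  have lt : (size (b%:P : {poly k}) < size (s * 'X)%R)%N.
    by rewrite size_mulX // ltnS (leq_trans (size_polyC_leq1 _)) // size_poly_gt0.
  split; last by rewrite size_polyDl // size_mulX.
  by rewrite monicE lead_coefDl // lead_coefM lead_coefX mulr1; apply: ms.
have phiE z : monic_of (phi z) = ((dec z.1).1 * 'X + z.2%:P) ^+ 2 * (dec z.1).2.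
  have [E ms mh sep] := decP z.1; have [ml sl] := mX _ z.2 ms.
  apply: lower_coefsK; first by rewrite rpredM // rpredX.
  have := size_monic_of z.1; rewrite E.
  rewrite !size_sqrM ?monic_neq0 // sl.
  have := monic_neq0 ms; have := monic_neq0 mh; rewrite -!size_poly_gt0; plia.
have inj : injective phi.
  move=> z w Ezw; have := phiE w; rewrite -Ezw phiE.
  have [Ez msz mhz sepz] := decP z.1; have [Ew msw mhw sepw] := decP w.1.
  have [mz _] := mX _ z.2 msz; have [mw _] := mX _ w.2 msw.
  case/squarefree_part_unique => // El Eh.
  have E2 : z.2 = w.2.
    by have := congr1 (fun p : {poly k} => p`_0) El; rewrite !coefD !coefMX !coefC !add0r.
  have E1 : (dec z.1).1 = (dec w.1).1.
    by move: El; rewrite E2 => /addIr /(mulIf (negbT (polyX_eq0 _))).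
  case: z w E2 E1 Eh Ez Ew {Ezw El msz mhz sepz msw mhw sepw mz mw} =>
    [c a] [d b] /= -> E1 Eh Ez Ew.
  by congr (_, _); apply: (can_inj (@monic_ofK n)); rewrite Ez Ew E1 Eh.
have -> : ~: separable_set n.+2 = phi @: [set: {ffun 'I_n -> k} * k].
  apply/setP => c; rewrite !inE; apply/idP/imsetP => [nsep|[z _ ->]]; last first.
    rewrite phiE; have [E ms mh sep] := decP z.1; have [ml sl] := mX _ z.2 ms.
    apply/negP => sepf; have := separable_nosquare sepf (isT : 1 < 2)%N.
    move=> /(_ ((dec z.1).1 * 'X + z.2%:P)); rewrite dvdp_mulr // => H.
    by case/negP: (monic_neq0 ms); rewrite -size_poly_eq0 -eqSS -sl; apply: contraT => /H.
  have [[s h] /= /and4P[/eqP E ms mh sep]] := monic_squarefree_part (monic_of_monic c).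
  have s1 : (1 < size s)%N.
    have := monic_neq0 ms; rewrite -size_poly_gt0 => s0.
    rewrite ltn_neqAle s0 andbT; apply: contra nsep => /eqP/esym/eqP/size_poly1P[b b0 Es].
    have b1 : b = 1 by have := monicP ms; rewrite Es lead_coefC.
    by rewrite E Es b1 expr1n mul1r.
  have [s' [b Es]] : exists s', exists b, s = s' * 'X + b%:P.
    exists (\poly_(i < size s) s`_i.+1), s`_0; apply/polyP => i.
    rewrite coefD coefMX coefC; case: i => [|i] /=; first by rewrite add0r.
    rewrite addr0 coef_poly; case: ltnP => // le.
    by rewrite nth_default // (leq_trans le).
  have s'0 : s' != 0.
    apply: contraTneq s1 => s'0; rewrite Es s'0 mul0r add0r -leqNgt.
    exact: size_polyC_leq1.
  have lt : (size (b%:P : {poly k}) < size (s' * 'X)%R)%N.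
    by rewrite size_mulX // ltnS (leq_trans (size_polyC_leq1 _)) // size_poly_gt0.
  have ms' : s' \is monic.
    by move: ms; rewrite !monicE Es lead_coefDl // lead_coefM lead_coefX mulr1.
  have ss : size s = (size s').+1 by rewrite Es size_polyDl // size_mulX.
  have sf : size (s' ^+ 2 * h) = n.+1.
    have := size_monic_of c; rewrite E !size_sqrM ?monic_neq0 // ss.
    have := monic_neq0 ms'; have := monic_neq0 mh; rewrite -!size_poly_gt0; plia.
  have mf : s' ^+ 2 * h \is monic by rewrite rpredM // rpredX.
  pose c' := lower_coefs n (s' ^+ 2 * h).
  have Ec' : monic_of c' = s' ^+ 2 * h by apply: lower_coefsK.
  exists (c', b); first by rewrite inE.
  rewrite -[LHS]monic_ofK -[RHS]monic_ofK phiE /=.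
  congr (lower_coefs _ _).
  have [Ed msd mhd sepd] := decP c'; rewrite Ec' in Ed.
  by have [<- <-] := squarefree_part_unique ms' msd sep sepd Ed; rewrite -Es -E.
by rewrite card_imset // cardsT card_prod card_ffun card_ord expnSr.
Qed.

Lemma card_separable_set n : (#|separable_set n.+2| + #|k| ^ n.+1 = #|k| ^ n.+2)%N.
Proof.
by rewrite -card_nonseparable cardsC card_ffun card_ord.
Qed.
End MonicPolynomials.

(** * Counting orbits *)

Section AffineGroup.
Variable k : finFieldType.

(* [(e, b)] stands for the substitution x -> e^2 x + b. *)
Definition affine : Type := ({unit k} * k)%type.
HB.instance Definition _ := Finite.copy affine ({unit k} * k)%type.

(** The product is composition with [a'] applied first, so that substitution is a right action. *)
Definition affine_mul (a a' : affine) : affine :=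
  ((a.1 * a'.1)%g, val a.1 ^+ 2 * a'.2 + a.2).
Definition affine_one : affine := (1%g, 0).
Definition affine_inv (a : affine) : affine :=
  ((a.1)^-1%g, - (val a.1 ^- 2 * a.2)).

Lemma affine_mulA : associative affine_mul.
Proof.
move=> a b c; rewrite /affine_mul /=; congr (_, _); first exact: mulgA.
by rewrite exprMn; ring.
Qed.

Lemma affine_mul1 : left_id affine_one affine_mul.
Proof.
by case=> a b; rewrite /affine_mul /= mul1g expr1n mul1r addr0.
Qed.

Lemma affine_mulV : left_inverse affine_one affine_inv affine_mul.
Proof.
case=> a b; rewrite /affine_mul /affine_inv /= mulVg; congr (_, _).
by rewrite exprVn addrN.
Qed.

HB.instance Definition _ := Finite_isGroup.Build affine affine_mulA affine_mul1
  affine_mulV.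

Lemma card_affine : #|[set: affine]| = ((#|k|.-1) * #|k|)%N.
Proof.
rewrite cardsT card_prod; congr (_ * _)%N.
by rewrite -card_finField_unit cardsT.
Qed.
End AffineGroup.

(** * Polynomials fixed by an affine substitution *)

Section FixedPolynomials.
Variable k : finFieldType.
Implicit Types (a b : k) (d f : {poly k}).

Definition affine_poly a b : {poly k} := a *: 'X + b%:P.

Lemma size_affine_poly a b : a != 0 -> size (affine_poly a b) = 2%N.
Proof.
move=> a0; have sX : size (a *: 'X : {poly k}) = 2%N by rewrite size_scale // size_polyX.
by rewrite size_polyDl sX // ltnS size_polyC_leq1.
Qed.

Lemma deriv_affine_poly a b : (affine_poly a b)^`() = a%:P.
Proof. by rewrite derivD derivZ derivX derivC addr0 -mul_polyC mulr1. Qed.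

Lemma lead_affine_poly a b : a != 0 -> lead_coef (affine_poly a b) = a.
Proof.
move=> a0; rewrite lead_coefE size_affine_poly // coefD coefZ coefX coefC.
by rewrite mulr1 addr0.
Qed.

Lemma coef_comp_translation d b m : (size d <= m.+2)%N ->
  (d \Po ('X + b%:P))`_m = d`_m + m.+1%:R * b * d`_m.+1.
Proof.
elim/poly_ind: d m => [|p c IH] m; first by rewrite comp_poly0 !coef0 mulr0 addr0.
rewrite comp_poly_MXaddC size_MXaddC => sz.
have sp : (size p <= m.+1)%N.
  by move: sz; case: ifP => [/andP[/eqP-> _]|_]; rewrite ?size_poly0.
rewrite mulrDr !coefD coefMX coefMC !coefMX !coefC addr0 /=.
have Em : (p \Po ('X + b%:P))`_m = p`_m.
  rewrite IH ?(leq_trans sp) // [p`_m.+1]nth_default //; ring.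
rewrite Em; case: m sz sp Em => [|m] sz sp Em /=; first by ring.
by rewrite IH // addr0 -[m.+2%:R]natr1; ring.
Qed.

(** Compare leading coefficients; for a translation these agree, and the next coefficient, which
    changes by deg(d) b times the leading one, is compared instead. *)
Lemma fixed_leading_index a b n d : a != 0 -> d != 0 -> (size d <= n)%N ->
  d \Po affine_poly a b = a ^+ n *: d ->
  a ^+ (n - (size d).-1) = 1 /\ (a = 1 -> (size d).-1%:R * b = 0).
Proof.
move=> a0 d0 dn E; have l0 : lead_coef d != 0 by rewrite lead_coef_eq0.
have sd : (0 < size d)%N by rewrite size_poly_gt0.
split.
  have := congr1 lead_coef E.
  rewrite lead_coef_comp ?size_affine_poly // lead_affine_poly // lead_coefZ mulrC.
  have -> : a ^+ n = a ^+ (n - (size d).-1) * a ^+ (size d).-1.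
    by rewrite -exprD subnK // (leq_trans (leq_pred _)).
  move/(mulIf l0)/eqP; rewrite -subr_eq0 -{1}[a ^+ _.-1]mul1r -mulrBl mulf_eq0.
  by rewrite (negPf (expf_neq0 _ a0)) orbF subr_eq0 => /eqP.
move=> a1; rewrite a1 expr1n scale1r /affine_poly scale1r in E.
have [m Em] : exists m, size d = m.+1 by exists (size d).-1; rewrite prednK.
rewrite Em /=; case: m Em => [|m] Em; first by rewrite mul0r.
have := coef_comp_translation b (eq_leq Em); rewrite E => /eqP.
rewrite -subr_eq0 opprD addNKr oppr_eq0 mulf_eq0.
have -> : d`_m.+1 = lead_coef d by rewrite lead_coefE Em.
by rewrite (negPf l0) orbF => /eqP.
Qed.

(** Halving is injective on a set of integers without consecutive members, and it maps the indices
    below 2g to those below g. *)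
Lemma card_no_consecutive g (J : pred nat) : ~~ J (2 * g)%N ->
  (forall i, J i -> ~~ J i.+1) -> (#|[pred i : 'I_(2 * g + 1) | J i]| <= g)%N.
Proof.
move=> Jg Jc; rewrite -[X in (_ <= X)%N]card_ord.
have lt (i : {i : 'I_(2 * g + 1) | J i}) : ((val i)./2 < g)%N.
  have Ji := valP i; have := ltn_ord (val i).
  have ne : nat_of_ord (val i) != (2 * g)%N by apply: contraNneq Jg => <-.
  by move: ne; lia.
rewrite -card_sig; apply: (@leq_card _ _ (fun i => Ordinal (lt i))).
move=> i j /(congr1 val) /= E; apply/val_inj/val_inj => /=.
have Ji := valP i; have Jj := valP j.
have [E1|ne1] := eqVneq (nat_of_ord (val j)) (val i).+1.
  by have := Jc _ Ji; rewrite -E1 Jj.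
have [E1|ne2] := eqVneq (nat_of_ord (val i)) (val j).+1.
  by have := Jc _ Jj; rewrite -E1 Ji.
have half_eq (m n : nat) : n != m.+1 -> m != n.+1 -> m./2 = n./2 -> m = n by lia.
exact: half_eq ne1 ne2 E.
Qed.

Definition fixed_set n a b := [set c : {ffun 'I_n -> k} |
  monic_of c \Po affine_poly a b == a ^+ n *: monic_of c].

(* The difference of two fixed polynomials is an eigenvector of the            *)
(* substitution, so its degree i satisfies a^(n - i) = 1, and i = 0 in k when   *)
(* a = 1; two consecutive indices never do, nor does n - 1.                     *)
Lemma card_fixed_set g a b : a != 0 -> (a != 1) || (b != 0) ->
  (#|fixed_set (2 * g + 1) a b| <= #|k| ^ g)%N.
Proof.
move=> a0 ab; set n := (2 * g + 1)%N.
have [->|[c0 Fc0]] := set_0Vmem (fixed_set n a b); first by rewrite cards0.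
(* For a translation by b != 0, the coefficient of degree n - 1 of a fixed monic polynomial changes
   by n b. This excludes the index n - 1 = 2g below. *)
have nb : a = 1 -> n%:R = 0 :> k.
  move=> a1; move: Fc0; rewrite inE a1 expr1n scale1r /affine_poly scale1r => /eqP E.
  have sz : (size (monic_of c0) <= (2 * g).+2)%N by rewrite size_monic_of /n addn1.
  have := coef_comp_translation b sz; rewrite E => /eqP.
  rewrite -subr_eq0 opprD addNKr oppr_eq0 mulf_eq0 -addn1 -/n.
  have -> : (monic_of c0)`_n = lead_coef (monic_of c0)
    by rewrite lead_coefE size_monic_of.
  rewrite (monicP (monic_of_monic c0)) oner_eq0 orbF mulf_eq0.
  by move: ab; rewrite a1 eqxx /= => /negPf ->; rewrite orbF => /eqP.
pose J := [pred i : nat | (i < n)%N && (a ^+ (n - i) == 1) && ((a == 1) ==> (i%:R == 0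
  :> k))].
have cJ : (#|[pred i : 'I_n | J i]| <= g)%N.
  apply: card_no_consecutive.
    rewrite /J /= /n addn1 ltnSn subSn // subnn expr1 /=; apply/negP.
    case/andP => /eqP a1; rewrite a1 eqxx /= => h.
    have := nb a1; rewrite /n addn1 -natr1 (eqP h) add0r => /eqP.
    by rewrite oner_eq0.
  move=> i /= /andP[/andP[lt1 /eqP E1] /implyP H1]; apply/negP.
  case/andP => /andP[lt2 /eqP E2] /implyP H2.
  have a1 : a = 1.
    have En : (n - i = (n - i.+1).+1)%N by lia.
    by move: E1; rewrite En exprS E2 mulr1.
  have := H2 (introT eqP a1); rewrite -natr1 (eqP (H1 (introT eqP a1))) add0r.
  by rewrite oner_eq0.
pose r (c : {ffun 'I_n -> k}) := [ffun i : {i : 'I_n | J i} => c (val i)].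
(* Two fixed polynomials agreeing on the indices in [J] coincide, as the degree of a nonzero
   difference would be such an index. *)
have inj : {in fixed_set n a b &, injective r}.
  move=> c c' Fc Fc' E; apply/ffunP => i0.
  pose d := monic_of c - monic_of c'.
  have dE : d = \sum_(i < n) (c i - c' i) *: 'X^i.
    rewrite /d /monic_of opprD addrACA subrr add0r -sumrB.
    by apply: eq_bigr => i _; rewrite scalerBl.
  suff d0 : d = 0.
    have := congr1 (fun p : {poly k} => p`_i0) d0; rewrite coef0 coefB !coefD !coef_lower.
    by rewrite coefXn ltn_eqF // !add0r => /eqP; rewrite subr_eq0 => /eqP.
  apply/eqP; apply: contraT => d0.
  have sd : (size d <= n)%N.
    rewrite dE; apply: (leq_trans (size_sum _ _ _)); apply/bigmax_leqP => i _.
    by rewrite (leq_trans (size_scale_leq _ _)) // size_polyXn.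
  have Ed : d \Po affine_poly a b = a ^+ n *: d.
    by move: Fc Fc'; rewrite !inE /d comp_polyB scalerBr => /eqP -> /eqP ->.
  have [H1 H2] := fixed_leading_index a0 d0 sd Ed.
  have s0 : (0 < size d)%N by rewrite size_poly_gt0.
  have lt : ((size d).-1 < n)%N by rewrite prednK.
  have Ji : J (Ordinal lt).
    rewrite /J /= lt H1 eqxx /=; apply/implyP => /eqP a1.
    by have /eqP := H2 a1; rewrite mulf_eq0; move: ab; rewrite a1 eqxx /= => /negPf ->;
      rewrite orbF.
  have := congr1 (fun h : {ffun {i : 'I_n | J i} -> k} => h (exist _ (Ordinal lt) Ji)) E.
  rewrite !ffunE /= => Ec; case/negP: d0; rewrite -lead_coef_eq0 lead_coefE.
  have -> : d`_(size d).-1 = c (Ordinal lt) - c' (Ordinal lt).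
    rewrite -[(size d).-1]/(nat_of_ord (Ordinal lt)) coefB !coefD !coef_lower.
    by rewrite opprD addrACA subrr add0r.
  by rewrite Ec subrr.
rewrite -(card_in_imset inj); apply: (leq_trans (max_card _)).
by rewrite card_ffun card_sig leq_exp2l // finNzRing_gt1.
Qed.

(** Evaluate f(a x + b) = a^n f(x) and its derivative at the fixed point z = b / (1 - a): f(z) = a^n
    f(z) and a f'(z) = a^n f'(z). Separability prevents f(z) and f'(z) from both vanishing. *)
Lemma fixed_separable_root n a b c : (0 < n)%N -> a != 0 -> a != 1 ->
  c \in fixed_set n a b -> c \in separable_set k n -> a ^+ n = 1 \/ a ^+ n.-1 = 1.
Proof.
move=> n0 a0 a1; rewrite !inE => /eqP E sep.
pose z := b / (1 - a); have a1' : 1 - a != 0 by rewrite subr_eq0 eq_sym.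
have Ez : (affine_poly a b).[z] = z.
  by rewrite hornerD hornerZ hornerX hornerC /z; field.
set f := monic_of c in E sep.
have E1 : f.[z] = a ^+ n * f.[z].
  by have := congr1 (horner^~ z) E; rewrite horner_comp Ez hornerZ.
have E2 : f^`().[z] * a = a ^+ n * f^`().[z].
  have := congr1 (fun p => p^`().[z]) E;
    rewrite deriv_comp derivZ hornerM horner_comp Ez hornerZ.
  by rewrite deriv_affine_poly hornerC.
have [fz0|fz0] := eqVneq f.[z] 0; last first.
  by left; apply: (mulIf fz0); rewrite mul1r -E1.
right; have f'z0 : f^`().[z] != 0.
  by move: sep; rewrite unlock => /coprimep_root; apply; apply/eqP.
apply: (mulIf a0); rewrite -exprSr prednK // mul1r; apply: (mulIf f'z0).
by rewrite -E2 mulrC.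
Qed.

Lemma card_unity_roots m : (0 < m)%N -> (#|[pred e : k | e ^+ m == 1%R]| <= m)%N.
Proof.
move=> m0; rewrite cardE -ltnS -(size_XnsubC (1 : k) m0).
apply: max_poly_roots; first by rewrite -size_poly_gt0 size_XnsubC.
  apply/allP => e; rewrite mem_enum inE => /eqP Ee.
  by rewrite /root !hornerE Ee subrr.
exact: enum_uniq.
Qed.
End FixedPolynomials.

Section AffineAction.
Variables (k : finFieldType) (n : nat).
Implicit Types (f : {poly k}) (c : {ffun 'I_n -> k}) (t : affine k).

(** The scalar e^(-2n) makes monic polynomials of degree n monic again. *)
Definition affine_subst t f : {poly k} :=
  val t.1 ^- (2 * n) *: (f \Po affine_poly (val t.1 ^+ 2) t.2).

Lemma unit_val_neq0 (u : {unit k}) : val u != 0.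
Proof. by rewrite -unitfE (valP u). Qed.

Lemma affine_substP t f f' : affine_subst t f = f' <->
  f \Po affine_poly (val t.1 ^+ 2) t.2 = val t.1 ^+ (2 * n) *: f'.
Proof.
have e0 : val t.1 ^+ (2 * n) != 0 by rewrite expf_neq0 // unit_val_neq0.
rewrite /affine_subst; split=> [<-|->].
  by rewrite scalerA mulfV // scale1r.
by rewrite scalerA mulVf // scale1r.
Qed.

Lemma affine_subst1 f : affine_subst 1%g f = f.
Proof.
by apply/affine_substP; rewrite /= !expr1n scale1r /affine_poly scale1r addr0 comp_polyXr.
Qed.

Lemma affine_substM t t' f : affine_subst (t * t')%g f = affine_subst t' (affine_subst
  t f).
Proof.
rewrite /affine_subst /= comp_polyZ scalerA exprMn invfM mulrC -comp_polyA.
congr (_ *: (f \Po _)).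
rewrite /affine_poly comp_polyD comp_polyZ comp_polyX comp_polyC exprMn.
by rewrite scalerDr scalerA -!mul_polyC !(polyCM, polyCD); ring.
Qed.

Lemma affine_subst_monic t c :
  affine_subst t (monic_of c) \is monic /\ size (affine_subst t (monic_of c)) = n.+1.
Proof.
have e0 := unit_val_neq0 t.1; have e20 := expf_neq0 2 e0.
split; last first.
  by rewrite size_scale ?invr_eq0 ?expf_neq0 // size_comp_poly2 ?size_monic_of
    ?size_affine_poly.
rewrite monicE lead_coefZ lead_coef_comp ?size_affine_poly // lead_affine_poly //.
rewrite (monicP (monic_of_monic c)) mul1r size_monic_of -exprM mulVf //.
by rewrite expf_neq0.
Qed.

Definition affine_act c t : {ffun 'I_n ->
  k} := lower_coefs n (affine_subst t (monic_of c)).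

Lemma monic_of_act c t : monic_of (affine_act c t) = affine_subst t (monic_of c).
Proof. by have [m s] := affine_subst_monic t c; apply: lower_coefsK. Qed.

Lemma affine_act1 c : affine_act c 1%g = c.
Proof. by rewrite /affine_act affine_subst1 monic_ofK. Qed.

Lemma affine_actM c t t' : affine_act c (t * t')%g = affine_act (affine_act c t) t'.
Proof. by rewrite {1 2}/affine_act affine_substM monic_of_act. Qed.

Definition affine_action := TotalAction affine_act1 affine_actM.

Local Notation G := [set: affine k].
Local Notation S := (separable_set k n).

Lemma affine_acts : [acts G, on S | affine_action].
Proof.
apply/actsP => t _ c; rewrite !inE /= monic_of_act /affine_subst.
have e0 := unit_val_neq0 t.1; have e20 := expf_neq0 2 e0.
set l := affine_poly _ _; set u := _ ^- _; set f := monic_of c.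
have u0 : u != 0 by rewrite invr_eq0 expf_neq0.
pose l' : {poly k} := (val t.1 ^+ 2)^-1 *: ('X - t.2%:P).
have ll' : l \Po l' = 'X.
  by rewrite /l comp_polyD comp_polyZ comp_polyX comp_polyC scalerA mulfV // scale1r
    subrK.
rewrite unlock derivZ deriv_comp deriv_affine_poly mulrC mul_polyC.
rewrite coprimepZl // !coprimepZr //.
apply/idP/idP => [/(coprimep_comp_poly l')|]; last exact: coprimep_comp_poly.
by rewrite -!comp_polyA ll' !comp_polyXr.
Qed.

Lemma affine_fix t : ('Fix_(S | affine_action)[t])%g = S :&: fixed_set n (val t.1 ^+ 2)
  t.2.
Proof.
apply/setP => c; rewrite !inE; congr (_ && _).
apply/subsetP/eqP => [H|H].
  have := H t (set11 t); rewrite inE => /eqP /(congr1 (@monic_of k n)).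
  by rewrite /= monic_of_act -exprM => /affine_substP.
move=> u /set1P ->; rewrite inE; apply/eqP.
apply: (can_inj (@monic_ofK k n)); rewrite /= monic_of_act.
by apply/affine_substP; rewrite exprM.
Qed.

Lemma affine_equivP c c' :
  affine_equiv n (monic_of c) (monic_of c') <-> c \in orbit affine_action G c'.
Proof.
split=> [[e [b [e0 E]]]|/orbitP[t _ <-]].
  apply/orbitP; exists (finField_unit e0, b); first by rewrite inE.
  apply: (can_inj (@monic_ofK k n)); rewrite /= monic_of_act.
  exact/affine_substP.
exists (val t.1), t.2; split; first exact: unit_val_neq0.
by apply/affine_substP; rewrite /= monic_of_act.
Qed.
End AffineAction.

(** * Burnside's formula and the error term *)

Section OrbitCount.
Variables (k : finFieldType) (g : nat).
Hypotheses (k2 : 2%:R != 0 :> k) (g0 : (0 < g)%N).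
Local Notation n := (2 * g + 1)%N.
Local Notation G := [set: affine k].
Local Notation S := (separable_set k n).
Local Notation N := #|orbit (affine_action k n) G @: S|.

Let Burnside : (\sum_(t in G) #|S :&: fixed_set n (val t.1 ^+ 2) t.2| =
  N * (#|k|.-1 * #|k|))%N.
Proof.
rewrite -card_affine -(Frobenius_Cauchy (affine_acts k n)).
by apply: eq_bigr => t _; rewrite affine_fix.
Qed.

Let trivial_elt (t : affine k) := (val t.1 ^+ 2 == 1) && (t.2 == 0).

Let card_trivial : #|[set t | trivial_elt t]| = 2%N.
Proof.
have m10 : -1 != 0 :> k by rewrite oppr_eq0 oner_eq0.
have -> : [set t | trivial_elt t] = [set (1%g, 0); (finField_unit m10, 0)].
  apply/setP => -[u b]; rewrite !inE /trivial_elt /= sqrf_eq1 -!pair_eqE /pair_eq /=.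
  by rewrite -!(inj_eq val_inj) /= -andb_orl.
rewrite cards2 -pair_eqE /pair_eq /= eqxx andbT -(inj_eq val_inj) /=.
by rewrite eq_sym -subr_eq0 -opprD oppr_eq0 -[1 + 1]/(2%:R) k2.
Qed.

Let sum_trivial :
  (\sum_(t in G | trivial_elt t) #|S :&: fixed_set n (val t.1 ^+ 2) t.2| = 2 * #|S|)%N.
Proof.
transitivity (\sum_(t in [set t | trivial_elt t]) #|S|)%N; last first.
  by rewrite sum_nat_const card_trivial.
apply: eq_big => [t|t /andP[_ /andP[/eqP E1 /eqP E2]]]; first by rewrite !inE.
congr #|pred_of_set _|; apply/setIidPl/subsetP => c _.
by rewrite inE E1 E2 expr1n scale1r /affine_poly scale1r addr0 comp_polyXr.
Qed.

Let unity m := [set u : {unit k} | val u ^+ m == 1].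

Let card_unity m : (0 < m)%N -> (#|unity m| <= m)%N.
Proof.
move=> m0; apply: leq_trans (card_unity_roots k m0).
rewrite -(card_imset _ val_inj); apply/subset_leq_card/subsetP => e /imsetP[u].
by rewrite inE => Eu ->; rewrite inE.
Qed.

(** An element (e, b) fixing a separable polynomial has e^2 = 1, e^(2n) = 1 or e^(4g) = 1. This
    leaves at most 2 + 2n + 4g = 4n values of e and q values of b, each pair fixing at most q^g
    polynomials. *)
Let sum_nontrivial :
  (\sum_(t in G | ~~ trivial_elt t) #|S :&: fixed_set n (val t.1 ^+ 2) t.2|
   <= 4 * n * #|k| ^ g.+1)%N.
Proof.
pose E := unity 2 :|: unity (2 * n) :|: unity (2 * (2 * g)).
have cE : (#|E| <= 4 * n)%N.
  have := card_unity (isT : 0 < 2)%N.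
  have := @card_unity (2 * n)%N; have := @card_unity (2 * (2 * g))%N.
  have := cardsU (unity 2 :|: unity (2 * n)) (unity (2 * (2 * g))).
  have := cardsU (unity 2) (unity (2 * n)).
  rewrite -/E; lia.
pose B : {set affine k} := [set t | t.1 \in E].
have cB : (#|B| <= 4 * n * #|k|)%N.
  have -> : B = setX E [set: k] by apply/setP => -[u b]; rewrite !inE andbT.
  by rewrite cardsX cardsT leq_mul2r cE orbT.
apply: (@leq_trans (\sum_(t in B) #|k| ^ g)); last first.
  by rewrite sum_nat_const expnS mulnA leq_mul2r cB orbT.
rewrite [X in (X <= _)%N](bigID (mem B)) /= addnC big1 ?add0n =>
  [|t /andP[/andP[_ nt] nB]].
  rewrite [X in (X <= _)%N](eq_bigl (fun t => ~~ trivial_elt t && (t \in B))); last first.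
    by move=> t; rewrite inE.
  apply: (@leq_trans (\sum_(t | ~~ trivial_elt t && (t \in B)) #|k| ^ g)).
    apply: leq_sum => t /andP[nt _].
    apply: leq_trans (subset_leq_card (subsetIr _ _)) (card_fixed_set g _ _).
      by rewrite expf_neq0 // unit_val_neq0.
    by rewrite -negb_and.
  rewrite [X in (_ <= X)%N](bigID (fun t => ~~ trivial_elt t)) /=.
  by rewrite (eq_bigl _ _ (fun t => andbC _ _)) leq_addr.
apply/eqP; rewrite cards_eq0; apply/eqP/setP => c; rewrite in_set0; apply/negP.
case/setIP => cS cF; case/negP: nB; rewrite !inE.
have [e1|e1] := eqVneq (val t.1 ^+ 2) 1; first by [].
have e0 := expf_neq0 2 (unit_val_neq0 t.1).
have n0 : (0 < n)%N by rewrite addn1.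
have [Ee|Ee] := fixed_separable_root n0 e0 e1 cF cS; rewrite -exprM addn1 /= in Ee *.
  by rewrite Ee eqxx.
by rewrite Ee eqxx orbT.
Qed.

(** The set S has q^(2g-1) M elements, where M = q (q - 1) is the order of the group, so after
    division by M the trivial elements give the main term exactly. The remaining sum is nonnegative
    and at most 4n q^2 q^(g-1), where q^2 is at most 2M. *)
Lemma orbit_count_bound :
  (2 * #|k| ^ (2 * g - 1) <= N <= 2 * #|k| ^ (2 * g - 1) + 8 * n * #|k| ^ (g - 1))%N.
Proof.
have q1 : (1 < #|k|)%N := finNzRing_gt1 k.
have cS : (#|S| = #|k| ^ (2 * g - 1) * (#|k|.-1 * #|k|))%N.
  have En : n = (2 * g - 1).+2 by lia.
  have := card_separable_set k (2 * g - 1); rewrite -En => H.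
  have E2 : (#|k| ^ n = #|k| * (#|k| * #|k| ^ (2 * g - 1)))%N by rewrite -!expnS -En.
  move: H; rewrite E2 expnS.
  case: #|k| q1 => // q _; move: (q.+1 ^ _)%N => Q /= H.
  by apply/eqP; rewrite -(eqn_add2r (q.+1 * Q)) H; apply/eqP; ring.
have := Burnside; rewrite (bigID trivial_elt) /= sum_trivial => H.
have Eg : (#|k| ^ g.+1 = #|k| * #|k| * #|k| ^ (g - 1))%N.
  by rewrite -mulnA -!expnS; congr (_ ^ _)%N; lia.
have HR := sum_nontrivial; rewrite cS in H; rewrite Eg in HR.
move: H HR; set M := (#|k|.-1 * #|k|)%N; set R := (\sum_(_ | _) _)%N => H HR.
have M0 : (0 < M)%N by rewrite muln_gt0; lia.
have q2M : (#|k| * #|k| <= 2 * M)%N.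
  by rewrite /M mulnA leq_mul2r; apply/orP; right; lia.
apply/andP; split; rewrite -(leq_pmul2r M0); first by rewrite -H -mulnA leq_addr.
rewrite -H mulnDl -mulnA leq_add2l; apply: leq_trans HR _.
have -> (T : nat) : (8 * n * T * M = 4 * n * (2 * M * T))%N by ring.
by rewrite leq_mul2l leq_mul2r q2M !orbT.
Qed.

(** One curve is chosen for a polynomial in each orbit; [pointed_isomorphicP] and [affine_equivP]
    make these curves a system of representatives. *)
Lemma pointed_count : hyp_pointed_count k g N.
Proof.
have rep (i : 'I_N) : exists c, c \in S /\ enum_val i = orbit (affine_action k n) G c.
  by have /imsetP[c cS E] := enum_valP i; exists c.
have [c Hc] := fin_all_exists rep.
have goodE d : good_poly g (monic_of (d : {ffun 'I_n -> k})) <-> d \in S.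
  rewrite inE; split=> [[]|sep]; first by [].
  by split=> //; [exact: monic_of_monic|rewrite size_monic_of; lia].
have repC (i : 'I_N) : exists C : pointed_hyperelliptic_curve k g,
  represents C (monic_of (c i)).
  by apply: represented_exists => //; apply/goodE; case: (Hc i).
have [r Hr] := fin_all_exists repC.
exists r; split.
- move=> i j /(pointed_isomorphicP k2 g0 (Hr i) (Hr j)).
  have gi := (goodE (c i)).2 (Hc i).1; have gj := (goodE (c j)).2 (Hc j).1.
  move=> /(_ gi gj)/affine_equivP/orbit_eqP E.
  by apply: enum_val_inj; rewrite (Hc i).2 (Hc j).2 E.
- move=> C; have [f gf Cf] := every_represented k2 C.
  have Ef : monic_of (lower_coefs n f) = f.
    by case: gf => mf _ sf; apply: lower_coefsK; rewrite // sf; lia.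
  set d := lower_coefs n f in Ef; have dS : d \in S by apply/goodE; rewrite Ef.
  have Od := imset_f (orbit (affine_action k n) G) dS.
  exists (enum_rank_in Od (orbit (affine_action k n) G d)).
  set i := enum_rank_in _ _.
  have gi := (goodE (c i)).2 (Hc i).1.
  apply/(pointed_isomorphicP k2 g0 Cf (Hr i) gf gi).
  rewrite -Ef; apply/affine_equivP; rewrite -(Hc i).2 enum_rankK_in //.
  exact: orbit_refl.
Qed.
End OrbitCount.

Theorem corollary3p3 (g : nat) (hg : (1 < g)%N) :
  exists c : nat, forall k : finFieldType, odd #|k| ->
    exists N : nat,
      hyp_pointed_count k g N /\
      `| N%:Z - 2 * #|k|%:Z ^+ (2 * g - 1) | <= c%:Z * #|k|%:Z ^+ (g - 1).
Proof.
exists (8 * (2 * g + 1))%N => k odd_k.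
have g0 : (0 < g)%N by apply: ltnW.
have k2 : 2%:R != 0 :> k.
  (* The order of k is a power of its characteristic, so an odd order excludes characteristic 2. *)
  have [p pr_p chp] := finPcharP k.
  have [m Em] : exists m, #|k| = (p ^ m)%N by rewrite (card_pprimeChar chp); eexists.
  rewrite -(dvdn_pcharf chp) dvdn_prime2 //; apply: contraTneq odd_k => p2.
  have m0 : m != 0%N by apply: contra_eq_neq Em => ->; rewrite gtn_eqF // finNzRing_gt1.
  by rewrite Em p2 oddX orbF.
have := orbit_count_bound k2 g0; have := pointed_count k2 g0.
set N := #|_| => HN /andP[lo hi]; exists N; split=> //.
have powz m : #|k|%:Z ^+ m = (#|k| ^ m)%N%:Z.
  by elim: m => // m IH; rewrite exprS IH expnS PoszM.
rewrite !powz; lia.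
Qed.
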